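(* Let $I\subset\mathbb{R}$ be an interval not containing $0$ and let $f_0\in\mathcal{F}(\mathbb{E}^{n+1};I)$ be arbitrary. Then $$\Psi\colon\mathrm{Diff}_+(\mathbb{S}^n)\to\mathcal{F}(\mathbb{E}^{n+1};I),\quad g\mapsto f_0\circ g,$$ is a homotopy equivalence. In the other direction, $\Phi\colon f\mapsto\nu_f$ is a homotopy equivalence between $\mathcal{F}(\mathbb{E}^{n+1};I)$ and $\mathrm{Diff}_{\pm}(\mathbb{S}^n)$, the sign being positive unless $I>0$ (all elements of $I$ are positive) and $n$ is odd.
   Context: Throughout, $n\ge 2$ is an integer; all manifolds are connected, oriented and smooth ($C^\infty$); maps between manifolds are smooth, and sets of maps carry the $C^\infty$-topology. $\mathbb{E}^{n+1}$ is Euclidean space with the canonical orientation. $\mathbb{S}^n\subset\mathbb{R}^{n+1}$ is the unit sphere, oriented so that $(u_1,\dots,u_n)$ is a positive frame of $T\mathbb{S}^n_p$ iff $(u_1,\dots,u_n,p)$ is a positive frame of $\mathbb{R}^{n+1}$. For an immersion $f\colon N^n\to\mathbb{E}^{n+1}$, the Gauss map is the unit normal $\nu_f$ determined by: $(u_1,\dots,u_n)$ is a positively oriented orthonormal frame of $TN_p$ (induced metric) if and only if $(df_p(u_1),\dots,df_p(u_n),\nu_f(p))$ is a positively oriented orthonormal frame of $\mathbb{R}^{n+1}$; it is regarded as a map $\nu_f\colon N\to\mathbb{S}^n$. The shape operator is $S=-df^{-1}\circ d\nu_f$; its eigenvalues are the principal curvatures of $f$. $\mathcal{F}(\mathbb{E}^{n+1};I)$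 is the space of immersions $\mathbb{S}^n\to\mathbb{E}^{n+1}$ all of whose principal curvatures lie in $I$. $\mathrm{Diff}_+(\mathbb{S}^n)$ and $\mathrm{Diff}_-(\mathbb{S}^n)$ are the spaces of orientation-preserving and orientation-reversing diffeomorphisms of $\mathbb{S}^n$. When $0\notin I$, $\nu_f$ is a diffeomorphism of $\mathbb{S}^n$ for every $f\in\mathcal{F}(\mathbb{E}^{n+1};I)$. *)

(* Defs.v *)
From HB Require Import structures.
From mathcomp Require Import all_boot all_order all_algebra.
From mathcomp Require Import all_classical all_reals all_analysis.

Set Implicit Arguments.
Unset Strict Implicit.
Unset Printing Implicit Defensive.

Import Order.TTheory GRing.Theory Num.Theory.
Import numFieldNormedType.Exports.

Local Open Scope classical_set_scope.
Local Open Scope ring_scope.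

Section Homotopy.
Context {R : realType}.

Definition homotopic_in {X Y : topologicalType} (A : set X) (B : set Y)
    (f g : X -> Y) : Prop :=
  exists H : X * R -> Y,
    [/\ {within A `*` `[0, 1]%classic, continuous H},
        (forall x t, A x -> 0 <= t <= 1 -> B (H (x, t))),
        (forall x, A x -> H (x, 0) = f x) &
        (forall x, A x -> H (x, 1) = g x)].

(** [f] restricts to a homotopy equivalence from the subspace [A] of [X] to the
    subspace [B] of [Y]; in particular it maps [A] into [B]. *)
Definition homotopy_equivalence {X Y : topologicalType} (A : set X) (B : set Y)
    (f : X -> Y) : Prop :=
  [/\ set_fun A B f, {within A, continuous f} &
      exists g : Y -> X,
        [/\ set_fun B A g, {within B, continuous g},
            homotopic_in A A (g \o f) id & homotopic_in B B (f \o g) id]].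

End Homotopy.
Arguments homotopy_equivalence R {X Y} A B f.

Section Euclidean.
Context {R : realType} {n : nat}.

Definition dot (u v : 'rV[R]_n) : R := \sum_i u 0 i * v 0 i.

(** The library norm on ['rV[R]_n] is the sup norm. *)
Definition enorm (u : 'rV[R]_n) : R := Num.sqrt (dot u u).

Definition orthonormal k (w : k.-tuple 'rV[R]_n) : Prop :=
  forall i j, dot (tnth w i) (tnth w j) = (i == j)%:R.

Definition frame_det (w : n.-tuple 'rV[R]_n) : R :=
  \det (\matrix_(i < n) tnth w i).

Definition partials {m} (s : seq 'I_n) (F : 'rV[R]_n -> 'rV[R]_m) :
    'rV[R]_n -> 'rV[R]_m :=
  foldr (fun i G => 'D_(delta_mx 0 i) G) F s.

Definition smooth_on {m} (U : set 'rV[R]_n) (F : 'rV[R]_n -> 'rV[R]_m) : Prop :=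
  forall s x, U x -> differentiable (partials s F) x.

End Euclidean.

Definition sphere (R : realType) (n : nat) : set 'rV[R]_n.+1 :=
  [set x | dot x x = 1].
Arguments sphere R n : clear implicits.

Section SphereCalculus.
Context {R : realType} {n : nat}.
Local Notation S := (set_type (sphere R n)).

(** The extension x |-> f (x / |x|) of [f] to R^(n+1) minus the origin, with
    junk value 0 at the origin.  Since x |-> x / |x| is a smooth retraction onto
    the sphere, [f] is smooth on the submanifold S^n iff this extension is smooth
    away from the origin, and the differential of [f] at [p] ([sdiff] below) is
    the restriction to T_p S^n of the differential of the extension at [p]. *)
Definition radial_ext {m} (f : S -> 'rV[R]_m) (x : 'rV[R]_n.+1) : 'rV[R]_m :=
  oapp f 0 (insub ((enorm x)^-1 *: x)).

Definition smooth {m} (f : S -> 'rV[R]_m) : Prop :=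
  smooth_on [set x | x != 0] (radial_ext f).

Definition tangent (p : S) (v : 'rV[R]_n.+1) : Prop := dot v (val p) = 0.

Definition sdiff {m} (f : S -> 'rV[R]_m) (p : S) (v : 'rV[R]_n.+1) : 'rV[R]_m :=
  'D_v (radial_ext f) (val p).

Definition jet {m} (f : S -> 'rV[R]_m) :
    {ptws seq 'I_n.+1 -> {uniform S -> 'rV[R]_m}} :=
  fun s p => partials s (radial_ext f) (val p).

End SphereCalculus.

(** Maps from S^n to R^m with the C^oo-topology: uniform convergence on the
    compact manifold S^n of all partial derivatives, of all orders.  The carrier
    also contains non-smooth maps, for which derivatives are junk; only subspaces
    consisting of smooth maps are ever used. *)
Definition Cinfty (R : realType) (n m : nat) : Type :=
  initial_topology (@jet R n m).

HB.instance Definition _ (R : realType) (n m : nat) :=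
  Topological.copy (Cinfty R n m) (initial_topology (@jet R n m)).

Definition post_incl {R : realType} {n : nat}
    (g : set_type (sphere R n) -> set_type (sphere R n)) : Cinfty R n n.+1 :=
  fun p => val (g p).

(** Maps from S^n to itself, with the topology induced from the inclusion of S^n
    in R^(n+1). *)
Definition Cinfty_self (R : realType) (n : nat) : Type :=
  initial_topology (@post_incl R n).

HB.instance Definition _ (R : realType) (n : nat) :=
  Topological.copy (Cinfty_self R n) (initial_topology (@post_incl R n)).

Section Diffeomorphisms.
Context {R : realType} {n : nat}.
Local Notation S := (set_type (sphere R n)).

Definition tangent_frame (p : S) (u : n.-tuple 'rV[R]_n.+1) : Prop :=
  forall i, tangent p (tnth u i).

(** Outward normal last: (u_1, ..., u_n) is positive at [p] iff
    (u_1, ..., u_n, p) is positive in R^(n+1). *)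
Definition positive_frame (p : S) (u : n.-tuple 'rV[R]_n.+1) : Prop :=
  tangent_frame p u /\ 0 < frame_det [tuple of rcons u (val p)].

Definition negative_frame (p : S) (u : n.-tuple 'rV[R]_n.+1) : Prop :=
  tangent_frame p u /\ frame_det [tuple of rcons u (val p)] < 0.

Definition diffeomorphism (g : S -> S) : Prop :=
  smooth (post_incl g) /\
  exists h : S -> S, [/\ smooth (post_incl h), cancel g h & cancel h g].

Definition push_frame {m} (f : S -> 'rV[R]_m) (p : S)
    (u : n.-tuple 'rV[R]_n.+1) : n.-tuple 'rV[R]_m :=
  [tuple of map (sdiff f p) u].

Definition orientation_preserving (g : S -> S) : Prop :=
  forall p u, positive_frame p u ->
    positive_frame (g p) (push_frame (post_incl g) p u).

Definition orientation_reversing (g : S -> S) : Prop :=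
  forall p u, positive_frame p u ->
    negative_frame (g p) (push_frame (post_incl g) p u).

End Diffeomorphisms.

Definition Diff_plus (R : realType) (n : nat) : set (Cinfty_self R n) :=
  [set g | diffeomorphism g /\ orientation_preserving g].

Definition Diff_minus (R : realType) (n : nat) : set (Cinfty_self R n) :=
  [set g | diffeomorphism g /\ orientation_reversing g].
Arguments Diff_plus R n : clear implicits.
Arguments Diff_minus R n : clear implicits.

Section Immersions.
Context {R : realType} {n : nat}.
Local Notation S := (set_type (sphere R n)).
Implicit Types f : S -> 'rV[R]_n.+1.

Definition immersion f : Prop :=
  smooth f /\ forall p v, tangent p v -> sdiff f p v = 0 -> v = 0.

(** [N] is the unit normal of [f] at [p]; [orthonormal (push_frame f p u)] says
    that [u] is orthonormal for the metric induced by [f]. *)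
Definition gauss_normal f (p N : S) : Prop :=
  forall u : n.-tuple 'rV[R]_n.+1, tangent_frame p u ->
    (positive_frame p u /\ orthonormal (push_frame f p u)) <->
    (orthonormal [tuple of rcons (push_frame f p u) (val N)] /\
     0 < frame_det [tuple of rcons (push_frame f p u) (val N)]).

(** The default value [p] is irrelevant: an immersion has exactly one unit normal
    at each point. *)
Definition gauss_map (f : Cinfty R n n.+1) : Cinfty_self R n :=
  fun p => xget p [set N | gauss_normal f p N].

(** - df_p^-1 o d(nu_f)_p: the [xget] picks the unique preimage under df_p, which
    is injective on T_p S^n with image the orthogonal of nu_f(p). *)
Definition shape_operator f (p : S) (v : 'rV[R]_n.+1) : 'rV[R]_n.+1 :=
  - xget 0 [set w | tangent p w /\
                    sdiff f p w = sdiff (post_incl (gauss_map f)) p v].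

Definition principal_curvature f (p : S) (k : R) : Prop :=
  exists v, [/\ tangent p v, v != 0 & shape_operator f p v = k *: v].

End Immersions.

Definition curvature_space (R : realType) (n : nat) (I : set R) :
    set (Cinfty R n n.+1) :=
  [set f | immersion f /\ forall p k, principal_curvature f p k -> I k].
Arguments curvature_space {R} n I.

(* Main.v *)
(** Along the sphere, an immersion [f] and its Gauss map [nu] have differentials with
    values in the hyperplanes orthogonal to [nu], and [df o dnu^-1] is self-adjoint
    there, with eigenvalues [-1/k] for [k] the principal curvatures. As [I] is an
    interval that avoids [0], having all principal curvatures in [I] amounts to bounds
    on the Rayleigh quotient of [df o dnu^-1]; hence the immersions with curvatures in
    [I] and a prescribed Gauss map form a convex set. Since the Gauss map of [f o g] is
    [nu o g] for [g] in [Diff_+], the immersions [f] and [f0 o nu_f0^-1 o nu_f] have the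
    same Gauss map, and the segment between them is the homotopy showing that
    [f |-> nu_f0^-1 o nu_f] and [g |-> f0 o nu_f0^-1 o g] are homotopy inverses.

    The Gauss map is a diffeomorphism because it is a local one and, for [n >= 2], a
    local homeomorphism of the sphere is injective: a path joining two points of a
    fibre, chosen to avoid the fibre over the antipode, has an image that contracts
    along great circles, and this homotopy lifts. Continuity for the C^oo topology
    comes from the formula for the Gauss map as a normalized determinant in the first
    derivatives of the immersion, and from the chain and product rules. *)
From HB Require Import structures.
Require Import Defs.
From mathcomp Require Import all_boot all_order all_algebra.
From mathcomp Require Import all_classical all_reals all_analysis.
From mathcomp Require Import ring lra.
Import Order.TTheory GRing.Theory Num.Theory.
Import numFieldNormedType.Exports.
Set Implicit Arguments.
Unset Strict Implicit.
Unset Printing Implicit Defensive.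
Local Open Scope classical_set_scope.
Local Open Scope ring_scope.

(** * Calculus of families of functions *)

(** Smoothness of one map and convergence of maps in the C^oo topology are instances of a single
    predicate, [Ck_family]; each closure property (products, roots, composition, Gauss maps) is
    proved once and yields both. Tangent spaces are not parametrized: a differential at [p] is a
    square matrix killing [p], and adding [p^T *m nu] makes it invertible, so that ranks and
    orientations become determinants in R^(n+1).

    The Rayleigh bounds are attained, hence are reciprocals of elements of [I]; this is how
    intervals with open or infinite ends survive convex combinations. The sign rule comes from
    [dnu = - df o S]: if [I] is positive, [dnu v] pairs negatively with [df v], so the nondegenerate
    segment joins [dnu] to [- df], which contributes the factor [(-1) ^+ n].

    One composite is exact in each equivalence: [f0 o nu_f0^-1 o g] has Gauss map [g], and
    [nu_f0^-1 o nu_(f0 o g)] is [g]. Of the four homotopies, two are therefore constant, and the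
    other two coincide. *)

Section DifferentiableEps.
Context {R : realType} {V W : normedModType R}.
Implicit Types f g : V -> W.

Lemma differentiable_eps f x e : differentiable f x -> 0 < e ->
  \forall y \near x, `|f y - f x - 'd f x (y - x)| <= e * `|y - x|.
Proof.
move=> /diff_locallyP [_ /eqaddoP fE] e0.
rewrite (near_shift 0) /=.
have := fE e e0; apply: filterS => y /=.
by rewrite !fctE /= subr0 addrK opprD addrA.
Qed.

Lemma eps_differentiable f (L : {linear V -> W}) x : continuous L ->
  (forall e, 0 < e ->
    \forall y \near x, `|f y - f x - L (y - x)| <= e * `|y - x|) ->
  differentiable f x /\ 'd f x = L :> (V -> W).
Proof.
move=> Lc fL.
have H : f \o shift x = cst (f x) + L +o_ 0 id.
  apply/eqaddoP => e e0.
  have := fL e e0; rewrite (near_shift 0) /=; apply: filterS => y /=.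
  by rewrite !fctE /= subr0 addrK opprD addrA.
have dE := diff_unique Lc H.
split => //; apply/diff_locallyP; rewrite dE; split => //.
Qed.

Lemma near_eq_differentiable f g x : (\near x, f x = g x) ->
  differentiable f x -> differentiable g x.
Proof.
move=> fg df; apply: proj1; apply: (@eps_differentiable _ ('d f x)).
  exact: diff_continuous.
move=> e e0; have fgx := nbhs_singleton fg.
by apply: filterS2 fg (differentiable_eps df e0) => y; rewrite fgx => ->.
Qed.

End DifferentiableEps.

Section CoordinateCalculus.
Context {R : realType} {N : nat}.
Local Notation E := 'rV[R]_N.

Definition pderiv (i : 'I_N) (F : E -> R) : E -> R := 'D_(delta_mx 0 i) F.

Definition pderivs (s : seq 'I_N) (F : E -> R) : E -> R := foldr pderiv F s.

Lemma differentiable_row m (F : E -> 'rV[R]_m) x :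
  (forall j, differentiable (fun y => F y 0 j) x) -> differentiable F x.
Proof.
move=> dF.
have -> : F = \sum_(j < m) (fun y => F y 0 j *: (delta_mx 0 j : 'rV[R]_m)).
  apply/funext => y; rewrite fct_sumE [LHS]row_sum_delta.
  by apply: eq_bigr => j _.
by apply: differentiable_sum => j; apply: differentiableZl.
Qed.

Lemma differentiable_coordf m (F : E -> 'rV[R]_m) x j :
  differentiable F x -> differentiable (fun y => F y 0 j) x.
Proof.
move=> dF; apply: (@differentiable_comp _ _ _ _ F (fun M : 'rV[R]_m => M 0 j)) => //.
exact: differentiable_coord.
Qed.

Lemma derive_coord m (F : E -> 'rV[R]_m) x v j : differentiable F x ->
  ('D_v F x) 0 j = 'D_v (fun y => F y 0 j) x.
Proof. by move=> dF; rewrite derive_mx ?mxE//; apply: diff_derivable. Qed.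

Lemma derive_pderiv (F : E -> R) x v : differentiable F x ->
  'D_v F x = \sum_i v 0 i * pderiv i F x.
Proof.
move=> dF; rewrite deriveE // [in LHS](row_sum_delta v) linear_sum.
by apply: eq_bigr => i _; rewrite linearZ /pderiv deriveE.
Qed.

Lemma pderiv_comp m (Phi : 'rV[R]_m -> R) (G : E -> 'rV[R]_m) x i :
  differentiable G x -> differentiable Phi (G x) ->
  'D_(delta_mx 0 i) (Phi \o G) x =
  \sum_j 'D_(delta_mx 0 j) Phi (G x) * pderiv i (fun y => G y 0 j) x.
Proof.
move=> dG dPhi; rewrite deriveE; last exact: differentiable_comp.
rewrite diff_comp //= -[X in 'd _ _ X]deriveE // [in LHS](row_sum_delta ('D_ _ G x)) linear_sum.
apply: eq_bigr => j _; rewrite linearZ /= -deriveE // mulrC; congr (_ * _).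
by rewrite derive_coord.
Qed.

End CoordinateCalculus.

Section Families.
Context {R : realType}.

Section Def.
Context {N : nat}.
Local Notation E := 'rV[R]_N.
Context {T : Type}.
Variables (F : set_system T) (A : set T) (t0 : T) (K U : set E).

(** For a compact [K] the first condition, imposed on all partial derivatives of
    order at most [k], says that they converge uniformly on [K] to those of [G t0];
    in this pointwise form it is stable under composition. With [T = unit] and
    [K = set0] the predicate reduces to differentiability of order [k]. *)
Fixpoint Ck_family k (G : T -> E -> R) : Prop :=
  [/\ (forall x, K x ->
        G q.1 q.2 @[q --> filter_prod F (within K (nbhs x))] --> G t0 x),
      (forall t x, A t -> U x -> differentiable (G t) x) &
      if k is k'.+1 then forall i, Ck_family k' (fun t => pderiv i (G t)) else True].

End Def.

Section Closure.
Context {N : nat}.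
Local Notation E := 'rV[R]_N.
Context {T : Type}.
Variables (F : set_system T) (A : set T) (t0 : T) (K U : set E).
Hypotheses (FF : Filter F) (FA : F A) (At0 : A t0) (oU : open U) (KU : K `<=` U).
Local Notation Ck_family := (Ck_family F A t0 K U).
Implicit Types G : T -> E -> R.

Let FW x : Filter (filter_prod F (within K (nbhs (x : E)))).
Proof. by apply: filter_prod_filter. Qed.

Lemma filter_prod_near (x : E) :
  \forall q \near filter_prod F (within K (nbhs x)), A q.1 /\ K q.2.
Proof.
exists (A, K) => //=; split => //.
by rewrite /within /=; apply: filterE.
Qed.

Lemma Ck_family_cvg k G x : Ck_family k G -> K x ->
  G q.1 q.2 @[q --> filter_prod F (within K (nbhs x))] --> G t0 x.
Proof. by case: k => [|k] [+ _ _]; apply. Qed.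

Lemma Ck_family_diff k G t x : Ck_family k G -> A t -> U x -> differentiable (G t) x.
Proof. by case: k => [|k] [_ + _]; apply. Qed.

Lemma Ck_family_pred k G : Ck_family k.+1 G -> Ck_family k G.
Proof.
elim: k G => [|k IH] G [c d H]; split => // i; exact: IH (H i).
Qed.

(** Openness of [U] lets an equality on [U] pass to derivatives, and [K] inside [U] lets it pass to
    the limits; every explicit derivative formula below is fed into the induction on [k] through
    this lemma. *)
Lemma Ck_family_ext k G G' : (forall t x, A t -> U x -> G t x = G' t x) ->
  Ck_family k G -> Ck_family k G'.
Proof.
have ext0 G1 G2 : (forall t x, A t -> U x -> G1 t x = G2 t x) -> Ck_family 0 G1 -> Ck_family 0 G2.
  move=> GG [c d _]; split => // [x Kx|t x At Ux].
    rewrite -GG //; last exact: KU.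
    apply: cvg_trans (c x Kx); apply: near_eq_cvg.
    apply: filterS (filter_prod_near x) => -[t y] /= [At /KU Uy].
    by rewrite GG.
  apply: near_eq_differentiable (d _ _ At Ux).
  by near=> y; apply: GG => //; near: y; apply: open_nbhs_nbhs.
elim: k G G' => [|k IH] G G' GG; first exact: ext0.
move=> [c d H]; have [c' d' _] := ext0 _ _ GG (And3 c d Logic.I).
split => // i; apply: IH (H i) => t x At Ux.
apply: near_eq_derive; near=> y; apply: GG => //; near: y.
exact: open_nbhs_nbhs.
Unshelve. all: by end_near.
Qed.

Lemma Ck_family_param k (a : T -> R) : a @ F --> a t0 -> Ck_family k (fun t _ => a t).
Proof.
elim: k a => [|k IH] a ca; split => //.
- move=> x Kx; apply: (@cvg_comp _ _ _ fst a) ca; exact: cvg_fst.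
- move=> x Kx; apply: (@cvg_comp _ _ _ fst a) ca; exact: cvg_fst.
- move=> i; apply: (@Ck_family_ext _ (fun _ _ => 0)); last by apply: IH; apply: cvg_cst.
  by move=> t x _ _; rewrite /pderiv derive_cst.
Qed.

Lemma Ck_family_cst k (c : R) : Ck_family k (fun _ _ => c).
Proof. by apply: (Ck_family_param k (a := fun=> c)); apply: cvg_cst. Qed.

Lemma Ck_family_coord k i : Ck_family k (fun _ x => x 0 i).
Proof.
have c x : K x -> (fun q : T * E => q.2 0 i) @
    filter_prod F (within K (nbhs x)) --> x 0 i.
  move=> Kx; apply: (@cvg_comp _ _ _ snd (fun y : E => y 0 i)).
    apply: cvg_trans; [exact: cvg_snd|exact: cvg_within].
  exact: coord_continuous.
have d (t : T) (x : E) : A t -> U x -> differentiable (fun x : E => x 0 i) x.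
  by move=> *; apply: differentiable_coord.
case: k => [|k]; split => // j.
apply: (@Ck_family_ext _ (fun _ _ => (delta_mx 0 j : E) 0 i)); last exact: Ck_family_cst.
move=> t x _ _; rewrite /pderiv -(derive_coord _ _ (F := id)) ?derive_id //.
Qed.

Lemma Ck_family_add k G1 G2 : Ck_family k G1 -> Ck_family k G2 -> Ck_family k (fun t x => G1 t x + G2 t x).
Proof.
elim: k G1 G2 => [|k IH] G1 G2 H1 H2; split => //.
- by move=> x Kx; apply: cvgD; apply: Ck_family_cvg Kx; eassumption.
- by move=> t x At Ux; apply: differentiableD; apply: Ck_family_diff At Ux; eassumption.
- by move=> x Kx; apply: cvgD; apply: Ck_family_cvg Kx; eassumption.
- by move=> t x At Ux; apply: differentiableD; apply: Ck_family_diff At Ux; eassumption.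
- case: H1 H2 => [_ d1 H1] [_ d2 H2] i.
  apply: (@Ck_family_ext _ (fun t x => pderiv i (G1 t) x + pderiv i (G2 t) x)); last exact: (IH _ _ (H1 i) (H2 i)).
  by move=> t x At Ux; rewrite /pderiv deriveD //; apply: diff_derivable;
    [exact: d1|exact: d2].
Qed.

Lemma Ck_family_mul k G1 G2 : Ck_family k G1 -> Ck_family k G2 -> Ck_family k (fun t x => G1 t x * G2 t x).
Proof.
elim: k G1 G2 => [|k IH] G1 G2 H1 H2; split => //.
- by move=> x Kx; apply: cvgM; apply: Ck_family_cvg Kx; eassumption.
- by move=> t x At Ux; apply: differentiableM; apply: Ck_family_diff At Ux; eassumption.
- by move=> x Kx; apply: cvgM; apply: Ck_family_cvg Kx; eassumption.
- by move=> t x At Ux; apply: differentiableM; apply: Ck_family_diff At Ux; eassumption.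
- have [[_ d1 P1] [_ d2 P2]] := (H1, H2) => i.
  apply: (@Ck_family_ext _ (fun t x => G1 t x * pderiv i (G2 t) x + G2 t x * pderiv i (G1 t) x)).
    by move=> t x At Ux; rewrite /pderiv deriveM //; apply: diff_derivable;
      [exact: d1|exact: d2].
  by apply: Ck_family_add; [apply: (IH _ _ _ (P2 i))|apply: (IH _ _ _ (P1 i))];
    apply: Ck_family_pred.
Qed.

Lemma Ck_family_sum k (J : Type) (r : seq J) (P : pred J) (G : J -> T -> E -> R) :
  (forall j, Ck_family k (G j)) -> Ck_family k (fun t x => \sum_(j <- r | P j) G j t x).
Proof.
move=> H; elim: r => [|j r IH].
  apply: (@Ck_family_ext _ (fun _ _ => 0)); last exact: Ck_family_cst.
  by move=> *; rewrite big_nil.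
case: (boolP (P j)) => Pj; last first.
  by apply: Ck_family_ext IH => t x _ _; rewrite big_cons (negbTE Pj).
apply: (@Ck_family_ext _ (fun t x => G j t x + \sum_(j <- r | P j) G j t x)).
  by move=> t x _ _; rewrite big_cons Pj.
exact: Ck_family_add.
Qed.

Lemma Ck_family_prod k (J : Type) (r : seq J) (P : pred J) (G : J -> T -> E -> R) :
  (forall j, Ck_family k (G j)) -> Ck_family k (fun t x => \prod_(j <- r | P j) G j t x).
Proof.
move=> H; elim: r => [|j r IH].
  apply: (@Ck_family_ext _ (fun _ _ => 1)); last exact: Ck_family_cst.
  by move=> *; rewrite big_nil.
case: (boolP (P j)) => Pj; last first.
  by apply: Ck_family_ext IH => t x _ _; rewrite big_cons (negbTE Pj).
apply: (@Ck_family_ext _ (fun t x => G j t x * \prod_(j <- r | P j) G j t x)).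
  by move=> t x _ _; rewrite big_cons Pj.
exact: Ck_family_mul.
Qed.

(** The derivative [- G^-2 * G'] contains the inverse again, but only to one order less; hence the
    induction on the order with [G] fixed. The square root below is treated in the same way. *)
Lemma Ck_family_inv k G : (forall t x, A t -> U x -> G t x != 0) ->
  Ck_family k G -> Ck_family k (fun t x => (G t x)^-1).
Proof.
move=> G0; elim: k => [|k IH] H; split => //.
- by move=> x Kx; apply: cvgV; [apply: G0 => //; apply: KU|apply: Ck_family_cvg Kx; eassumption].
- by move=> t x At Ux; apply: differentiableV; [apply: Ck_family_diff At Ux; eassumption|exact: G0].
- by move=> x Kx; apply: cvgV; [apply: G0 => //; apply: KU|apply: Ck_family_cvg Kx; eassumption].
- by move=> t x At Ux; apply: differentiableV; [apply: Ck_family_diff At Ux; eassumption|exact: G0].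
- have [_ d P] := H => i.
  apply: (@Ck_family_ext _ (fun t x => ((-1) * ((G t x)^-1 * (G t x)^-1)) * pderiv i (G t) x)).
    move=> t x At Ux; rewrite /pderiv deriveV ?G0//; last by apply: diff_derivable; exact: d.
    by rewrite mulN1r -expr2 -exprVn.
  apply: Ck_family_mul (P i); apply: Ck_family_mul; first exact: Ck_family_cst.
  by apply: Ck_family_mul; apply: IH; apply: Ck_family_pred.
Qed.

Lemma Ck_family_sqrt k G : (forall t x, A t -> U x -> 0 < G t x) ->
  Ck_family k G -> Ck_family k (fun t x => Num.sqrt (G t x)).
Proof.
move=> G0.
have dsqrt (r : R) : 0 < r -> differentiable Num.sqrt r.
  by move=> r0; apply/derivable1_diffP; have [] := is_derive1_sqrt r0.
elim: k => [|k IH] H.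
  split => //.
  - move=> x Kx; apply: (@cvg_comp _ _ _ (fun q => G q.1 q.2)).
      by apply: Ck_family_cvg Kx; eassumption.
    exact: sqrt_continuous.
  - move=> t x At Ux; apply: (@differentiable_comp _ _ _ _ (G t)).
      by apply: Ck_family_diff At Ux; eassumption.
    by apply: dsqrt; apply: G0.
split => //.
- move=> x Kx; apply: (@cvg_comp _ _ _ (fun q => G q.1 q.2)).
    by apply: Ck_family_cvg Kx; eassumption.
  exact: sqrt_continuous.
- move=> t x At Ux; apply: (@differentiable_comp _ _ _ _ (G t)).
    by apply: Ck_family_diff At Ux; eassumption.
  by apply: dsqrt; apply: G0.
- have [_ d P] := H => i.
  apply: (@Ck_family_ext _ (fun t x => (2 * Num.sqrt (G t x))^-1 * pderiv i (G t) x)).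
    move=> t x At Ux; rewrite /pderiv.
    have dG := d t x At Ux; have dq := dsqrt _ (G0 t x At Ux).
    rewrite -[X in _ = 'D_ _ X x]/(Num.sqrt \o G t).
    rewrite [RHS]deriveE; last exact: differentiable_comp.
    rewrite diff_comp //= -[X in 'd _ _ X]deriveE //.
    rewrite -[X in _ = 'd _ _ X]mulr1 -[_ * 1]/(_ *: 1) linearZ -deriveE //.
    by rewrite derive_sqrt ?G0 // mulrC.
  apply: Ck_family_mul (P i); apply: Ck_family_inv => [t x At Ux|].
    by rewrite mulf_neq0 // gt_eqF // sqrtr_gt0 G0.
  by apply: Ck_family_mul; [exact: Ck_family_cst|apply: IH; apply: Ck_family_pred].
Qed.

End Closure.
End Families.

Lemma cvg_row (R : realType) (T : Type) (F : set_system T) (FF : Filter F) m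
    (G : T -> 'rV[R]_m) (l : 'rV[R]_m) :
  (forall j, G q 0 j @[q --> F] --> l 0 j) -> G @ F --> l.
Proof.
move=> H B [P nP PB]; rewrite /nbhs /=.
have HF : F [set q | forall j, P 0 j (G q 0 j)].
  by apply: filter_forall => j; apply: (H j); apply: nP.
by apply: filterS HF => q Pq; apply: PB => i j; rewrite ord1.
Qed.

Section Smth.
Context {R : realType} {N : nat}.
Local Notation E := 'rV[R]_N.

Lemma pderivs_rcons s i (G : E -> R) : pderivs (rcons s i) G = pderivs s (pderiv i G).
Proof. exact: foldr_rcons. Qed.

Definition Ck_on (V : set E) k (Phi : E -> R) :=
  Ck_family (globally [set tt]) setT tt set0 V k (fun _ => Phi).

Lemma Ck_on_diff V k Phi x : Ck_on V k Phi -> V x -> differentiable Phi x.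
Proof. by move=> H Vx; apply: (Ck_family_diff (t := tt) H). Qed.

(** [Ck_family] strips the derivative that is applied first, which is the last entry of [s]; hence
    the induction from the right end of the list. *)
Lemma Ck_on_pderivs (V : set E) Phi : (forall k, Ck_on V k Phi) <->
  (forall s x, V x -> differentiable (pderivs s Phi) x).
Proof.
split=> H.
  move=> s; elim/last_ind: s Phi H => [|s i IH] Phi H x Vx.
    exact: Ck_on_diff (H 0%N) Vx.
  by rewrite pderivs_rcons; apply: IH => // k; have [_ _] := H k.+1; apply.
move=> k; elim: k Phi H => [|k IH] Phi H; split => //.
- by move=> t x _; apply: (H [::]).
- by move=> t x _; apply: (H [::]).
- by move=> i; apply: IH => s x Vx; have := H (rcons s i) x Vx; rewrite pderivs_rcons.
Qed.

Lemma Ck_on_ext (V : set E) k Phi Phi' : open V ->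
  (forall x, V x -> Phi x = Phi' x) -> Ck_on V k Phi -> Ck_on V k Phi'.
Proof.
by move=> oV H; apply: Ck_family_ext => // t x _; exact: H.
Qed.

End Smth.

Section Composition.
Context {R : realType} {N m : nat}.
Local Notation E := 'rV[R]_N.
Context {T : Type}.
Variables (F : set_system T) (A : set T) (t0 : T) (K U : set E).
Hypotheses (FF : Filter F) (FA : F A) (At0 : A t0) (oU : open U) (KU : K `<=` U).
Local Notation Ck_family := (Ck_family F A t0 K U).

Variable V : set 'rV[R]_m.

(** No formula for higher derivatives of a composite is involved: the chain rule writes a first
    derivative as a sum of products whose factors are a composite of lower order and a derivative of
    [G]. *)
Lemma Ck_family_comp k (Phi : 'rV[R]_m -> R) (G : T -> E -> 'rV[R]_m) :
  Ck_on V k Phi -> (forall j, Ck_family k (fun t x => G t x 0 j)) ->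
  (forall t x, A t -> U x -> V (G t x)) ->
  Ck_family k (fun t x => Phi (G t x)).
Proof.
move=> + + GV.
have base k' (Psi : 'rV[R]_m -> R) : Ck_on V k' Psi ->
    (forall j, Ck_family k' (fun t x => G t x 0 j)) -> Ck_family 0 (fun t x => Psi (G t x)).
  move=> dPsi H; split => //.
  - move=> x Kx; apply: (@cvg_comp _ _ _ (fun q => G q.1 q.2) Psi); last first.
      apply: (@differentiable_continuous _ _ _ (G t0 x) Psi); apply: (Ck_on_diff dPsi).
      by apply: GV => //; apply: KU.
    by apply: cvg_row => j; apply: (Ck_family_cvg (H j)).
  - move=> t x At Ux; apply: (@differentiable_comp _ _ _ _ (G t)).
      by apply: differentiable_row => j; apply: (Ck_family_diff (H j)).
    by apply: (Ck_on_diff dPsi); apply: GV.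
elim: k Phi => [|k IH] Phi sPhi H; first exact: base sPhi H.
have [c d _] := base _ _ sPhi H; split => // i.
apply: (Ck_family_ext FF FA At0 oU KU
  (G := fun t x => \sum_j pderiv j Phi (G t x) * pderiv i (fun y => G t y 0 j) x)).
  move=> t x At Ux; rewrite -pderiv_comp //.
    by apply: differentiable_row => j; apply: (Ck_family_diff (H j)).
  by apply: (Ck_on_diff sPhi); apply: GV.
apply: Ck_family_sum => // j; apply: Ck_family_mul => //.
  by apply: IH; [have [_ _] := sPhi; apply|move=> j'; apply: Ck_family_pred].
by have [_ _] := H j; apply.
Qed.

End Composition.

Section Good.
Context {R : realType} {N : nat}.
Local Notation E := 'rV[R]_N.
Context {T : Type}.
Variables (F : set_system T) (A : set T) (t0 : T) (K U : set E).
Hypotheses (FF : Filter F) (FA : F A) (At0 : A t0) (oU : open U) (KU : K `<=` U).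
Local Notation Ck_family := (Ck_family F A t0 K U).

Lemma Ck_family_pderivs G : (forall k, Ck_family k G) <->
  (forall s, Ck_family 0 (fun t => pderivs s (G t))).
Proof.
split=> H.
  move=> s; elim/last_ind: s G H => [|s i IH] G H; first exact: H 0%N.
  under eq_fun do rewrite pderivs_rcons.
  by apply: IH => k; have [_ _] := H k.+1; apply.
move=> k; elim: k G H => [|k IH] G H; first exact: (H [::]).
have [c d _] := H [::]; split => // i; apply: IH => s.
by have := H (rcons s i); under [X in Ck_family _ X -> _]eq_fun do rewrite pderivs_rcons.
Qed.

(** Near each [x] the joint limit makes [G t y] close to [G t0 x], continuity of [G t0] replaces the
    latter by [G t0 y], and compactness of [K] makes the choice of [t] independent of [x]. *)
Lemma Gd0_uniform G : compact K -> Ck_family 0 G ->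
  forall e, 0 < e -> \forall t \near F, forall x, K x -> `|G t x - G t0 x| < e.
Proof.
move=> cK [c d _] e e0.
have cK' := (near_covering_withinP K).2 ((compact_near_coveringP K).1 cK).
have := cK' _ F (fun t x => `|G t x - G t0 x| < e) FF.
apply => x Kx.
have e20 : 0 < e / 2 by rewrite divr_gt0.
have [[P Q] /= [FP WQ] PQ] := (cvgrPdist_lt _ _).1 (c x Kx) _ e20.
have cx : {for x, continuous (G t0)} by apply: differentiable_continuous; apply: d => //; apply: KU.
have nx := (cvgrPdist_lt _ _).1 cx _ e20.
have {}WQ : \forall y \near x, K y -> Q y by exact: WQ.
near=> y t => Ky /=.
have h1 : `|G t0 x - G t0 y| < e / 2 by near: y; exact: nx.
have h2 : `|G t0 x - G t y| < e / 2.
  apply: (PQ (t, y)); split => /=; first by near: t.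
  by move: (Ky); apply: (near WQ y).
rewrite (splitr e) distrC; apply: le_lt_trans (ltrD h1 h2).
rewrite distrC -[X in `|X|](subrKA (G t0 x)) [leRHS]addrC.
by apply: le_trans (ler_normD _ _) _; rewrite [X in X + _]distrC.
Unshelve. all: by end_near.
Qed.

Lemma uniform_Gd0 G : (forall t x, A t -> U x -> differentiable (G t) x) ->
  (forall e, 0 < e -> \forall t \near F, forall x, K x -> `|G t x - G t0 x| < e) ->
  Ck_family 0 G.
Proof.
move=> d H; split => // x Kx; apply/cvgrPdist_lt => e e0.
have e20 : 0 < e / 2 by rewrite divr_gt0.
have cx : {for x, continuous (G t0)} by apply: differentiable_continuous; apply: d => //; apply: KU.
have nx := (cvgrPdist_lt _ _).1 cx _ e20.
exists ([set t | forall y, K y -> `|G t y - G t0 y| < e / 2],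
        [set y | K y /\ `|G t0 x - G t0 y| < e / 2]) => /=.
  split; first exact: H.
  have {}nx : nbhs x [set y | `|G t0 x - G t0 y| < e / 2] by exact: nx.
  by rewrite /within /=; apply: filterS nx => y h Ky; split.
move=> [t y] /= [h1 [Ky h2]]; rewrite (splitr e) -(subrKA (G t0 y)).
apply: le_lt_trans (ler_normD _ _) _; apply: ltrD => //.
by rewrite distrC; apply: h1.
Qed.

End Good.

(** * The C^oo topology *)

Lemma cvg_initial (S : choiceType) (X : topologicalType) (f : S -> X)
    (T : Type) (F : set_system T) (FF : Filter F) (g : T -> S) (s : S) :
  g @ F --> (s : initial_topology f) <-> (f \o g) @ F --> f s.
Proof.
split=> [gs|fgs].
  move=> B nB; have : nbhs (s : initial_topology f) (f @^-1` B).
    exact: (@initial_continuous _ _ f s).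
  exact: gs.
move=> B [_ [[C oC <-] Cs CB]].
have := fgs C (open_nbhs_nbhs (conj oC Cs)).
rewrite /nbhs /=; apply: filterS => t; exact: CB.
Qed.

Lemma cvg_ptws (I : Type) (V : topologicalType) (T : Type) (F : set_system T)
    (FF : Filter F) (g : T -> {ptws I -> V}) (l : {ptws I -> V}) :
  g @ F --> l <-> forall i, (fun t => g t i) @ F --> l i.
Proof.
split=> [/cvg_sup H i|H].
  exact: (proj1 (@cvg_initial _ V (fun f : I -> V => f i) T F FF g l) (H i)).
apply/cvg_sup => i.
exact: (proj2 (@cvg_initial _ V (fun f : I -> V => f i) T F FF g l) (H i)).
Qed.

Lemma cvg_uniform_norm (R : realType) (S : choiceType) (V : normedModType R)
    (T : Type) (F : set_system T) (FF : Filter F)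
    (g : T -> {uniform S -> V}) (l : {uniform S -> V}) :
  g @ F --> l <->
  forall e, 0 < e -> \forall t \near F, forall p, `|g t p - l p| < e.
Proof.
split=> [gl e e0|H P /uniform_nbhs [E [entE EP]]].
  have : nbhs l [set h : {uniform S -> V} | forall p, `|h p - l p| < e].
    apply/uniform_nbhs.
    exists [set xy : V * V | ball xy.1 e xy.2]; split.
      exact: entourage_ball (PosNum e0).
    move=> h /= H p; have := H p Logic.I.
    by rewrite -ball_normE /= distrC.
  by move/gl.
move: entE; rewrite -entourage_ballE => -[e /= e0 eE].
have := H e e0; apply: filterS => t Ht; apply: EP => p _ /=; apply: eE.
by rewrite /= -ball_normE /= distrC.
Qed.

(** * Euclidean geometry of the sphere and radial extensions *)

Section SphereBasics.
Context {R : realType} {n : nat}.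
Local Notation E := 'rV[R]_n.+1.
Local Notation S := (set_type (sphere R n)).
Local Notation K := (sphere R n).
Local Notation U := ([set x : E | x != 0]).
Implicit Types x y : E.

Lemma dotC m (u v : 'rV[R]_m) : dot u v = dot v u.
Proof. by apply: eq_bigr => i _; rewrite mulrC. Qed.

Lemma dotE m (u v : 'rV[R]_m) : dot u v = (u *m v^T) 0 0.
Proof. by rewrite mxE; apply: eq_bigr => i _; rewrite mxE. Qed.

Lemma dotDl m (u v w : 'rV[R]_m) : dot (u + v) w = dot u w + dot v w.
Proof. by rewrite !dotE mulmxDl mxE. Qed.

Lemma dotZl m a (u v : 'rV[R]_m) : dot (a *: u) v = a * dot u v.
Proof. by rewrite !dotE -scalemxAl mxE. Qed.

Lemma dotDr m (u v w : 'rV[R]_m) : dot u (v + w) = dot u v + dot u w.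
Proof. by rewrite dotC dotDl !(dotC _ u). Qed.

Lemma dotZr m a (u v : 'rV[R]_m) : dot u (a *: v) = a * dot u v.
Proof. by rewrite dotC dotZl dotC. Qed.

Lemma dotNl m (u v : 'rV[R]_m) : dot (- u) v = - dot u v.
Proof. by rewrite -scaleN1r dotZl mulN1r. Qed.

Lemma dotNr m (u v : 'rV[R]_m) : dot u (- v) = - dot u v.
Proof. by rewrite dotC dotNl dotC. Qed.

Lemma dotBl m (u v w : 'rV[R]_m) : dot (u - v) w = dot u w - dot v w.
Proof. by rewrite dotDl dotNl. Qed.

Lemma dotBr m (u v w : 'rV[R]_m) : dot u (v - w) = dot u v - dot u w.
Proof. by rewrite dotDr dotNr. Qed.

Lemma dot0l m (u : 'rV[R]_m) : dot 0 u = 0.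
Proof. by rewrite dotE mul0mx mxE. Qed.

Lemma dot0r m (u : 'rV[R]_m) : dot u 0 = 0.
Proof. by rewrite dotC dot0l. Qed.

Lemma dot_ge0 m (u : 'rV[R]_m) : 0 <= dot u u.
Proof. by apply: sumr_ge0 => i _; rewrite -expr2 sqr_ge0. Qed.

Lemma dot_eq0 m (u : 'rV[R]_m) : (dot u u == 0) = (u == 0).
Proof.
apply/idP/eqP => [|->]; last by rewrite dot0l.
rewrite psumr_eq0 => [/allP H|i _]; last by rewrite -expr2 sqr_ge0.
apply/rowP => i; rewrite mxE.
by have := H i (mem_index_enum i); rewrite /= -expr2 sqrf_eq0 => /eqP.
Qed.

Lemma dot_gt0 m (u : 'rV[R]_m) : (0 < dot u u) = (u != 0).
Proof. by rewrite lt0r dot_ge0 andbT dot_eq0. Qed.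

Lemma dot_all_eq0 m (u : 'rV[R]_m) : (forall v, dot u v = 0) -> u = 0.
Proof. by move=> /(_ u) /eqP; rewrite dot_eq0 => /eqP. Qed.

Lemma enorm_gt0 m (u : 'rV[R]_m) : (0 < enorm u) = (u != 0).
Proof. by rewrite sqrtr_gt0 dot_gt0. Qed.

Lemma enorm_sqr m (u : 'rV[R]_m) : enorm u ^+ 2 = dot u u.
Proof. by rewrite sqr_sqrtr // dot_ge0. Qed.

Lemma enormZ m a (u : 'rV[R]_m) : enorm (a *: u) = `|a| * enorm u.
Proof. by rewrite /enorm dotZl dotZr mulrA -expr2 sqrtrM ?sqr_ge0 // sqrtr_sqr. Qed.

Lemma enorm_sphere x : K x -> enorm x = 1.
Proof. by rewrite /sphere /= /enorm => ->; rewrite sqrtr1. Qed.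

Lemma normalized x : x != 0 -> K ((enorm x)^-1 *: x).
Proof.
move=> x0; have e0 : enorm x != 0 by rewrite gt_eqF // enorm_gt0.
by rewrite /sphere /= dotZl dotZr -enorm_sqr expr2 mulKf // mulVf.
Qed.

Lemma sphere_neq0 x : K x -> x != 0.
Proof. by rewrite /sphere /= => Kx; rewrite -dot_eq0 Kx oner_eq0. Qed.

Lemma sphere_subU : K `<=` U.
Proof. by move=> x /sphere_neq0. Qed.

Lemma dot_continuous m : continuous (fun x : 'rV[R]_m => dot x x).
Proof.
rewrite /dot; apply: continuous_big; first exact: add_continuous.
move=> i _ x; have c : (fun y : 'rV[R]_m => y 0 i) @ x --> x 0 i.
  exact: coord_continuous.
exact: (cvgM c c).
Qed.

Lemma coord_le_norm m (x : 'rV[R]_m) i : `|x 0 i| <= `|x|.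
Proof.
rewrite [leRHS]/Num.norm /= mx_normrE.
exact: (le_bigmax _ (fun ij : 'I_1 * 'I_m => `|x ij.1 ij.2|) (0, i)).
Qed.

Lemma rowvec_norm_le m (x : 'rV[R]_m) e : 0 <= e ->
  (forall i, `|x 0 i| <= e) -> `|x| <= e.
Proof.
move=> e0 H; rewrite [leLHS]/Num.norm /= mx_normrE.
by apply: bigmax_le => // -[i j] _ /=; rewrite ord1.
Qed.

Lemma rowvec_norm_lt m (x : 'rV[R]_m) e : 0 < e ->
  (forall i, `|x 0 i| < e) -> `|x| < e.
Proof.
move=> e0 H; rewrite [ltLHS]/Num.norm /= mx_normrE.
by apply: bigmax_lt => // -[i j] _ /=; rewrite ord1.
Qed.

Lemma sphere_compact : compact K.
Proof.
apply: bounded_closed_compact.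
  exists 1; split; first exact: num_real.
  move=> M M1 x Kx; apply: ltW; apply: le_lt_trans M1.
  apply: rowvec_norm_le => // i; rewrite -(ler_pXn2r (n := 2)) ?nnegrE //.
  rewrite expr1n -[leRHS]Kx -normrX ger0_norm ?sqr_ge0 // /dot (bigD1 i) //= expr2.
  by rewrite lerDl; apply: sumr_ge0 => j _; rewrite -expr2 sqr_ge0.
have -> : K = (fun x : E => dot x x) @^-1` [set 1] by [].
by apply: preimage_closed => [x _|]; [exact: dot_continuous|exact: closed_eq].
Qed.

Lemma open_neq0 : open U.
Proof.
have -> : U = ~` [set 0] by apply/seteqP; split => x /= /eqP.
by rewrite openC; apply: accessible_closed_set1; apply: hausdorff_accessible; exact: norm_hausdorff.
Qed.

(** The point [p] is chosen before [f], so the same [p] evaluates several extensions at once. *)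
Lemma radial_ext_ex x : x != 0 ->
  exists2 p : S, val p = (enorm x)^-1 *: x &
    forall m (f : S -> 'rV[R]_m), radial_ext f x = f p.
Proof.
move=> x0; have Kx := normalized x0.
exists (SigSub (mem_set Kx)) => // m f.
rewrite /radial_ext; case: insubP => [p _ vp|/negP []]; last exact: mem_set.
by congr f; apply: val_inj; rewrite vp.
Qed.

Lemma valS (p : S) : K (val p).
Proof. exact: set_valP. Qed.

Lemma radial_ext_val m (f : S -> 'rV[R]_m) (p : S) : radial_ext f (val p) = f p.
Proof.
have [q vq ->] := radial_ext_ex (sphere_neq0 (valS p)).
by congr f; apply: val_inj; rewrite vq enorm_sphere ?invr1 ?scale1r //; apply: valS.
Qed.

Lemma radial_extZ m (f : S -> 'rV[R]_m) r x : 0 < r ->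
  radial_ext f (r *: x) = radial_ext f x.
Proof.
move=> r0; rewrite /radial_ext enormZ gtr0_norm // invfM scalerA mulrC.
by rewrite mulrA mulfV ?gt_eqF // mul1r.
Qed.

Lemma radial_ext_comp m (f : S -> 'rV[R]_m) (g : S -> S) x : x != 0 ->
  radial_ext (f \o g) x = radial_ext f (radial_ext (post_incl g) x).
Proof.
by move=> x0; have [p _ E] := radial_ext_ex x0; rewrite !E radial_ext_val.
Qed.

Lemma radial_ext_post_incl (g : S -> S) x : x != 0 ->
  K (radial_ext (post_incl g) x).
Proof. by move=> x0; have [p _ ->] := radial_ext_ex x0; apply: valS. Qed.

End SphereBasics.

(** * Smoothness and C^oo convergence, coordinate by coordinate *)

Section SmoothComponents.
Context {R : realType} {N m : nat}.
Local Notation E := 'rV[R]_N.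
Variable V : set E.
Hypothesis oV : open V.
Implicit Types G : E -> 'rV[R]_m.

Lemma partials_coord s G x j : (forall s x, V x -> differentiable (partials s G) x) ->
  V x -> (partials s G x) 0 j = pderivs s (fun y => G y 0 j) x.
Proof.
move=> H; elim: s x => [//|i s IH] x Vx /=.
rewrite derive_coord; last exact: H.
apply: near_eq_derive; near=> y; apply: IH; near: y; exact: open_nbhs_nbhs.
Unshelve. all: by end_near. Qed.

Lemma smooth_onP G : smooth_on V G <->
  forall j k, Ck_on V k (fun x => G x 0 j).
Proof.
split=> [H j|H].
  apply/Ck_on_pderivs => s x Vx.
  apply: (@near_eq_differentiable _ _ _ (fun y => partials s G y 0 j)).
    by near=> y; apply: partials_coord => //; near: y; exact: open_nbhs_nbhs.
  by apply: differentiable_coordf; apply: H.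
have {}H j := (Ck_on_pderivs V _).1 (H j).
(* The two claims need a joint induction: taking a coordinate of a derivative requires
   differentiability of the vector-valued partial, which is in turn deduced from its coordinates. *)
suff Q s : (forall x, V x -> forall j, partials s G x 0 j = pderivs s (fun y => G y 0 j) x) /\
    (forall x, V x -> differentiable (partials s G) x).
  by move=> s; have [] := Q s.
elim: s => [|i s [IH1 IH2]].
  by split => // x Vx; apply: differentiable_row => j; apply: (H j [::]).
have e x : V x -> forall j, partials (i :: s) G x 0 j = pderivs (i :: s) (fun y => G y 0 j) x.
  move=> Vx j /=; rewrite derive_coord; last exact: IH2.
  by apply: near_eq_derive; near=> y; apply: IH1; near: y; exact: open_nbhs_nbhs.
split => // x Vx; apply: differentiable_row => j.
apply: (near_eq_differentiable _ (H j (i :: s) x Vx)).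
by near=> y; rewrite e //; near: y; exact: open_nbhs_nbhs.
Unshelve. all: by end_near. Qed.

End SmoothComponents.

Section CinftyConvergence.
Context {R : realType} {n m : nat}.
Local Notation E := 'rV[R]_n.+1.
Local Notation S := (set_type (sphere R n)).
Local Notation K := (sphere R n).
Local Notation U := ([set x : E | x != 0]).

Lemma smoothP (f : S -> 'rV[R]_m) : smooth f <->
  forall j k, Ck_on U k (fun x => radial_ext f x 0 j).
Proof. by apply: smooth_onP; exact: open_neq0. Qed.

Context {T : Type}.
Variables (F : set_system T) (A : set T) (t0 : T).
Hypotheses (FF : Filter F) (FA : F A) (At0 : A t0).

(** The passage through which all continuity statements on spaces of maps are reduced to
    [Ck_family]: on the compact sphere, uniform convergence of jets and joint limits are exchanged
    by [Gd0_uniform] and [uniform_Gd0]. *)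
Lemma cvg_CinftyP (Fm : T -> Cinfty R n m) : (forall t, A t -> smooth (Fm t)) ->
  Fm @ F --> Fm t0 <->
  forall j k, Ck_family F A t0 K U k (fun t x => radial_ext (Fm t) x 0 j).
Proof.
move=> sF.
have oU := @open_neq0 R n; have KU := @sphere_subU R n.
have sF' t j : A t -> forall s x, U x ->
    differentiable (pderivs s (fun x => radial_ext (Fm t) x 0 j)) x.
  by move=> At; apply/Ck_on_pderivs; exact: ((smoothP (Fm t)).1 (sF t At) j).
have E t s x j : A t -> U x ->
    partials s (radial_ext (Fm t)) x 0 j = pderivs s (fun x => radial_ext (Fm t) x 0 j) x.
  by move=> At Ux; apply: (partials_coord oU) => //; exact: sF.
have -> : (Fm @ F --> Fm t0) <-> forall s e, 0 < e -> \forall t \near F,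
    forall p : S, `|jet (Fm t) s p - jet (Fm t0) s p| < e.
  have -> : (Fm @ F --> Fm t0) <->
      ((fun t => jet (Fm t)) @ F --> jet (Fm t0)) by exact: cvg_initial.
  by rewrite cvg_ptws; split=> H s; have /cvg_uniform_norm := H s.
split=> H.
  move=> j; apply/Ck_family_pderivs => s; apply: uniform_Gd0 => //.
    by move=> t x At; apply: sF'.
  move=> e e0; apply: filterS2 FA (H s e e0) => t At Ht x Kx.
  rewrite -!E //; try exact: KU.
  have := Ht (SigSub (mem_set Kx)); rewrite /jet /=; apply: le_lt_trans.
  set a := partials _ _ _; set b := partials _ _ _.
  by have := coord_le_norm (a - b) j; rewrite !mxE.
move=> s e e0.
have H' j : \forall t \near F, forall x, K x ->
    `|pderivs s (fun x => radial_ext (Fm t) x 0 j) x -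
      pderivs s (fun x => radial_ext (Fm t0) x 0 j) x| < e.
  have := @Gd0_uniform _ _ _ _ _ t0 K U FF At0 KU
    (fun t => pderivs s (fun x => radial_ext (Fm t) x 0 j)) sphere_compact.
  by apply => //; move: s; apply/Ck_family_pderivs.
have {}H' := filter_forall FF H'.
apply: filterS2 FA H' => t At Ht p; apply: rowvec_norm_lt => // j.
rewrite !mxE !E //; try exact: (KU _ (valS p)).
exact: (Ht j _ (valS p)).
Qed.

End CinftyConvergence.

(** * Linear algebra of an immersion at a point *)

Section PointAlgebra.
Context {R : realType} {n : nat}.
Local Notation E := 'rV[R]_n.+1.
Local Notation Mat := 'M[R]_n.+1.
Implicit Types (p v w x y nu : E) (J L : Mat).

(** Matrix determinant lemma: conjugation by a unipotent block matrix turns one block-triangular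
    matrix into another, and their determinants are the two sides. *)
Lemma det_rank1 (y x : E) : \det (1%:M + y^T *m x) = 1 + dot x y.
Proof.
have H : (block_mx 1%:M 0 x 1%:M : 'M[R]_(n.+1 + 1)) *m
    (block_mx (1%:M + y^T *m x) (y^T) 0 1%:M : 'M[R]_(n.+1 + 1)) *m
    (block_mx 1%:M 0 (- x) 1%:M : 'M[R]_(n.+1 + 1)) =
    (block_mx 1%:M (y^T) 0 (1%:M + x *m y^T) : 'M[R]_(n.+1 + 1)).
  rewrite !mulmx_block !mul1mx !mul0mx !mulmx1 !addr0 !mulmx0 !add0r.
  rewrite mulmxN mulmxDl mulmxDr mulmxN !mulmx1 mul1mx addrK.
  congr block_mx; last exact: addrC.
by rewrite mulmxA [- _ - x]addrC addrACA !subrr addr0.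
have := congr1 determinant H; rewrite !det_mulmx !det_lblock !det_ublock !det1.
by rewrite !mul1r !mulr1 => ->; rewrite det_mx11 !mxE dotE mxE.
Qed.

Lemma mulmx_outer v p w : v *m (p^T *m w) = dot v p *: w.
Proof. by rewrite mulmxA [v *m _]mx11_scalar mul_scalar_mx -dotE. Qed.

Lemma mulmxD_outer v p w J : v *m (J + p^T *m w) = v *m J + dot v p *: w.
Proof. by rewrite mulmxDr mulmx_outer. Qed.

Lemma dot_mulmx v w J : dot (v *m J) w = dot v (w *m J^T).
Proof. by rewrite !dotE trmx_mul trmxK mulmxA. Qed.

Lemma dot_normal v J nu : nu *m J^T = 0 -> dot (v *m J) nu = 0.
Proof. by move=> H; rewrite dot_mulmx H dot0r. Qed.

(** The differential of an immersion at [p] as a matrix acting on the right of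
    row vectors, extended by 0 to the normal direction [p]. *)
Definition nondeg p J :=
  [/\ dot p p = 1, p *m J = 0 & forall v, dot v p = 0 -> v *m J = 0 -> v = 0].

(** The matrix [J + p^T *m nu] agrees with [J] on the hyperplane orthogonal to [p] and sends [p] to
    [nu]; positivity of its determinant is the orientation condition on the normal. *)
Definition is_normal p J nu :=
  [/\ dot nu nu = 1, nu *m J^T = 0 & 0 < \det (J + p^T *m nu)].

Lemma ex_unit_normal p J : nondeg p J -> exists2 nu, dot nu nu = 1 & nu *m J^T = 0.
Proof.
move=> [pp pJ _]; have /det0P [w w0 wJ] : \det J^T == 0.
  rewrite det_tr; apply/det0P; exists p => //.
  by rewrite -dot_eq0 pp oner_eq0.
exists ((enorm w)^-1 *: w); first exact: normalized.
by rewrite -scalemxAl wJ scaler0.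
Qed.

Section Normal.
Variables (p : E) (J : Mat) (nu : E).
Hypotheses (ndJ : nondeg p J) (nu1 : dot nu nu = 1) (nuJ : nu *m J^T = 0).

(** The image of [J] is orthogonal to [nu], so a vector killed by the sum is killed by both
    summands. *)
Lemma frame_unitmx : J + p^T *m nu \in unitmx.
Proof.
have [pp pJ inj] := ndJ; rewrite unitmxE unitfE; apply/det0P => -[x x0 xM].
move: xM; rewrite mulmxD_outer => xM.
have d0 : dot x p = 0.
  by have := congr1 (dot^~ nu) xM; rewrite dotDl dot_normal // dotZl nu1 dot0l add0r mulr1.
by move: x0; rewrite (inj x) ?eqxx //; move: xM; rewrite d0 scale0r addr0.
Qed.

Lemma solve_tangent y : dot y nu = 0 -> exists2 z, dot z p = 0 & z *m J = y.
Proof.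
move=> yn; exists (y *m invmx (J + p^T *m nu)).
  have := mulmxKV frame_unitmx y; rewrite mulmxD_outer => /(congr1 (dot^~ nu)).
  by rewrite dotDl dot_normal // dotZl nu1 yn add0r mulr1.
have H := mulmxKV frame_unitmx y; move: (H); rewrite mulmxD_outer.
move=> /[dup] /(congr1 (dot^~ nu)).
by rewrite dotDl dot_normal // dotZl nu1 yn add0r mulr1 => ->; rewrite scale0r addr0.
Qed.

Lemma det_outer w : \det (J + p^T *m w) = \det (J + p^T *m nu) * dot w nu.
Proof.
have [pp pJ inj] := ndJ; set B := J + p^T *m nu.
(* Hence replacing [nu] by [w] multiplies [B] on the right by the rank-one perturbation
   [1 + nu^T (w - nu)], whose determinant is [dot w nu]. *)
have pM : B *m nu^T = p^T.
  by rewrite mulmxDl -mulmxA -(trmxK (J *m _)) trmx_mul trmxK nuJ trmx0 add0r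
    [nu *m _]mx11_scalar -dotE nu1 mulmx1.
have -> : J + p^T *m w = B *m (1%:M + nu^T *m (w - nu)).
  by rewrite mulmxDr mulmx1 mulmxA pM mulmxBr /B -addrA [X in _ = _ + X]addrC subrK.
by rewrite det_mulmx det_rank1 dotBl nu1 addrC subrK.
Qed.

End Normal.

(** The generalized cross product of the images under [J] of a positive orthonormal tangent frame at
    [p]: polynomial in [p] and [J], and a multiple of the unit normal. *)
Definition cross p J : E := \row_c \det (J + p^T *m delta_mx 0 c).

Definition normalize m (x : 'rV[R]_m) := (enorm x)^-1 *: x.

Lemma cross_normal p J nu : nondeg p J -> dot nu nu = 1 -> nu *m J^T = 0 ->
  cross p J = \det (J + p^T *m nu) *: nu.
Proof.
move=> nd n1 nJ; apply/rowP => c; rewrite !mxE (det_outer nd n1 nJ); congr (_ * _).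
rewrite /dot (bigD1 c) //= mxE !eqxx mul1r big1 ?addr0 // => i ic.
by rewrite mxE (negbTE ic) andbF mul0r.
Qed.

(** Existence, uniqueness and a formula that is smooth in [p] and [J], all at once: [cross p J] is
    [\det (J + p^T *m nu)] times either unit normal [nu], so normalizing selects the one with
    positive determinant. *)
Lemma is_normalP p J nu : nondeg p J ->
  is_normal p J nu <-> nu = normalize (cross p J).
Proof.
move=> nd; split=> [[n1 nJ d0]|->].
  have e1 : enorm nu = 1 by rewrite /enorm n1 sqrtr1.
  rewrite /normalize (cross_normal nd n1 nJ) enormZ gtr0_norm // e1 mulr1 scalerA.
  by rewrite mulVf ?scale1r // gt_eqF.
have [nu1 n1 nJ] := ex_unit_normal nd.
have := frame_unitmx nd n1 nJ; rewrite unitmxE unitfE => d0.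
have e1 : enorm nu1 = 1 by rewrite /enorm n1 sqrtr1.
have -> : normalize (cross p J) = Num.sg (\det (J + p^T *m nu1)) *: nu1.
  rewrite /normalize (cross_normal nd n1 nJ) enormZ e1 mulr1 scalerA; congr (_ *: _).
  by rewrite [X in _ * X]numEsg mulrC -mulrA mulfV ?normr_eq0 // mulr1.
split.
- by rewrite dotZl dotZr n1 mulr1 -expr2 sqr_sg d0.
- by rewrite -scalemxAl nJ scaler0.
- by rewrite (det_outer nd n1 nJ) dotZl n1 mulr1 mulrC -normrEsg normr_gt0.
Qed.

Lemma cross_neq0 p J : nondeg p J -> cross p J != 0.
Proof.
move=> nd; have [nu n1 nJ] := ex_unit_normal nd.
have := frame_unitmx nd n1 nJ; rewrite unitmxE unitfE => d0.
by rewrite (cross_normal nd n1 nJ) scaler_eq0 (negbTE d0) /= -dot_eq0 n1 oner_eq0.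
Qed.

Lemma is_normal_ex p J : nondeg p J -> exists nu, is_normal p J nu.
Proof. by move=> nd; exists (normalize (cross p J)); apply/is_normalP. Qed.

Lemma det_cross p J w : nondeg p J -> \det (J + p^T *m w) = dot w (cross p J).
Proof.
move=> nd; have [nu n1 nJ] := ex_unit_normal nd.
by rewrite (det_outer nd n1 nJ) (cross_normal nd n1 nJ) dotZr.
Qed.

(** The radial extension is homogeneous of degree 0, so its differential at [r *: p] is [r^-1] times
    that at [p]. The factor found here is positive and disappears under [normalize], which carries
    the formula for the normal off the sphere. *)
Lemma crossZ p J r : nondeg p J -> 0 < r ->
  cross (r *: p) (r^-1 *: J) = (r^-1 ^+ n.+1 * r ^+ 2) *: cross p J.
Proof.
move=> nd r0; have r0' : r != 0 by rewrite gt_eqF.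
apply/rowP => c; rewrite !mxE.
have -> : r^-1 *: J + (r *: p)^T *m delta_mx 0 c =
    r^-1 *: (J + p^T *m (r ^+ 2 *: delta_mx 0 c)).
  rewrite scalerDr; congr (_ + _); rewrite -scalemxAr scalerA linearZ /= -scalemxAl.
  by rewrite expr2 mulrA mulVf // mul1r.
rewrite detZ -mulrA; congr (_ * _).
by rewrite !(det_cross _ nd) dotZl.
Qed.

Lemma normalizeZ m (x : 'rV[R]_m) r : 0 < r -> normalize (r *: x) = normalize x.
Proof.
move=> r0; rewrite /normalize enormZ gtr0_norm // invfM scalerA mulrAC mulVf ?mul1r //.
by rewrite gt_eqF.
Qed.

Lemma tnth_rcons_last (T : Type) (u : n.-tuple T) (x : T) :
  tnth [tuple of rcons u x] ord_max = x.
Proof. by rewrite (tnth_nth x) /= nth_rcons size_tuple ltnn eqxx. Qed.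

Lemma tnth_rcons_lift (T : Type) (u : n.-tuple T) (x : T) j :
  tnth [tuple of rcons u x] (lift ord_max j) = tnth u j.
Proof.
by rewrite !(tnth_nth x) lift_max /= nth_rcons size_tuple ltn_ord.
Qed.

Definition tangents p (u : n.-tuple E) := forall i, dot (tnth u i) p = 0.

(** Row by row, [J + p^T *m nu] takes the frame [(u, p)] to the frame [(u J, nu)]. *)
Lemma frame_det_push p J nu (u : n.-tuple E) : dot p p = 1 -> p *m J = 0 ->
  tangents p u ->
  frame_det [tuple of rcons [tuple of map (mulmx^~ J) u] nu] =
  frame_det [tuple of rcons u p] * \det (J + p^T *m nu).
Proof.
move=> pp pJ tu; rewrite /frame_det -det_mulmx; congr (\det _).
apply/row_matrixP => i; rewrite row_mul !rowK mulmxD_outer.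
case: (unliftP ord_max i) => [j ->|->].
  by rewrite !tnth_rcons_lift tnth_map tu scale0r addr0.
by rewrite !tnth_rcons_last pJ pp scale1r add0r.
Qed.

Lemma orthonormal_rcons (u : n.-tuple E) nu : dot nu nu = 1 ->
  Defs.orthonormal [tuple of rcons u nu] <-> Defs.orthonormal u /\ tangents nu u.
Proof.
move=> n1; split=> [H|[ou tu] i j].
  split=> [i j|i].
    have := H (lift ord_max i) (lift ord_max j); rewrite !tnth_rcons_lift => ->.
    by rewrite (inj_eq lift_inj).
  have := H (lift ord_max i) ord_max; rewrite tnth_rcons_lift tnth_rcons_last => ->.
  by rewrite eq_sym (negbTE (neq_lift _ _)).
case: (unliftP ord_max i) => [i' ->|->]; case: (unliftP ord_max j) => [j' ->|->];
  rewrite ?tnth_rcons_lift ?tnth_rcons_last.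
- by rewrite ou (inj_eq lift_inj).
- by rewrite tu eq_sym (negbTE (neq_lift _ _)).
- by rewrite dotC tu (negbTE (neq_lift _ _)).
- by rewrite n1 eqxx.
Qed.

Lemma reflection_orthogonal (w : E) : w != 0 ->
  let Q := 1%:M - (2 / dot w w) *: (w^T *m w) in Q *m Q^T = 1%:M.
Proof.
move=> w0 Q; have c0 : dot w w != 0 by rewrite dot_eq0.
have QT : Q^T = Q.
  by rewrite /Q linearB /= trmx1 linearZ /= trmx_mul trmxK.
have ww : w^T *m w *m (w^T *m w) = dot w w *: (w^T *m w).
  by rewrite -mulmxA mulmx_outer -scalemxAr.
rewrite QT /Q mulmxBl mul1mx mulmxBr mulmx1 -scalemxAl -scalemxAr ww !scalerA.
rewrite (_ : _ * dot w w = 2 / dot w w + 2 / dot w w); last by field.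
by rewrite scalerDl opprB addrK subrK.
Qed.

(** A Householder reflection exchanging [nu] and the last basis vector. *)
Lemma orthogonal_last_row nu : dot nu nu = 1 ->
  exists2 Q : Mat, Q *m Q^T = 1%:M & row ord_max Q = nu.
Proof.
move=> n1; pose e : E := delta_mx 0 ord_max.
have ee : dot e e = 1.
  by rewrite dotE trmx_delta mul_delta_mx mxE !eqxx.
have [->|ne] := eqVneq nu e.
  by exists 1%:M; rewrite ?trmx1 ?mulmx1 // rowE mulmx1.
have w0 : nu - e != 0 by rewrite subr_eq0.
exists (1%:M - (2 / dot (nu - e) (nu - e)) *: ((nu - e)^T *m (nu - e))).
  exact: reflection_orthogonal.
have c0 : dot (nu - e) (nu - e) != 0 by rewrite dot_eq0.
rewrite rowE mulmxBr mulmx1 -scalemxAr mulmx_outer scalerA -/e.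
have -> : 2 / dot (nu - e) (nu - e) * dot e (nu - e) = -1.
  move: c0; rewrite !dotBl !dotBr ee n1 (dotC nu e) => c0; field.
  by move: c0; congr (_ != 0); ring.
by rewrite scaleN1r opprK addrC subrK.
Qed.

Lemma positive_frame_ex nu : (0 < n)%N -> dot nu nu = 1 ->
  exists u : n.-tuple E, Defs.orthonormal [tuple of rcons u nu] /\
    0 < frame_det [tuple of rcons u nu].
Proof.
move=> n0 n1; have [Q QQ Qn] := orthogonal_last_row n1.
suff [P [PP Pn dP]] : exists P : Mat, [/\ P *m P^T = 1%:M, row ord_max P = nu & 0 < \det P].
  exists [tuple row (lift ord_max i) P | i < n].
  have E i : tnth [tuple of rcons [tuple row (lift ord_max i) P | i < n] nu] i = row i P.
    case: (unliftP ord_max i) => [j ->|->]; last by rewrite tnth_rcons_last.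
    by rewrite tnth_rcons_lift tnth_mktuple.
  split=> [i j|]; last first.
    rewrite /frame_det (_ : (\matrix_i _) = P) //.
    by apply/row_matrixP => i; rewrite rowK E.
  rewrite !E dotE; have := congr1 (fun B : Mat => B i j) PP; rewrite !mxE => <-.
  by apply: eq_bigr => k _; rewrite !mxE.
have dQ : \det Q != 0.
  by apply/eqP => d0; have := congr1 determinant QQ; rewrite det_mulmx d0 mul0r det1 => /eqP;
    rewrite eq_sym oner_eq0.
have [dQ0|dQ0] := ltP 0 (\det Q); first by exists Q.
(* Changing the sign of row 0 changes that of the determinant, and leaves the last row [nu] alone
   because [0 < n]. *)
pose d : E := \row_i (if i == ord0 then -1 else 1).
exists (diag_mx d *m Q); split.
- rewrite trmx_mul tr_diag_mx mulmxA -(mulmxA _ Q) QQ mulmx1 mulmx_diag -diag_const_mx.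
  by congr diag_mx; apply/rowP => i; rewrite !mxE; case: ifP; rewrite ?mulN1r ?opprK ?mulr1.
- rewrite row_mul row_diag_mx mxE /= -Qn [in RHS]rowE -scalemxAl.
  by rewrite ifF ?scale1r //; apply/negbTE; rewrite -val_eqE /= -lt0n.
- rewrite det_mulmx det_diag (bigD1 ord0) //= big1 ?mxE /= ?mulr1.
    by rewrite mulN1r oppr_gt0 lt_neqAle dQ.
  by move=> i i0; rewrite mxE (negbTE i0).
Qed.

(** For the direction from frames to normals a single frame is enough: the preimage under [J] of a
    positive orthonormal frame [w] of the hyperplane orthogonal to the true normal [N0]. *)
Lemma gauss_frame_normal p J nu : (0 < n)%N -> nondeg p J -> dot nu nu = 1 ->
  (forall u : n.-tuple E, tangents p u ->
    (0 < frame_det [tuple of rcons u p] /\ Defs.orthonormal [tuple of map (mulmx^~ J) u])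
    <-> (Defs.orthonormal [tuple of rcons [tuple of map (mulmx^~ J) u] nu] /\
         0 < frame_det [tuple of rcons [tuple of map (mulmx^~ J) u] nu]))
  <-> is_normal p J nu.
Proof.
move=> n0 nd n1; have [pp pJ inj] := nd.
have tJ m (u : n.-tuple E) : m *m J^T = 0 -> tangents m [tuple of map (mulmx^~ J) u].
  by move=> mJ i; rewrite tnth_map dot_normal.
split=> [H|[_ nJ d0] u tu]; last first.
  rewrite orthonormal_rcons // (frame_det_push _ pp pJ tu) pmulr_lgt0 //.
  by split=> [[]|[[]]] //; split => //; split => //; apply: tJ.
have [N0 [N1 NJ dN]] := is_normal_ex nd.
have [w [ow dw]] := positive_frame_ex n0 N1.
have [_ tw] := (orthonormal_rcons w N1).1 ow.
pose u := [tuple of map (mulmx^~ (invmx (J + p^T *m N0))) w].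
have uP i : dot (tnth u i) p = 0 /\ tnth u i *m J = tnth w i.
  have [z zp zJ] := solve_tangent nd N1 NJ (tw i).
  suff -> : tnth u i = z by [].
  rewrite tnth_map -zJ; have -> : z *m J = z *m (J + p^T *m N0).
    by rewrite mulmxD_outer zp scale0r addr0.
  by rewrite mulmxK // frame_unitmx.
have tu : tangents p u by move=> i; have [] := uP i.
have uw : [tuple of map (mulmx^~ J) u] = w.
  by apply: eq_from_tnth => i; rewrite tnth_map; have [] := uP i.
have := frame_det_push N0 pp pJ tu; rewrite uw => fN.
have du : 0 < frame_det [tuple of rcons u p].
  by move: dw; rewrite fN pmulr_lgt0.
have := H u tu; rewrite uw => -[[//|]].
  by split => //; have [] := (orthonormal_rcons w N1).1 ow.
rewrite orthonormal_rcons // => -[_ tnu] dnu _.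
split => //; last first.
  by have := frame_det_push nu pp pJ tu; rewrite uw => e; move: dnu; rewrite e pmulr_rgt0.
(* It remains to see that [nu] is orthogonal to every [v *m J]. In the orthonormal basis [(w, N0)]
   this vector has no [N0] component, and [nu] has no [w] components. *)
apply: dot_all_eq0 => v; rewrite dotC -{1}(trmxK J) -dot_mulmx trmxK.
pose B : Mat := \matrix_i tnth [tuple of rcons w N0] i.
have BB : B *m B^T = 1%:M.
  apply/matrixP => i j; have := ow i j; rewrite dotE !mxE => <-.
  by apply: eq_bigr => k _; rewrite !mxE.
have BB' := mulmx1C BB.
have -> : v *m J = v *m J *m B^T *m B by rewrite -mulmxA BB' mulmx1.
rewrite dot_mulmx dotE mxE big1 // => i _; rewrite !mxE.
case: (unliftP ord_max i) => [j ->|->].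
  rewrite [X in _ * X](_ : _ = 0) ?mulr0 //.
  rewrite -[RHS](tnu j) dotC; apply: eq_bigr => k _; rewrite !mxE.
  by rewrite tnth_rcons_lift.
rewrite [X in X * _](_ : _ = 0) ?mul0r //.
rewrite -[RHS](dot_normal v NJ); apply: eq_bigr => k _; rewrite !mxE.
by rewrite tnth_rcons_last.
Qed.

End PointAlgebra.

(** * Rayleigh quotients, and determinants along segments *)

Section Rayleigh.
Context {R : realType} {n : nat}.
Local Notation E := 'rV[R]_n.+1.
Local Notation Mat := 'M[R]_n.+1.
Implicit Types (p v w x y nu : E) (J L : Mat) (I : set R).

Lemma mulmx_coord_continuous m (J : 'M[R]_(n.+1, m)) i :
  continuous (fun v : E => (v *m J) 0 i).
Proof.
have -> : (fun v : E => (v *m J) 0 i) = (fun v => \sum_k v 0 k * J k i).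
  by apply/funext => v; rewrite mxE.
apply: continuous_big => [|k _ x]; first exact: add_continuous.
have c : (fun y : E => y 0 k) @ x --> x 0 k by exact: coord_continuous.
exact: (cvgM c (cvg_cst _)).
Qed.

Lemma dot_mulmx_continuous J L : continuous (fun v : E => dot (v *m J) (v *m L)).
Proof.
rewrite /dot; apply: continuous_big => [|k _ x]; first exact: add_continuous.
have c1 := @mulmx_coord_continuous _ J k x.
have c2 := @mulmx_coord_continuous _ L k x.
exact: (cvgM c1 c2).
Qed.

Lemma quadratic_ge0 (a c : R) : 0 <= c -> (forall t : R, 0 <= 2 * t * a + t ^+ 2 * c) ->
  a = 0.
Proof.
move=> c0 H; have c1 : 0 < c + 1 by lra.
apply/eqP; apply: contraT => a0.
have a2 : 0 < a ^+ 2 by rewrite exprn_even_gt0.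
(* The minimizer [- a / c] is shifted to [- a / (c + 1)] so that [c = 0] is covered as well. *)
have := H (- a / (c + 1)).
have -> : 2 * (- a / (c + 1)) * a + (- a / (c + 1)) ^+ 2 * c =
    - (a ^+ 2 * (c + 2) / (c + 1) ^+ 2) by field; lra.
have c2 : 0 < a ^+ 2 * (c + 2) / (c + 1) ^+ 2.
  by apply: divr_gt0; [apply: mulr_gt0 => //; lra|exact: exprn_gt0].
by rewrite oppr_ge0 leNgt c2.
Qed.

(** The first variation vanishes at a minimizer of [- dot (v J) (v L) / dot (v L) (v L)], so
    [v J + mu v L] is orthogonal to the image of [L] on tangent vectors; it also lies in that image,
    hence is 0. With [L = - k J] on [v], the value [mu] is [k^-1]. *)
Lemma rayleigh_min p J L nu : (0 < n)%N -> nondeg p L ->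
  dot nu nu = 1 -> nu *m J^T = 0 -> nu *m L^T = 0 ->
  (forall v w, dot (v *m J) (w *m L) = dot (w *m J) (v *m L)) ->
  exists mu v, [/\ dot v p = 0, v != 0, v *m J = - mu *: (v *m L) &
    forall w, dot w p = 0 -> mu * dot (w *m L) (w *m L) <= - dot (w *m J) (w *m L)].
Proof.
move=> n0 ndL n1 nJ nL sym; have [pp pL inj] := ndL.
pose C := sphere R n `&` [set v | dot v p = 0].
have cC : compact C.
  apply: compact_closedI; first exact: sphere_compact.
  have -> : [set v | dot v p = 0] = (fun v : E => (v *m p^T) 0 0) @^-1` [set 0].
    by apply/seteqP; split=> v /=; rewrite dotE.
  by apply: preimage_closed => [x _|]; [exact: mulmx_coord_continuous|exact: closed_eq].
have [u [ou _]] := positive_frame_ex n0 pp.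
have C0 : C !=set0.
  have [/= ou' tu] := (orthonormal_rcons u pp).1 ou.
  exists (tnth u (Ordinal n0)); split; last exact: tu.
  by rewrite /sphere /= ou' eqxx.
have Lpos v : dot v p = 0 -> v != 0 -> 0 < dot (v *m L) (v *m L).
  by move=> vp v0; rewrite dot_gt0; apply: contra_neq v0 => vL; apply: inj.
pose q v := - dot (v *m J) (v *m L) / dot (v *m L) (v *m L).
have qc : {within C, continuous q}.
  apply: continuous_in_subspaceT => v /set_mem [Kv vp].
  have d0 : dot (v *m L) (v *m L) != 0.
    by rewrite gt_eqF // Lpos // (sphere_neq0 Kv).
  have c1 := @dot_mulmx_continuous J L v; have c2 := @dot_mulmx_continuous L L v.
  exact: (cvgM (cvgN c1) (cvgV d0 c2)).
have [v0 v0C minq] := EVT_min_rV C0 cC qc.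
have [Kv v0p] := set_mem v0C; have v00 := sphere_neq0 Kv.
pose mu := q v0.
have B0 w : dot w p = 0 -> mu * dot (w *m L) (w *m L) <= - dot (w *m J) (w *m L).
  move=> wp; have [->|w0] := eqVneq w 0.
    by rewrite !mul0mx !dot0l mulr0 oppr0.
  rewrite -ler_pdivlMr ?Lpos //.
  have Cw : (enorm w)^-1 *: w \in C.
    by apply/mem_set; split; [exact: normalized|rewrite /= dotZl wp mulr0].
  have := minq _ Cw; rewrite /mu {2}/q -!scalemxAl !dotZl !dotZr.
  have e0 : enorm w != 0 by rewrite gt_eqF // enorm_gt0.
  have l0 : dot (w *m L) (w *m L) != 0 by rewrite gt_eqF // Lpos.
  congr (_ <= _); field; rewrite e0 l0 //.
exists mu, v0; split => //.
have muE : mu * dot (v0 *m L) (v0 *m L) = - dot (v0 *m J) (v0 *m L).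
  by rewrite /mu /q divfK // gt_eqF // Lpos.
(* Along [v0 - t w] the difference of the two sides of [B0] has no constant term, and its linear
   coefficient is twice the pairing to be shown zero. *)
have orth w : dot w p = 0 -> dot (v0 *m J + mu *: (v0 *m L)) (w *m L) = 0.
  move=> wp; pose c := - dot (w *m J) (w *m L) - mu * dot (w *m L) (w *m L).
  apply: (@quadratic_ge0 _ c); first by rewrite subr_ge0 B0.
  move=> t; have := B0 (v0 + (- t) *: w); rewrite dotDl dotZl v0p wp mulr0 addr0.
  move=> /(_ erefl); rewrite -subr_ge0; congr (_ <= _).
  rewrite !mulmxDl -!scalemxAl !(dotDl, dotDr, dotZl, dotZr) (sym w v0).
  have A0 : dot (v0 *m J) (v0 *m L) = - (mu * dot (v0 *m L) (v0 *m L)) by rewrite muE opprK.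
  by rewrite (dotC (w *m L) (v0 *m L)) /c A0; ring.
have yn : dot (v0 *m J + mu *: (v0 *m L)) nu = 0.
  by rewrite dotDl dotZl !dot_normal // mulr0 addr0.
have [z zp zL] := solve_tangent ndL n1 nL yn.
have := orth z zp; rewrite zL => /eqP; rewrite dot_eq0 addr_eq0 => /eqP ->.
by rewrite scaleNr.
Qed.

(** Along the segment the determinant is a polynomial in [s] without a root in the unit interval, so
    its end values have the same sign. *)
Lemma det_path (A B : Mat) :
  (forall s, 0 <= s <= 1 -> \det ((1 - s) *: A + s *: B) != 0) ->
  0 < \det A * \det B.
Proof.
move=> H.
pose P := \det (\matrix_(i, j) ((A i j)%:P + (B i j - A i j)%:P * 'X) : 'M[{poly R}]_n.+1).
have PE s : P.[s] = \det ((1 - s) *: A + s *: B).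
  rewrite -[LHS]/(horner_eval s P) -det_map_mx; congr (\det _).
  apply/matrixP => i j; rewrite !mxE -[LHS]/((_ + _).[s]) !hornerE; ring.
have P0 : P.[0] = \det A by rewrite PE subr0 scale1r scale0r addr0.
have P1 : P.[1] = \det B by rewrite PE subrr scale1r scale0r add0r.
rewrite -P0 -P1 ltNge; apply/negP => PP.
have P10 : P.[1] != 0 by rewrite PE; apply: H; rewrite ler01 lexx.
have [||s s01] := @poly_ivt _ (P.[1] *: P) 0 1; first exact: ler01.
  by rewrite !hornerZ mulrC PP -expr2 sqr_ge0.
rewrite rootE hornerZ mulf_eq0 (negbTE P10) /= PE => /eqP e.
by have := H s s01; rewrite e eqxx.
Qed.

(** The part of the segment from [s] to 1 is nondegenerate too, so the orientation known at [J] is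
    carried back to [s]. *)
Lemma is_normal_path p J1 J nu : is_normal p J nu -> nu *m J1^T = 0 ->
  (forall s, 0 <= s <= 1 -> nondeg p ((1 - s) *: J1 + s *: J)) ->
  forall s, 0 <= s <= 1 -> is_normal p ((1 - s) *: J1 + s *: J) nu.
Proof.
move=> [n1 nJ d0] nJ1 nd.
have nJs s : nu *m ((1 - s) *: J1 + s *: J)^T = 0.
  by rewrite linearD !linearZ /= mulmxDr -!scalemxAr nJ nJ1 !scaler0 addr0.
have pathE r s : (1 - r) *: (((1 - s) *: J1 + s *: J) + p^T *m nu) + r *: (J + p^T *m nu) =
    ((1 - (s + r * (1 - s))) *: J1 + (s + r * (1 - s)) *: J) + p^T *m nu.
  by apply/matrixP => i j; rewrite !mxE; ring.
move=> s /andP[s0 s1]; split => //.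
suff : 0 < \det ((1 - s) *: J1 + s *: J + p^T *m nu) * \det (J + p^T *m nu).
  by rewrite pmulr_lgt0.
apply: det_path => r /andP[r0 r1]; rewrite pathE -unitfE -unitmxE.
apply: frame_unitmx => //; apply: nd.
have h : 0 <= r * (1 - s) by apply: mulr_ge0 => //; rewrite subr_ge0.
  have h2 : r * (1 - s) <= 1 - s by rewrite ler_piMl ?subr_ge0.
  by apply/andP; split; lra.
Qed.

End Rayleigh.

(** * Curvature conditions at a point: orientation and convexity *)

Section Curvature.
Context {R : realType} {n : nat}.
Hypothesis n0 : (0 < n)%N.
Local Notation E := 'rV[R]_n.+1.
Local Notation Mat := 'M[R]_n.+1.
Implicit Types (p v w x y nu : E) (J L : Mat) (I : set R).

(** [J], [L] are the differentials at [p] of an immersion and of its Gauss map,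
    the value of the latter being [nu]; the symmetry hypothesis is the
    self-adjointness of the shape operator. *)
Definition curvature_data p J L nu :=
  [/\ nondeg p J, is_normal p J nu, p *m L = 0, nu *m L^T = 0 &
    forall v w, dot (v *m J) (w *m L) = dot (w *m J) (v *m L)].

Definition eigen p J L (k : R) :=
  exists v, [/\ dot v p = 0, v != 0 & v *m L = - k *: (v *m J)].

Lemma interval_sign I : is_interval I -> ~ I 0 ->
  (forall k, I k -> 0 < k) \/ (forall k, I k -> k < 0).
Proof.
move=> iI I0; have [H|/existsNP [k /not_implyP [Ik /negP k0]]] :=
  pselect (forall k, I k -> 0 < k); first by left.
right=> l Il; rewrite ltNge; apply/negP => l0; apply: I0.
by apply: (iI k l) => //; rewrite l0 andbT leNgt.
Qed.

Section Data.
Variables (I : set R) (p : E) (J L : Mat) (nu : E).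
Hypotheses (cd : curvature_data p J L nu) (Ik : forall k, eigen p J L k -> I k).
Hypothesis (I0 : ~ I 0).

(** A tangent vector killed by [L] would be a principal direction of curvature 0. *)
Lemma curvature_nondeg : nondeg p L.
Proof.
have [[pp pJ inj] _ pL _ _] := cd; split => // v vp vL.
apply: contrapT => v0; apply: I0; apply: Ik; exists v; split => //.
  exact/eqP.
by rewrite vL oppr0 scale0r.
Qed.

(** The two bounds are attained at eigenvectors. *)
Lemma curvature_bounds : exists k1 k2, [/\ I k1, I k2 &
  forall v, dot v p = 0 ->
    k1^-1 * dot (v *m L) (v *m L) <= - dot (v *m J) (v *m L) <=
    k2^-1 * dot (v *m L) (v *m L)].
Proof.
have [ndJ [n1 nJ _] pL nL sym] := cd; have ndL := curvature_nondeg.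
have [_ _ injJ] := ndJ.
have ev mu v : dot v p = 0 -> v != 0 -> v *m J = - mu *: (v *m L) -> I mu^-1.
  move=> vp v0 vJ; apply: Ik; exists v; split => //; rewrite vJ scalerA.
  have mu0 : mu != 0.
    by apply: contra_neq v0 => mu0; apply: injJ => //; rewrite vJ mu0 oppr0 scale0r.
  by rewrite mulrNN mulVf // scale1r.
have [mu1 [v1 [v1p v10 v1J B1]]] := rayleigh_min n0 ndL n1 nJ nL sym.
(* The upper bound is the minimum principle applied to [- J]. *)
have nJ' : nu *m (- J)^T = 0 by rewrite linearN /= mulmxN nJ oppr0.
have sym' v w : dot (v *m - J) (w *m L) = dot (w *m - J) (v *m L).
  by rewrite !mulmxN !dotNl sym.
have [mu2 [v2 [v2p v20 v2J B2]]] := rayleigh_min n0 ndL n1 nJ' nL sym'.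
exists mu1^-1, (- mu2)^-1; split; first exact: ev v1J.
  by apply: (ev _ v2) => //; apply: oppr_inj; rewrite -mulmxN v2J opprK scaleNr.
move=> v vp; rewrite !invrK B1 //=.
by have := B2 v vp; rewrite mulmxN dotNl mulNr lerNr.
Qed.

Lemma curvature_pos : (forall k, I k -> 0 < k) -> forall v, dot v p = 0 -> v != 0 ->
  dot (v *m J) (v *m L) < 0.
Proof.
move=> Ip v vp v0; have [k1 [k2 [I1 I2 H]]] := curvature_bounds.
have [_ _ inj] := curvature_nondeg.
rewrite -oppr_gt0; apply: lt_le_trans (andP (H v vp)).1.
apply: mulr_gt0; first by rewrite invr_gt0 Ip.
by rewrite dot_gt0; apply: contra_neq v0; apply: inj.
Qed.

Lemma curvature_neg : (forall k, I k -> k < 0) -> forall v, dot v p = 0 -> v != 0 ->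
  0 < dot (v *m J) (v *m L).
Proof.
move=> Ip v vp v0; have [k1 [k2 [I1 I2 H]]] := curvature_bounds.
have [_ _ inj] := curvature_nondeg.
rewrite -oppr_lt0; apply: le_lt_trans (andP (H v vp)).2 _.
rewrite nmulr_rlt0; last by rewrite invr_lt0 Ip.
by rewrite dot_gt0; apply: contra_neq v0; apply: inj.
Qed.

(** The segment from [e J] to [L] consists of nondegenerate maps, so the Gauss map
    and the immersion carry the same orientation up to the sign [e ^+ n]. *)
Lemma gauss_orientation (e : R) : e ^+ 2 = 1 ->
  (forall v, dot v p = 0 -> v != 0 -> 0 < e * dot (v *m J) (v *m L)) ->
  0 < e ^+ n * \det (L + p^T *m nu).
Proof.
move=> e2 H; have [[pp pJ injJ] [n1 nJ d0] pL nL sym] := cd.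
(* Taking [e] out of the whole matrix gives [e ^+ n.+1], and the normal slot contributes one more
   [e]; since [e ^+ 2 = 1], the factor [e ^+ n] is left. *)
have dE : \det (e *: J + p^T *m nu) = e ^+ n * \det (J + p^T *m nu).
  have -> : e *: J + p^T *m nu = e *: (J + p^T *m (e *: nu)).
    by rewrite scalerDr -scalemxAr scalerA -expr2 e2 scale1r.
  rewrite detZ (det_outer (And3 pp pJ injJ) n1 nJ (e *: nu)) dotZl n1 mulr1.
  rewrite exprS; transitivity (e ^+ 2 * (e ^+ n * \det (J + p^T *m nu))); first by ring.
  by rewrite e2 mul1r.
suff : 0 < \det (e *: J + p^T *m nu) * \det (L + p^T *m nu).
  by rewrite dE mulrAC pmulr_lgt0.
apply: det_path => s /andP[s0 s1].
have -> : (1 - s) *: (e *: J + p^T *m nu) + s *: (L + p^T *m nu) =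
    ((1 - s) *: (e *: J) + s *: L) + p^T *m nu.
  by apply/matrixP => i j; rewrite !mxE; ring.
rewrite -unitfE -unitmxE; apply: frame_unitmx => //; last first.
  by rewrite linearD !linearZ /= mulmxDr -!scalemxAr nJ nL !scaler0 addr0.
split => //; first by rewrite mulmxDr -!scalemxAr pJ pL !scaler0 addr0.
move=> v vp /(congr1 (fun z => dot z (v *m L))).
rewrite mulmxDr -!scalemxAr dotDl !dotZl dot0l => h.
apply: contrapT => /eqP v0; have [_ _ injL] := curvature_nondeg.
have h1 := H v vp v0.
have h2 : 0 < dot (v *m L) (v *m L) by rewrite dot_gt0; apply: contra_neq v0; apply: injL.
have [s00|s00] := eqVneq s 0.
  by move: h h1; rewrite s00 subr0 mul1r mul0r addr0 => ->; rewrite ltxx.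
have s2 : 0 < s * dot (v *m L) (v *m L) by rewrite mulr_gt0 // lt0r s00.
have s3 : 0 <= (1 - s) * (e * dot (v *m J) (v *m L)).
  by rewrite mulr_ge0 ?subr_ge0 // ltW.
by move: (ltr_wpDl s3 s2); rewrite h ltxx.
Qed.

End Data.

(** With [L] fixed, the Rayleigh numerator is affine in [J], so common bounds at both ends hold
    along the segment. They exclude degeneracy because [k1] and [k2] have the same sign, and they
    place every eigenvalue between [k2] and [k1], inside the interval. *)
Lemma curvature_convex I p J1 J L nu : is_interval I -> ~ I 0 ->
  curvature_data p J1 L nu -> (forall k, eigen p J1 L k -> I k) ->
  curvature_data p J L nu -> (forall k, eigen p J L k -> I k) ->
  forall t, 0 <= t <= 1 ->
  let Jt := (1 - t) *: J1 + t *: J in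
  curvature_data p Jt L nu /\ (forall k, eigen p Jt L k -> I k).
Proof.
move=> iI I0 cd1 H1 cd H t t01 Jt.
have [[pp pJ1 inj1] [n1 nJ1 d1] pL nL sym1] := cd1.
have [[_ pJ inj] [_ nJ d] _ _ sym] := cd.
have [_ _ injL] := curvature_nondeg cd H I0.
have Lpos v : dot v p = 0 -> v != 0 -> 0 < dot (v *m L) (v *m L).
  by move=> vp v0; rewrite dot_gt0; apply: contra_neq v0; apply: injL.
have bt : exists k1 k2, [/\ I k1, I k2 & forall s v, 0 <= s <= 1 -> dot v p = 0 ->
    k1^-1 * dot (v *m L) (v *m L) <=
    - dot (v *m ((1 - s) *: J1 + s *: J)) (v *m L) <=
    k2^-1 * dot (v *m L) (v *m L)].
  have [a1 [a2 [Ia1 Ia2 Ha]]] := curvature_bounds cd1 H1 I0.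
  have [b1 [b2 [Ib1 Ib2 Hb]]] := curvature_bounds cd H I0.
  (* The weaker of the two bounds on each side; being one of the given curvatures, it still lies in
     [I]. *)
  pose k1 := if a1^-1 <= b1^-1 then a1 else b1.
  pose k2 := if a2^-1 <= b2^-1 then b2 else a2.
  exists k1, k2; split; [by rewrite /k1; case: ifP|by rewrite /k2; case: ifP|].
  move=> s v /andP[s0 s1] vp; have /andP[A1 A2] := Ha v vp; have /andP[B1 B2] := Hb v vp.
  rewrite mulmxDr -!scalemxAr dotDl !dotZl.
  have l0 := dot_ge0 (v *m L); set l := dot (v *m L) (v *m L) in A1 A2 B1 B2 l0 *.
  set x := dot (v *m J1) _ in A1 A2 *; set y := dot (v *m J) _ in B1 B2 *.
  have [C1 C2] : k1^-1 * l <= - x /\ k1^-1 * l <= - y.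
    rewrite /k1; case: (leP a1^-1 b1^-1) => h; split => //.
      by apply: le_trans B1; apply: ler_wpM2r.
    by apply: le_trans A1; apply: ler_wpM2r => //; apply: ltW.
  have [D1 D2] : - x <= k2^-1 * l /\ - y <= k2^-1 * l.
    rewrite /k2; case: (leP a2^-1 b2^-1) => h; split => //.
      by apply: (le_trans A2); apply: ler_wpM2r.
    by apply: (le_trans B2); apply: ler_wpM2r => //; apply: ltW.
  have s1' : 0 <= 1 - s by rewrite subr_ge0.
  by apply/andP; split; nra.
have [k1 [k2 [I1 I2 B]]] := bt.
have sgI := interval_sign iI I0.
have ndt s : 0 <= s <= 1 -> nondeg p ((1 - s) *: J1 + s *: J).
  move=> s01; split => //; first by rewrite mulmxDr -!scalemxAr pJ1 pJ !scaler0 addr0.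
  move=> v vp vJ; apply: contrapT => /eqP v0; have := B s v s01 vp.
  rewrite vJ dot0l oppr0; have l0 := Lpos v vp v0.
  case: sgI => sg /andP[h1 h2].
    by move: h1; rewrite leNgt mulr_gt0 // invr_gt0 sg.
  have k2n : k2^-1 < 0 by rewrite invr_lt0 sg.
  by move: h2; rewrite leNgt nmulr_rlt0 ?l0.
have nt := is_normal_path (And3 n1 nJ d) nJ1 ndt t01.
split.
  split => //; first exact: ndt.
  by move=> v w; rewrite !mulmxDr -!scalemxAr !dotDl !dotZl sym1 sym.
move=> k [v [vp v0 vL]].
have /andP[h1 h2] := B t v t01 vp.
have l0 := Lpos v vp v0.
have k0 : k != 0 by apply: contraTneq l0 => k0; rewrite vL k0 oppr0 scale0r dot0l ltxx.
have E1 : - dot (v *m Jt) (v *m L) = k^-1 * dot (v *m L) (v *m L).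
  by rewrite {2}vL dotZl mulrA mulrN mulVf // mulN1r.
move: h1 h2; rewrite E1 !ler_pM2r // => h1 h2.
case: sgI => sg.
  have kp : 0 < k^-1 by apply: lt_le_trans h1; rewrite invr_gt0 sg.
  move: kp h1 h2; rewrite invr_gt0 => kp; rewrite !lef_pV2 ?posrE // ?sg // => h1 h2.
  by apply: (iI k2 k1) => //; rewrite h1 h2.
have kp : k^-1 < 0 by apply: (le_lt_trans h2); rewrite invr_lt0 sg.
move: kp h1 h2; rewrite invr_lt0 => kp; rewrite !lef_nV2 ?negrE // ?sg // => h1 h2.
by apply: (iI k2 k1) => //; rewrite h1 h2.
Qed.

End Curvature.

(** * Local inverses *)

Section MeanValue.
Context {R : realType} {N : nat}.
Local Notation E := 'rV[R]_N.
Implicit Types (F : E -> R) (x y v : E).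

Lemma mean_value F y v :
  (forall t : R, 0 <= t <= 1 -> differentiable F (y + t *: v)) ->
  exists2 t : R, 0 <= t <= 1 & F (y + v) - F y = 'D_v F (y + t *: v).
Proof.
move=> dF; pose phi (t : R) := F (y + t *: v).
have line (t : R) : differentiable (fun t : R => y + t *: v) t.
  by apply: differentiableD => //; apply: differentiableZl.
have dphi (t : R) : 0 <= t <= 1 -> is_derive t 1 phi ('D_v F (y + t *: v)).
  move=> t01; have dc : differentiable phi t.
    by apply: (@differentiable_comp _ _ _ _ (fun t : R => y + t *: v)) => //; exact: dF.
  apply: DeriveDef; first exact: diff_derivable.
  rewrite deriveE // -[phi]/(F \o (fun t : R => y + t *: v)).
  rewrite diff_comp //; last exact: dF.
  rewrite /= deriveE; last exact: dF.
  congr ('d _ _ _); rewrite -deriveE // deriveD //; last by apply: diff_derivable; apply: differentiableZl.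
  rewrite derive_cst add0r deriveE; last exact: differentiableZl.
  by rewrite diffZl // diff_val scale1r.
have [|t||t t01] := @MVT_segment R phi (fun t => 'D_v F (y + t *: v)) 0 1.
- exact: ler01.
- by rewrite in_itv /= => /andP[t0 t1]; apply: dphi; rewrite !ltW.
- apply: continuous_in_subspaceT => s; rewrite inE /= in_itv /= => s01.
  apply: differentiable_continuous; apply/derivable1_diffP.
  by have [] := dphi s s01.
- move: t01; rewrite in_itv /= subr0 mulr1 /phi scale1r scale0r addr0 => t01 ->.
  by exists t.
Qed.

Lemma sum_norm_le (v : E) (a : 'I_N -> R) e : 0 <= e -> (forall i, `|a i| <= e) ->
  `|\sum_i v 0 i * a i| <= N%:R * e * `|v|.
Proof.
move=> e0 ae; apply: le_trans (ler_norm_sum _ _ _) _.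
rewrite -mulrA mulr_natl -[X in _ *+ X]card_ord -sumr_const.
apply: ler_sum => i _; rewrite normrM mulrC.
by apply: ler_pM => //; apply: coord_le_norm.
Qed.

(** Strict differentiability: by the mean value theorem on the segment from [y] to [x], the error is
    governed by the variation of the partial derivatives near [x0]. *)
Lemma strict_differentiable F (U : set E) x0 e : open U -> U x0 ->
  (forall x, U x -> differentiable F x) ->
  (forall i, {for x0, continuous (pderiv i F)}) -> 0 < e ->
  exists2 r : R, 0 < r & ball x0 r `<=` U /\
    forall x y, ball x0 r x -> ball x0 r y ->
      `|F x - F y - \sum_i (x - y) 0 i * pderiv i F x0| <= e * `|x - y|.
Proof.
(* Each of the [N] coordinates contributes at most [e'] times the norm; dividing by [N.+1] keeps the
   divisor positive. *)
move=> oU Ux0 dF cF e0; pose e' := e / N.+1%:R.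
have e'0 : 0 < e' by rewrite divr_gt0.
have near1 : \forall x \near x0, U x by exact: open_nbhs_nbhs.
have near2 : \forall x \near x0, forall i, `|pderiv i F x0 - pderiv i F x| < e'.
  have H i : \forall x \near x0, `|pderiv i F x0 - pderiv i F x| < e'.
    by have /cvgrPdist_lt := cF i; apply.
  exact: (filter_forall (nbhs_filter x0) H).
have : nbhs x0 [set x | U x /\ forall i, `|pderiv i F x0 - pderiv i F x| < e'].
  exact: (filterI near1 near2).
move=> /nbhs_ballP[r /= r0 rU].
exists r => //; split=> [x /rU[]//|x y xr yr].
have seg t : 0 <= t <= 1 -> ball x0 r (y + t *: (x - y)).
  move=> /andP[t0 t1]; move: xr yr; rewrite -!ball_normE /= => xr yr.
  have -> : x0 - (y + t *: (x - y)) = (1 - t) *: (x0 - y) + t *: (x0 - x).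
    by rewrite scalerBl scale1r !scalerBr; apply/rowP => i; rewrite !mxE; ring.
  apply: le_lt_trans (ler_normD _ _) _; rewrite !normrZ (ger0_norm t0).
  rewrite ger0_norm ?subr_ge0 //.
  have [->|t00] := eqVneq t 0; first by rewrite subr0 mul1r mul0r addr0.
  have tp : 0 < t by rewrite lt0r t00.
  have h1 : t * `|x0 - x| < t * r by rewrite ltr_pM2l.
  have h2 : (1 - t) * `|x0 - y| <= (1 - t) * r by rewrite ler_wpM2l ?subr_ge0 // ltW.
  lra.
have [|t t01] := @mean_value F y (x - y).
  by move=> t /seg /rU[/dF].
have -> : y + (x - y) = x by rewrite addrC subrK.
move=> ->; rewrite derive_pderiv; last by have /rU[/dF] := seg t t01.
rewrite -sumrB (eq_bigr (fun i => (x - y) 0 i * (pderiv i F (y + t *: (x - y)) - pderiv i F x0))).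
  apply: le_trans (sum_norm_le _ (ltW e'0) _) _.
    by move=> i; have /rU[_ /(_ i)] := seg t t01; rewrite distrC => /ltW.
  rewrite ler_wpM2r // /e' mulrCA ger_pMr // ler_pdivrMr ?ltr0n // mul1r ler_nat.
  exact: leqnSn.
by move=> i _; rewrite mulrBr.
Qed.

End MeanValue.

Section LocalInverse.
Context {R : realType} {n : nat}.
Local Notation E := 'rV[R]_n.+1.
Variables (G : E -> E) (U : set E).
Hypotheses (oU : open U) (dG : forall x j, U x -> differentiable (fun y => G y 0 j) x).
Hypothesis cG : forall x i j, U x -> {for x, continuous (pderiv i (fun y => G y 0 j))}.

Definition pjac (x : E) : 'M[R]_n.+1 := \matrix_(i, j) pderiv i (fun y => G y 0 j) x.

Lemma mulmx_norm_le (B : 'M[R]_n.+1) :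
  exists2 k : R, 0 < k & forall v : E, `|v *m B| <= k * `|v|.
Proof.
pose k := 1 + n.+1%:R * \sum_i \sum_j `|B i j|.
have s0 : 0 <= \sum_i \sum_j `|B i j| by apply: sumr_ge0 => i _; apply: sumr_ge0.
exists k => [|v]; first by rewrite ltr_pwDl // mulr_ge0.
apply: rowvec_norm_le => [|j].
  by rewrite mulr_ge0 // addr_ge0 // mulr_ge0.
rewrite mxE; apply: le_trans (sum_norm_le _ s0 _) _.
  move=> i; rewrite (bigD1 i) //= (bigD1 j) //= -addrA lerDl addr_ge0 ?sumr_ge0 //.
  by move=> i' _; apply: sumr_ge0.
by rewrite ler_wpM2r // lerDr.
Qed.

Lemma strict_differentiable_row x0 e : U x0 -> 0 < e ->
  exists2 r : R, 0 < r & ball x0 r `<=` U /\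
    forall x y, ball x0 r x -> ball x0 r y ->
      `|G x - G y - (x - y) *m pjac x0| <= e * `|x - y|.
Proof.
move=> Ux0 e0.
have /choice [r rP] : forall j : 'I_n.+1, exists r : R, 0 < r /\ (ball x0 r `<=` U /\
    forall x y, ball x0 r x -> ball x0 r y ->
      `|G x 0 j - G y 0 j - \sum_i (x - y) 0 i * pderiv i (fun y => G y 0 j) x0| <= e * `|x - y|).
  move=> j; have [r r0 H] := strict_differentiable oU Ux0
    (fun x Ux => @dG x j Ux) (fun i => @cG x0 i j Ux0) e0.
  by exists r.
pose r0 := \big[Num.min/r ord0]_j r j.
have r0r j : r0 <= r j by apply: bigmin_le_cond.
exists r0; first by apply: lt_bigmin => [|j _]; have [] := rP ord0; [|by have [] := rP j].
split=> [x xr|x y xr yr].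
  by have [_ [+ _]] := rP ord0; apply; apply: le_ball xr.
apply: rowvec_norm_le => [|j]; first by rewrite mulr_ge0 // ltW.
have [_ [_ /(_ x y)]] := rP j; rewrite !mxE => H.
rewrite (eq_bigr (fun i => (x - y) 0 i * pderiv i (fun y => G y 0 j) x0)).
  by apply: H; [apply: le_ball xr|apply: le_ball yr].
by move=> i _; rewrite !mxE.
Qed.

(** Quantitative inverse function theorem. The map [T z = G z *m invmx J] differs from the identity
    by a map of Lipschitz constant 1/2, which gives the lower bound. A preimage of [w] is found by
    minimizing the residual [|T z - y|] on the closed ball: a nonzero minimum could be decreased. *)
Lemma local_inverse x0 : U x0 -> pjac x0 \in unitmx ->
  exists r c : R, [/\ 0 < r, 0 < c,
    (forall x y, ball x0 r x -> ball x0 r y -> c * `|x - y| <= `|G x - G y|) &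
    forall x s w, 0 < s -> closed_ball x s `<=` ball x0 r -> `|w - G x| < c * s ->
      exists2 z, `|z - x| <= s & G z = w].
Proof.
move=> Ux0 uJ; set J := pjac x0 in uJ.
have [k k0 kP] := mulmx_norm_le (invmx J).
have [|r r0 [rU H]] := @strict_differentiable_row x0 (2 * k)^-1 Ux0.
  by rewrite invr_gt0 mulr_gt0.
pose T z := G z *m invmx J.
have TP x y : ball x0 r x -> ball x0 r y -> `|T x - T y - (x - y)| <= 2^-1 * `|x - y|.
  move=> xr yr; have := H x y xr yr.
  have -> : T x - T y - (x - y) = (G x - G y - (x - y) *m J) *m invmx J.
    by rewrite [in RHS]mulmxBl mulmxK // mulmxBl.
  move=> h; apply: le_trans (kP _) _; apply: le_trans (ler_wpM2l (ltW k0) h) _.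
  by rewrite invfM mulrCA !mulrA divfK ?gt_eqF //.
have TL x y : ball x0 r x -> ball x0 r y -> `|x - y| <= 2 * `|T x - T y|.
  move=> xr yr; have h := TP x y xr yr.
  have := ler_normB (T x - T y) (T x - T y - (x - y)).
  rewrite subKr => h2; lra.
have TG x y : `|T x - T y| <= k * `|G x - G y| by rewrite -mulmxBl kP.
(* The factor 4 serves the second claim: it makes [|y - T x| < s / 4], and a minimizer [z] then
   satisfies [|z - x| <= 2 |T z - T x| <= 4 |y - T x| < s], so it is interior. *)
exists r, (4 * k)^-1; split => //; first by rewrite invr_gt0 mulr_gt0.
  move=> x y xr yr; rewrite mulrC ler_pdivrMr ?mulr_gt0 //.
  have h1 := TL x y xr yr; have h2 := TG x y.
  have h3 : 0 <= k * `|G x - G y| by rewrite mulr_ge0 // ltW.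
  lra.
move=> x s w s0 sr wx; pose y := w *m invmx J.
have yx : `|y - T x| < s / 4.
  rewrite /y /T -mulmxBl; apply: le_lt_trans (kP _) _.
  rewrite -ltr_pdivlMl //; apply: lt_le_trans wx _.
  by rewrite invfM -!mulrA mulrCA (mulrC s).
have xx : closed_ball x s x by apply: closed_ballxx.
have cC : compact (closed_ball x s).
  apply: bounded_closed_compact; last exact: closed_ball_closed.
  exists (`|x| + s); split; first exact: num_real.
  move=> M M1 z; rewrite closed_ballE // /closed_ball_ /= => zx; apply: ltW.
  apply: le_lt_trans M1.
  by have := ler_normB x (x - z); rewrite subKr => h; apply: le_trans h _; rewrite lerD2l.
have cphi : {within closed_ball x s, continuous (fun z => `|T z - y|)}.
  apply: continuous_in_subspaceT => z /set_mem /sr /rU Uz.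
  have cT : T z' @[z' --> z] --> T z.
    apply: (@cvg_row _ _ (nbhs z) _) => j.
    apply: (@cvg_comp _ _ _ G (fun v => (v *m invmx J) 0 j)).
      apply: (@cvg_row _ _ (nbhs z) _) => i; exact: (differentiable_continuous (dG i Uz)).
    exact: mulmx_coord_continuous.
  exact: (cvg_norm (cvgB cT (cvg_cst y))).
have [z zC zmin] := EVT_min_rV (ex_intro _ x xx) cC cphi.
have {}zC := set_mem zC.
have zx : `|z - x| < s.
  have h1 := TL z x (sr _ zC) (sr _ xx).
  have h2 := zmin x (mem_set xx); rewrite /= in h2.
  have h3 := ler_distD y (T z) (T x).
  by rewrite (distrC (T x)) in h2; lra.
exists z; first exact: ltW.
have [Tzy|Tzy] := eqVneq (T z) y.
  by rewrite -(mulmxKV uJ (G z)) -/(T z) Tzy /y mulmxKV.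
have d0 : 0 < `|T z - y| by rewrite normr_gt0 subr_eq0.
set d := `|T z - y| in d0.
(* A damped Newton step from [z], short enough to remain in the closed ball; it brings the residual
   down to at most [(1 - l / 2) * d]. *)
pose l := Num.min 1 ((s - `|z - x|) / d).
have l0 : 0 < l by rewrite lt_min ltr01 divr_gt0 // subr_gt0.
have l1 : l <= 1 by rewrite ge_min lexx.
have ld : l * d <= s - `|z - x| by rewrite -ler_pdivlMr // ge_min lexx orbT.
pose z' := z + l *: (y - T z).
have nd : `|l *: (y - T z)| = l * d by rewrite normrZ gtr0_norm // distrC.
have z'C : closed_ball x s z'.
  rewrite closed_ballE // /closed_ball_ /= distrC /z' addrAC.
  by apply: le_trans (ler_normD _ _) _; rewrite nd; lra.
have := zmin z' (mem_set z'C); rewrite /= -/d leNgt => /negP []; rewrite -/d.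
have -> : T z' - y = (T z' - T z - (z' - z)) + (1 - l) *: (T z - y).
  have -> : z' - z = l *: (y - T z) by rewrite /z' [z + _]addrC addrK.
  by move: (T z) (T z') => a b; apply/rowP => j; rewrite !mxE; ring.
apply: le_lt_trans (ler_normD _ _) _.
have h1 := TP z' z (sr _ z'C) (sr _ zC).
have e1 : `|z' - z| = l * d by rewrite -nd /z' [z + _]addrC addrK.
rewrite e1 in h1; rewrite normrZ ger0_norm ?subr_ge0 // -/d.
have h5 : 0 < l * d by rewrite mulr_gt0.
lra.
Qed.

End LocalInverse.

(** * Local homeomorphisms of the sphere *)

Lemma compact_uniform_eps (R : realType) (X : topologicalType) (C : set X)
    (P : R -> X -> Prop) : compact C ->
  (forall x, C x -> \forall x' \near x & e \near (0 : R)^'+, C x' -> P e x') ->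
  exists2 e : R, 0 < e & forall x, C x -> P e x.
Proof.
move=> cC H.
have cC' := (near_covering_withinP C).2 ((compact_near_coveringP C).1 cC).
have nP : \forall e \near (0 : R)^'+, C `<=` P e by exact: cC' H.
have n0 : \forall e \near (0 : R)^'+, 0 < e by exact: nbhs_right_gt.
have [e [eP e0]] : exists e : R, C `<=` P e /\ 0 < e.
  apply: (@filter_ex _ (0 : R)^'+ _ (fun e => C `<=` P e /\ 0 < e)).
  exact: (filterI nP n0).
by exists e.
Qed.

Lemma near_right_lt (R : realType) (c : R) : 0 < c ->
  \forall e \near (0 : R)^'+, 0 < e /\ e < c.
Proof.
move=> c0; near=> e; split; first by near: e; exact: nbhs_right_gt.
by near: e; exact: nbhs_right_lt.
Unshelve. all: by end_near. Qed.

Lemma compact_unif_continuous (R : realType) (V W : normedModType R) (C : set V)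
    (f : V -> W) : compact C -> (forall x, C x -> {for x, continuous f}) ->
  forall e, 0 < e -> exists2 d : R, 0 < d &
    forall x, C x -> forall y, `|x - y| < d -> C y -> `|f x - f y| < e.
Proof.
move=> cC cf e e0.
have [|d d0 dP] := @compact_uniform_eps R V C
  (fun d x => forall y, `|x - y| < d -> C y -> `|f x - f y| < e) cC; last by exists d.
move=> x Cx; have e2 : 0 < e / 2 by rewrite divr_gt0.
have : nbhs x [set y | `|f x - f y| < e / 2].
  by have /cvgrPdist_lt := cf x Cx; apply.
move=> /nbhs_ballP [r /= r0 rP].
exists (ball x (r / 2), [set d | 0 < d /\ d < r / 2]) => /=.
  split; first by apply: nbhsx_ballx; rewrite divr_gt0.
  by apply: near_right_lt; rewrite divr_gt0.
move=> [x' d] /= [xx' [d0 dr]] Cx' y x'y Cy.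
have h1 : `|f x - f x'| < e / 2.
  by apply: rP; apply: le_ball xx'; rewrite ler_pdivrMr // ler_peMr ?ltW // ltr1n.
have h2 : `|f x - f y| < e / 2.
  apply: rP; rewrite -ball_normE /=; move: xx'; rewrite -ball_normE /= => xx'.
  have h := ler_distD x' x y; lra.
by have h := ler_distD (f x) (f x') (f y); rewrite (distrC (f x') (f x)) in h; lra.
Qed.

(** * Vectors in general position and great-circle arcs *)

Section GenericVectors.
Context {R : realType} {n : nat}.
Local Notation E := 'rV[R]_n.+1.
Implicit Types (p q v w x : E).

(** A point of the moment curve outside finitely many hyperplanes. *)
Lemma generic_vector (W : seq E) : (forall w, w \in W -> w != 0) ->
  exists m : E, forall w, w \in W -> dot w m != 0.
Proof.
move=> W0; pose P := \prod_(w <- W) rVpoly w.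
have P0 : P != 0.
  rewrite /P prodf_seq_neq0; apply/allP => w /W0 w0 /=.
  by apply: contra_neq w0 => w0; rewrite -[w]rVpolyK w0 linear0.
have [t tP] : exists t : R, ~~ root P t.
  pose rs := [seq i%:R : R | i <- iota 0 (size P)].
  case: (altP (@allP _ (root P) rs)) => [/allP H|/allPn[t _ tP]]; last by exists t.
  have := max_poly_roots P0 H; rewrite size_map size_iota ltnn => /(_ _)/negP [] //.
  by rewrite map_inj_uniq ?iota_uniq // => i j /eqP; rewrite eqr_nat => /eqP.
exists (\row_i t ^+ i) => w wW.
have : root (rVpoly w) t = false.
  by apply: contraNF tP => rw; rewrite /P (big_rem w) //= rootM rw.
rewrite rootE => /negbT; congr (_ != 0).
by rewrite horner_poly; apply: eq_bigr => i _; rewrite insubT //= => h; rewrite mxE; congr (w _ _ * _); apply: val_inj.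
Qed.

(** Two linear conditions in dimension [n + 1 >= 3]; this count is where [2 <= n] enters the
    covering argument. *)
Lemma orthogonal_pair p q : (2 <= n)%N -> exists w, [/\ w != 0, dot w p = 0 & dot w q = 0].
Proof.
move=> n2; pose A : 'M[R]_(n.+1, 1 + 1) := row_mx p^T q^T.
have : kermx A != 0.
  rewrite -mxrank_eq0 mxrank_ker subn_eq0 -ltnNge.
  by apply: leq_ltn_trans (rank_leq_col A) _.
case/rowV0Pn => w /sub_kermxP; rewrite mul_mx_row => wA w0; exists w.
have := wA; rewrite -row_mx0 => /eq_row_mx [wp wq].
by rewrite !dotE wp wq !mxE.
Qed.

Lemma normalize_sphere x : x != 0 -> sphere R n (normalize x).
Proof. exact: normalized. Qed.

Lemma normalize_id x : sphere R n x -> normalize x = x.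
Proof. by move=> Kx; rewrite /normalize enorm_sphere // invr1 scale1r. Qed.

Lemma normalize_continuous x : x != 0 -> {for x, continuous (@normalize R n.+1)}.
Proof.
move=> x0; have c1 : enorm y @[y --> x] --> enorm x.
  apply: (@cvg_comp _ _ _ (fun y => dot y y)); first exact: dot_continuous.
  exact: sqrt_continuous.
have e0 : enorm x != 0 by rewrite gt_eqF // enorm_gt0.
exact: (cvgZ (cvgV e0 c1) cvg_id).
Qed.

(** The chord projected radially to the sphere: a great-circle arc, not at constant speed, that
    makes sense unless [w] is antipodal to [v]. *)
Definition arc v w (t : R) : E := normalize ((1 - t) *: v + t *: w).

Lemma segment_eq0 v w t : sphere R n v -> sphere R n w ->
  (1 - t) *: v + t *: w = 0 -> w = - v.
Proof.
rewrite /sphere /= => v1 w1 /eqP; rewrite addr_eq0 => /eqP vw.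
have := congr1 (fun x => dot x x) vw.
rewrite dotNl dotNr opprK !dotZl !dotZr v1 w1 !mulr1 => e.
have t2 : t = 2^-1.
  have : 1 - 2 * t = 0 by move: e; move/eqP; rewrite -subr_eq0 => /eqP e; rewrite -e; ring.
  by move=> h; lra.
move: vw; rewrite t2 (_ : 1 - 2^-1 = 2^-1 :> R); last by field.
rewrite -scalerN => /scalerI => H; rewrite [in RHS]H ?opprK //.
Qed.

Lemma segment_neq0 v w t : sphere R n v -> sphere R n w -> w != - v ->
  (1 - t) *: v + t *: w != 0.
Proof. by move=> Kv Kw; apply: contra_neq; exact: segment_eq0. Qed.

Lemma arc_sphere v w t : sphere R n v -> sphere R n w -> w != - v ->
  sphere R n (arc v w t).
Proof. by move=> Kv Kw wv; apply: normalize_sphere; apply: segment_neq0. Qed.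

Lemma arc0 v w : sphere R n v -> arc v w 0 = v.
Proof. by move=> Kv; rewrite /arc subr0 scale1r scale0r addr0 normalize_id. Qed.

Lemma arc1 v w : sphere R n w -> arc v w 1 = w.
Proof. by move=> Kv; rewrite /arc subrr scale1r scale0r add0r normalize_id. Qed.

Lemma arc_continuous v w (T : Type) (F : set_system T) (FF : Filter F)
    (f : T -> E) (a : T -> R) (t : R) : sphere R n v -> sphere R n w -> w != - v ->
  f @ F --> w -> a @ F --> t -> (fun z => arc v (f z) (a z)) @ F --> arc v w t.
Proof.
move=> Kv Kw wv cf ca.
apply: (@cvg_comp _ _ _ (fun z => (1 - a z) *: v + a z *: f z) (@normalize R n.+1)); last first.
  by apply: normalize_continuous; apply: segment_neq0.
have c1 : (fun z => 1 - a z) @ F --> 1 - t by exact: (cvgB (cvg_cst _) ca).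
exact: (cvgD (cvgZ c1 (cvg_cst _)) (cvgZ ca cf)).
Qed.

End GenericVectors.

(** * Discrete path lifting, injectivity and surjectivity *)

Section Covering.
Context {R : realType} {n : nat}.
Local Notation E := 'rV[R]_n.+1.
Local Notation K := (sphere R n).
Hypothesis n2 : (2 <= n)%N.
Variable g : E -> E.
Hypothesis gK : forall x, K x -> K (g x).
Hypothesis gc : forall x, K x -> {for x, continuous g}.
Hypothesis g_inj_loc : exists2 e : R, 0 < e &
  forall x y, K x -> K y -> `|x - y| < e -> g x = g y -> x = y.
Hypothesis g_open : forall e : R, 0 < e -> exists2 d : R, 0 < d &
  forall x w, K x -> K w -> `|w - g x| < d -> exists y, [/\ K y, `|y - x| < e & g y = w].

(** By local injectivity a ball of radius [e / 2] contains at most one point of the fibre, and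
    finitely many such balls cover the sphere. *)
Lemma finite_fiber w : exists L : seq E, forall q, K q -> g q = w -> q \in L.
Proof.
have [e e0 He] := g_inj_loc.
have := @sphere_compact R n; rewrite compact_cover => /(_ _ setT (fun x => ball x (e / 2))).
case=> [x _|x Kx|D _ KD].
- exact: ball_open.
- by exists x => //; apply: ballxx; rewrite divr_gt0.
(* A ball that misses the fibre contributes the default 0, which merely enlarges the list. *)
pose pt x := xget (0 : E) [set q | K q /\ g q = w /\ ball x (e / 2) q].
exists [seq pt x | x <- finmap.enum_fset D] => q Kq gq.
have [x xD xq] := KD _ Kq; apply/mapP; exists x => //.
have [Kp [gp bp]] : K (pt x) /\ g (pt x) = w /\ ball x (e / 2) (pt x).
  exact: (@xgetI _ (0 : E) [set q | K q /\ g q = w /\ ball x (e / 2) q] q).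
apply: He => //; last by rewrite gq.
move: (pt x) xq bp => px; rewrite -!ball_normE /= => h1 h2.
by have h := ler_distD x q px; rewrite (distrC q x) in h; lra.
Qed.

Section Lifting.
Variables (eta delta : R) (p v : E).
Hypotheses (Kp : K p) (gp : g p = v).
Hypothesis He : forall x y, K x -> K y -> `|x - y| < 4 * eta -> g x = g y -> x = y.
Hypotheses (eta0 : 0 < eta) (delta0 : 0 < delta).
Hypothesis Hd : forall x w, K x -> K w -> `|w - g x| < delta ->
  exists y, [/\ K y, `|y - x| < eta & g y = w].

Let Kv : K v. Proof. by rewrite -gp; apply: gK. Qed.

Local Notation node M x j := (arc v (g x) (j%:R / M%:R)).

(** A discrete lift of the arc from [v] to [g x]: a chain from [p] over [M] equal parameter steps,
    with jumps below [eta], that ends at [x] itself. This end condition is what is propagated from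
    point to point in place of continuous path lifting. *)
Definition lifts M x := exists c : nat -> E,
  [/\ c 0%N = p, c M = x,
      (forall j, (j <= M)%N -> K (c j) /\ g (c j) = node M x j) &
      forall j, (j < M)%N -> `|c j.+1 - c j| < eta].

Lemma lifts_refl M : (0 < M)%N -> lifts M p.
Proof.
move=> M0; exists (fun=> p); split => // [j _|j _]; last by rewrite subrr normr0.
split => //; rewrite gp /arc -scalerDl subrK scale1r normalize_id //.
Qed.

(** The arc from [v] to [g x = v] is constant, so by local injectivity the chain cannot leave
    [p]. *)
Lemma lifts_eq M x : g x = v -> lifts M x -> x = p.
Proof.
move=> gx [c [c0 cM cK cs]]; rewrite -cM.
suff H j : (j <= M)%N -> c j = p by exact: H.
elim: j => [//|j IH] jM; have cj := IH (ltnW jM).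
have gc' i : (i <= M)%N -> g (c i) = v.
  by move=> iM; have [_ ->] := cK i iM; rewrite gx /arc -scalerDl subrK scale1r normalize_id.
apply: He => //; first by have [] := cK _ jM.
  by have := cs j jM; rewrite cj; move: eta0; lra.
by rewrite gc' // gp.
Qed.

(** Each node of the old chain is corrected by less than [eta]. A new node and the lift of the next
    value near its predecessor lie over the same point and are joined by four jumps below [eta];
    this is why injectivity is assumed at scale [4 * eta]. *)
Lemma lifts_step M x x' : (0 < M)%N -> K x -> K x' -> g x' != - v -> `|x - x'| < eta ->
  (forall j, (j <= M)%N -> `|node M x' j - node M x j| < delta) ->
  (forall j, (j < M)%N -> `|node M x' j.+1 - node M x' j| < delta) ->
  lifts M x -> lifts M x'.
Proof.
move=> M0 Kx Kx' gx' xx' H1 H2 [c [c0 cM cK cs]].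
have Kn j : K (node M x' j) by apply: arc_sphere => //; apply: gK.
have /choice [c' c'P] : forall j, exists y, (j <= M)%N ->
    [/\ K y, `|y - c j| < eta & g y = node M x' j].
  move=> j; case: (leqP j M) => [jM|]; last by exists 0.
  have [Kc gcj] := cK j jM.
  have [|y yP] := @Hd (c j) (node M x' j) Kc (Kn j); last by exists y.
  by rewrite gcj; apply: H1.
exists c'; split.
- have [Ky yc gy] := c'P 0%N (leq0n _).
  apply: He => //; last by rewrite gy mul0r arc0.
  by rewrite c0 in yc; move: eta0; lra.
- have [Ky yc gy] := c'P M (leqnn _).
  apply: He => //; last by rewrite gy divff ?arc1 ?pnatr_eq0 ?gt_eqF //; apply: gK.
  have h := ler_distD x (c' M) x'; rewrite cM in yc; move: eta0; lra.
- by move=> j /c'P [].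
move=> j jM.
have [K1 d1 g1] := c'P j (ltnW jM); have [K2 d2 g2] := c'P j.+1 jM.
have [|y [Ky yd gy]] := @Hd (c' j) (node M x' j.+1) K1 (Kn _).
  by rewrite g1; apply: H2.
suff <- : y = c' j.+1 by [].
apply: He => //; last by rewrite gy.
have h1 := ler_distD (c' j) y (c' j.+1).
have h2 := ler_distD (c j) (c' j) (c' j.+1).
have h3 := ler_distD (c j.+1) (c j) (c' j.+1).
have h4 := cs j jM.
rewrite (distrC (c j.+1) (c' _)) (distrC (c j) (c j.+1)) in h3; lra.
Qed.

(** Uniform continuity of the contraction on the unit square yields a mesh on which neighbouring
    nodes are [delta]-close in both directions; [lifts_step] is then iterated. The conclusion is for
    all large [M] because two arcs have to share one subdivision. *)
Lemma lifts_segment a b : K a -> K b -> b != - a ->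
  (forall s, 0 <= s <= 1 -> g (arc a b s) != - v) ->
  exists M0, forall M, (M0 < M)%N -> lifts M a -> lifts M b.
Proof.
move=> Ka Kb ba gab.
have Ks s : K (arc a b s) by exact: arc_sphere.
pose C := `[(0:R), 1]%classic `*` `[(0:R), 1]%classic.
have cC : compact C by apply: compact_setX; exact: segment_compact.
have ca (s : R) : arc a b s' @[s' --> s] --> arc a b s.
  by apply: arc_continuous => //; first [exact: cvg_cst|exact: cvg_id].
pose h (z : R * R) := arc v (g (arc a b z.1)) z.2.
have ch z : C z -> {for z, continuous h}.
  case: z => s t [/= s01 _]; apply: arc_continuous => //.
  - by apply: gK.
  - by apply: gab; move: s01; rewrite in_itv.
  - apply: (@cvg_comp _ _ _ (fun z : R * R => arc a b z.1) g); last exact: gc.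
    by apply: (@cvg_comp _ _ _ fst (arc a b)); [exact: cvg_fst|exact: ca].
  - exact: cvg_snd.
have [d1 d10 H1] := compact_unif_continuous cC ch delta0.
have [d2 d20 H2] := compact_unif_continuous (@segment_compact R 0 1) (fun s _ => @ca s) eta0.
pose d := Num.min d1 d2.
have d0 : 0 < d by rewrite lt_min d10.
have [M0 M0P] : exists M0 : nat, d^-1 < M0%:R.
  by exists (Num.truncn d^-1).+1; apply: truncnS_gt.
exists M0 => M M0M la.
have Mp : 0 < M%:R :> R by rewrite ltr0n; apply: leq_ltn_trans M0M.
have Md : M%:R^-1 < d.
  by rewrite invf_plt ?posrE //; apply: lt_trans M0P _; rewrite ltr_nat.
have unit j : (j <= M)%N -> 0 <= (j%:R / M%:R : R) <= 1.
  by move=> jM; rewrite divr_ge0 //= ler_pdivrMr // mul1r ler_nat.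
have diff j : `|j.+1%:R / M%:R - j%:R / M%:R : R| < d.
  by rewrite -mulrBl -natr1 addrAC subrr add0r mul1r gtr0_norm // invr_gt0.
have CP s t : 0 <= s <= 1 -> 0 <= t <= 1 -> C (s, t).
  by move=> s01 t01; split; rewrite /= in_itv.
have hE s t : arc v (g (arc a b s)) t = h (s, t) by [].
have pn (s t : R) : `|(s, t)| = Num.max `|s| `|t| by [].
have M0' : (0 < M)%N by apply: leq_ltn_trans M0M.
suff H i : (i <= M)%N -> lifts M (arc a b (i%:R / M%:R)).
  by have := H M (leqnn _); rewrite divff ?gt_eqF // arc1.
elim: i => [|i IH] iM; first by rewrite mul0r arc0.
apply: lifts_step (IH (ltnW iM)) => //.
- exact: gab (unit _ iM).
- apply: H2; rewrite /= ?in_itv ?unit ?(ltnW iM) //.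
  by rewrite distrC; apply: lt_le_trans (diff i) _; rewrite ge_min lexx orbT.
- move=> j jM; rewrite !hE; apply: H1; try by apply: CP; apply: unit => //; apply: ltnW.
  rewrite -[X in `|X|]/(_ - _, _ - _) pn subrr normr0 /=.
  rewrite gt_max d10 andbT.
  by apply: lt_le_trans (diff i) _; rewrite ge_min lexx.
- move=> j jM; rewrite !hE; apply: H1; try by apply: CP; apply: unit => //; apply: ltnW.
  rewrite -[X in `|X|]/(_ - _, _ - _) pn subrr normr0 /=.
  rewrite gt_max d10 /=.
  by apply: lt_le_trans (diff j) _; rewrite ge_min lexx.
Qed.

End Lifting.

(** Two points of the fibre over [v] are joined by two arcs avoiding the fibre over
    [- v]; lifting the homotopy that contracts the image of this path to [v] along
    arcs shows that they coincide. *)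
Lemma covering_injective p p' : K p -> K p' -> g p = g p' -> p = p'.
Proof.
move=> Kp Kp' gpp; have [e e0 He] := g_inj_loc.
pose eta := e / 4.
have eta0 : 0 < eta by rewrite divr_gt0.
have e4 : 4 * eta = e by rewrite /eta; field.
have {}He : forall x y, K x -> K y -> `|x - y| < 4 * eta -> g x = g y -> x = y.
  by rewrite e4.
have [delta d0 Hd] := g_open eta0.
pose v := g p; have Kv : K v by apply: gK.
have [L LP] := finite_fiber (- v).
have vNv : v != - v.
  by rewrite -subr_eq0 opprK -mulr2n -scaler_nat scaler_eq0 pnatr_eq0 /= (sphere_neq0 Kv).
(* A vector [w] orthogonal to [x] and [q] but not to [m] shows that [q] can have the direction
   [r *: x + s *: m] only for [s = 0]. Thus the arc between [x] and [m] can meet the fibre over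
   [- v] only at [x], whose image is [v]. Adding [x] itself to the list gives [m != - x]. *)
have /choice [wf wfP] := fun xq : E * E => orthogonal_pair xq.1 xq.2 n2.
pose W := [seq wf (p, q) | q <- p :: L] ++ [seq wf (p', q) | q <- p' :: L].
have [|m0 m0P] := @generic_vector R n W.
  by move=> w; rewrite mem_cat => /orP[] /mapP [q _ ->]; have [] := wfP (p, q);
   have [] := wfP (p', q).
have pair x q : (x == p) || (x == p') -> q \in x :: L ->
    exists w, [/\ dot w x = 0, dot w q = 0 & dot w m0 != 0].
  move=> xp qL; exists (wf (x, q)); have [_ wx wq] := wfP (x, q); split => //.
  apply: m0P; rewrite mem_cat; apply/orP.
  by case/orP: xp qL => /eqP -> qL; [left|right]; apply: map_f.
have m00 : m0 != 0.
  have [||w [_ _]] := pair p p; rewrite ?eqxx ?mem_head //.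
  by apply: contra_neq => ->; rewrite dot0r.
pose m := normalize m0; have Km : K m by apply: normalize_sphere.
have {}pair x q : (x == p) || (x == p') -> q \in x :: L ->
    exists w, [/\ dot w x = 0, dot w q = 0 & dot w m != 0].
  move=> xp qL; have [w [wx wq wm]] := pair x q xp qL; exists w; split => //.
  by rewrite /m /normalize dotZr mulf_neq0 // invr_neq0 // gt_eqF // enorm_gt0.
clearbody m.
have mN x : (x == p) || (x == p') -> m != - x.
  move=> xp; have [|w [wx _]] := pair x x xp; first exact: mem_head.
  by apply: contra_neq => ->; rewrite dotNr wx oppr0.
have avoid x (s r : R) : (x == p) || (x == p') -> g x = v ->
    K (normalize (r *: x + s *: m)) -> (s = 0 -> r = 1) -> g (normalize (r *: x + s *: m)) != - v.
  move=> xp gx Kq sr; apply/eqP => gq; have qL := LP _ Kq gq.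
  have [|w [wx wq wm]] := pair x _ xp (_ : normalize (r *: x + s *: m) \in x :: L).
    by rewrite inE qL orbT.
  have Kx : K x by case/orP: xp => /eqP ->.
  have s0 : s = 0.
    move: wq; rewrite /normalize dotZr => /eqP; rewrite mulf_eq0 invr_eq0 => /orP[/eqP e00|].
      by move: Kq; rewrite /sphere /= /normalize e00 invr0 scale0r dot0l => /esym/eqP; rewrite oner_eq0.
    by rewrite dotDr !dotZr wx mulr0 add0r mulf_eq0 (negbTE wm) orbF => /eqP.
  move: gq; rewrite s0 (sr s0) scale1r scale0r addr0 normalize_id // gx => /eqP.
  by rewrite (negbTE vNv).
have [M1 H1] : exists M0, forall M, (M0 < M)%N -> lifts eta p v M p -> lifts eta p v M m.
  apply: (@lifts_segment eta delta p v) => //; first by apply: mN; rewrite eqxx.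
  move=> s _; apply: avoid; rewrite ?eqxx //; last by move=> ->; rewrite subr0.
  by apply: arc_sphere => //; apply: mN; rewrite eqxx.
have pNm : p' != - m.
  by rewrite -eqr_oppLR eq_sym mN // eqxx orbT.
have [M2 H2] : exists M0, forall M, (M0 < M)%N -> lifts eta p v M m -> lifts eta p v M p'.
  apply: (@lifts_segment eta delta p v) => // s _.
  have Ka : K (arc m p' s) by apply: arc_sphere.
  rewrite /arc addrC; apply: avoid; rewrite ?eqxx ?orbT // -?gpp //.
    by move: Ka; rewrite /arc addrC.
  by move=> /eqP; rewrite subr_eq0 => /eqP <-.
pose M := (maxn M1 M2).+1.
have l0 : lifts eta p v M p by apply: lifts_refl.
apply/esym; apply: (@lifts_eq eta p v _ _ _ _ M) => //.
by apply: H2; [rewrite ltnS leq_maxr|apply: H1 => //; rewrite ltnS leq_maxl].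
Qed.

(** The arc from [g x0] to [w] is lifted in small steps by uniform openness; as the end point
    upstairs is not prescribed, the distance moved there is irrelevant and the radius 1 is taken. *)
Lemma reach_arc x0 w : K x0 -> K w -> w != - g x0 -> exists2 x, K x & g x = w.
Proof.
move=> Kx0 Kw wN; have [d d0 Hd] := g_open (@ltr01 R).
have Kv := gK Kx0; set v := g x0 in wN Kv *.
have ca (s : R) : arc v w s' @[s' --> s] --> arc v w s.
  by apply: arc_continuous => //; first [exact: cvg_cst|exact: cvg_id].
have [e e0 H] := compact_unif_continuous (@segment_compact R 0 1) (fun s _ => @ca s) d0.
have [M0 M0P] : exists M0 : nat, e^-1 < M0%:R.
  by exists (Num.truncn e^-1).+1; apply: truncnS_gt.
pose M := M0.+1.
have Mp : 0 < M%:R :> R by rewrite ltr0n.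
have Md : M%:R^-1 < e.
  by rewrite invf_plt ?posrE //; apply: lt_trans M0P _; rewrite ltr_nat.
suff HI i : (i <= M)%N -> exists2 x, K x & g x = arc v w (i%:R / M%:R).
  by have [x Kx] := HI M (leqnn _); rewrite divff ?gt_eqF // arc1 // => gx; exists x.
elim: i => [|i IH] iM; first by exists x0 => //; rewrite mul0r arc0.
have [x Kx gx] := IH (ltnW iM).
have [|y [Ky _ gy]] := @Hd x (arc v w (i.+1%:R / M%:R)) Kx (arc_sphere _ Kv Kw wN); last by exists y.
have unit j : (j <= M)%N -> 0 <= (j%:R / M%:R : R) <= 1.
  by move=> jM; rewrite divr_ge0 //= ler_pdivrMr // mul1r ler_nat.
rewrite gx; apply: H; rewrite /= ?in_itv ?unit ?(ltnW iM) //.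
by rewrite -mulrBl -natr1 addrAC subrr add0r mul1r gtr0_norm // invr_gt0.
Qed.

(** One arc reaches everything but the antipode of [g x0]; the antipode is reached in two arcs,
    through a point orthogonal to it. *)
Lemma covering_surjective w : K w -> exists2 x, K x & g x = w.
Proof.
move=> Kw; pose x0 := w; have Kx0 : K x0 by [].
have [wN|wN] := eqVneq w (- g x0); last exact: reach_arc wN.
have [u [u0 uw _]] := orthogonal_pair w w n2.
have Km := normalize_sphere u0.
have um : dot u (normalize u) != 0.
  by rewrite /normalize dotZr mulf_neq0 ?invr_neq0 ?dot_eq0 // gt_eqF // enorm_gt0.
have [x Kx gx] : exists2 x, K x & g x = normalize u.
  apply: reach_arc Kx0 Km _; rewrite -wN.
  by apply: contra_neq um => ->.
apply: reach_arc Kx Kw _; rewrite gx.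
apply: contra_neq um => wE; rewrite -[normalize u]opprK -wE dotNr uw oppr0 //.
Qed.

End Covering.

(** * Symmetry of second derivatives *)

Section Young.
Context {R : realType} {N : nat}.
Local Notation E := 'rV[R]_N.
Variables (F : E -> R) (U : set E) (x : E).
Hypotheses (oU : open U) (Ux : U x) (dF : forall y, U y -> differentiable F y).
Local Notation e := (delta_mx 0).

Definition second_difference (i j : 'I_N) (t : R) : R :=
  F (x + t *: e i + t *: e j) - F (x + t *: e i) - F (x + t *: e j) + F x.

Lemma second_differenceC i j t : second_difference i j t = second_difference j i t.
Proof. by rewrite /second_difference (addrAC x (t *: e i)); ring. Qed.

Lemma delta_norm i : `|e i : E| <= 1.
Proof.
by apply: rowvec_norm_le => // j; rewrite mxE eqxx /=; case: (_ == _); rewrite ?normr1 ?normr0.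
Qed.

(** By the mean value theorem in direction [i], the second difference is [t] times the difference of
    two values of [pderiv i F], which differentiability at [x] evaluates. The errors are at most
    [eps] times [(s + 1) * t] and [s * t] with [s <= 1], whence the constant 3. *)
Lemma second_difference_le i j eps : differentiable (pderiv i F) x -> 0 < eps ->
  exists2 r : R, 0 < r & forall t, 0 < t -> t < r ->
    `|second_difference i j t - t ^+ 2 * pderiv j (pderiv i F) x| <= 3 * eps * t ^+ 2.
Proof.
move=> dA eps0; set A := pderiv i F in dA *.
have : nbhs x [set y | U y /\ `|A y - A x - 'd A x (y - x)| <= eps * `|y - x|].
  have h1 : nbhs x U by exact: open_nbhs_nbhs.
  exact: (filterI h1 (differentiable_eps dA eps0)).
move=> /nbhs_ballP [r /= r0 rP].
exists (r / 2); first by rewrite divr_gt0.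
move=> t t0 tr.
have inball (a b : R) : 0 <= a <= 1 -> 0 <= b <= 1 -> ball x r (x + ((a * t) *: e i + (b * t) *: e j)) /\
    `|(a * t) *: e i + (b * t) *: e j : E| <= (a + b) * t.
  move=> /andP[a0 a1] /andP[b0 b1].
  have h : `|(a * t) *: e i + (b * t) *: e j : E| <= (a + b) * t.
    apply: le_trans (ler_normD _ _) _; rewrite normrZ [X in _ + X]normrZ mulrDl.
    have at0 : 0 <= a * t by rewrite mulr_ge0 // ltW.
    have bt0 : 0 <= b * t by rewrite mulr_ge0 // ltW.
    rewrite [X in X * _ + _]ger0_norm // [X in _ + X * _]ger0_norm //.
    by apply: lerD; apply: ler_piMr => //; exact: delta_norm.
  split=> //; rewrite -ball_normE /= opprD addrA subrr add0r normrN.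
  apply: le_lt_trans h _.
  have : (a + b) * t <= 2 * t by apply: ler_wpM2r; [exact: ltW|lra].
  by move=> h2; apply: le_lt_trans h2 _; rewrite mulrC -ltr_pdivlMr.
have z01 : 0 <= (0 : R) <= 1 by rewrite lexx ler01.
have o01 : 0 <= (1 : R) <= 1 by rewrite lexx ler01.
pose F' y := F (y + t *: e j) - F y.
have dF1 s : 0 <= s <= 1 -> differentiable F (x + s *: (t *: e i)).
  move=> s01; apply: dF; have [/rP [+ _] _] := inball s 0 s01 z01.
  by rewrite mul0r scale0r addr0 scalerA.
have dF2 s : 0 <= s <= 1 -> differentiable F (x + s *: (t *: e i) + t *: e j).
  move=> s01; apply: dF; have [/rP [+ _] _] := inball s 1 s01 o01.
  by rewrite mul1r addrA scalerA.
have dsh y : differentiable (fun y => y + t *: e j : E) y by apply: differentiableD.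
have dF2' s : 0 <= s <= 1 -> differentiable (fun y => F (y + t *: e j)) (x + s *: (t *: e i)).
  move=> s01; apply: (@differentiable_comp _ _ _ _ (fun y => y + t *: e j) F) => //.
  exact: dF2.
have [|s s01 H] := @mean_value R N F' x (t *: e i).
  move=> s s01; apply: differentiableB; [exact: dF2'|exact: dF1].
have HE : second_difference i j t = t * (A (x + s *: (t *: e i) + t *: e j) - A (x + s *: (t *: e i))).
  have -> : second_difference i j t = F' (x + t *: e i) - F' x.
    by rewrite /F' /second_difference; ring.
  rewrite H deriveE; last by apply: differentiableB; [exact: dF2'|exact: dF1].
  rewrite linearZ /= -[LHS]/(t * _); congr (_ * _).
  rewrite -deriveE; last by apply: differentiableB; [exact: dF2'|exact: dF1].
  rewrite deriveB; [|by apply: diff_derivable; exact: dF2'|by apply: diff_derivable; exact: dF1].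
  congr (_ - _); rewrite deriveE; last exact: dF2'.
  rewrite -[X in diff _ X](_ : F \o (fun y => y + t *: e j) = _) // diff_comp //; last exact: dF2.
  rewrite /= /A /pderiv deriveE; last exact: dF2.
  congr ('d _ _ _); rewrite -deriveE //.
  rewrite deriveD; [|exact: derivable_id|exact: derivable_cst].
  by rewrite derive_id derive_cst addr0.
have [/rP [_ B1] N1] := inball s 1 s01 o01.
have [/rP [_ B2] N2] := inball s 0 s01 z01.
rewrite HE.
have E1 : x + s *: (t *: e i) + t *: e j = x + ((s * t) *: e i + (1 * t) *: e j).
  by rewrite mul1r addrA scalerA.
have E2 : x + s *: (t *: e i) = x + ((s * t) *: e i + (0 * t) *: e j).
  by rewrite mul0r scale0r addr0 scalerA.
rewrite E1 E2.
move: B1 B2; rewrite !(addrC x) !addrK => B1 B2.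
set h1 := (s * t) *: e i + (1 * t) *: e j in B1 N1 *.
set h2 := (s * t) *: e i + (0 * t) *: e j in B2 N2 *.
have hd : 'd A x h1 - 'd A x h2 = t * pderiv j A x.
  rewrite -linearB /= /h1 /h2 opprD addrACA subrr add0r mul1r mul0r scale0r subr0.
  by rewrite linearZ /= /pderiv deriveE.
have -> : t * (A (h1 + x) - A (h2 + x)) - t ^+ 2 * pderiv j A x =
    t * ((A (h1 + x) - A x - 'd A x h1) - (A (h2 + x) - A x - 'd A x h2)).
  rewrite expr2 -mulrA -hd; ring.
rewrite normrM gtr0_norm // expr2 mulrCA; apply: ler_wpM2l; first exact: ltW.
apply: le_trans (ler_normB _ _) _.
apply: le_trans (lerD B1 B2) _; rewrite -mulrDr.
rewrite (mulrC 3) -mulrA; apply: ler_wpM2l; first exact: ltW.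
apply: le_trans (lerD N1 N2) _; rewrite -mulrDl; apply: ler_wpM2r; first exact: ltW.
by move: s01 => /andP[_ s1]; lra.
Qed.

(** Divided by [t ^+ 2], the symmetric second difference approximates both mixed derivatives; two
    errors of [3 * (eps / 6)] add up to [eps]. *)
Lemma young i j : differentiable (pderiv i F) x -> differentiable (pderiv j F) x ->
  pderiv j (pderiv i F) x = pderiv i (pderiv j F) x.
Proof.
move=> di dj; apply/eqP; rewrite -subr_eq0 -normr_le0; apply/ler_addgt0Pr => eps eps0.
rewrite add0r; have e6 : 0 < eps / 6 by rewrite divr_gt0.
have [r1 r10 H1] := @second_difference_le i j _ di e6.
have [r2 r20 H2] := @second_difference_le j i _ dj e6.
pose t := Num.min r1 r2 / 2.
have m0 : 0 < Num.min r1 r2 by rewrite lt_min r10.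
have t0 : 0 < t by rewrite divr_gt0.
have tm : t < Num.min r1 r2 by rewrite ltr_pdivrMr // ltr_pMr // ltr1n.
have := H1 t t0 (lt_le_trans tm _); rewrite ge_min lexx => /(_ isT) h1.
have := H2 t t0 (lt_le_trans tm _); rewrite ge_min lexx orbT second_differenceC => /(_ isT) h2.
set a := pderiv j _ x in h1 *; set b := pderiv i _ x in h2 *.
have t20 : 0 < t ^+ 2 by rewrite exprn_gt0.
rewrite -(ler_pM2l t20).
rewrite -[X in X * `|_|](gtr0_norm t20) -normrM.
have -> : t ^+ 2 * (a - b) = (second_difference i j t - t ^+ 2 * b) -
   (second_difference i j t - t ^+ 2 * a) by ring.
apply: le_trans (ler_normB _ _) _; apply: le_trans (lerD h2 h1) _.
by rewrite le_eqVlt; apply/orP; left; apply/eqP; field.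
Qed.

End Young.

(** * Differentials of maps on the sphere *)

Section Jacobian.
Context {R : realType} {n : nat}.
Local Notation E := 'rV[R]_n.+1.
Local Notation S := (set_type (sphere R n)).
Local Notation K := (sphere R n).
Local Notation U := ([set x : E | x != 0]).

Lemma near_neq0 (x : E) : x != 0 -> \forall y \near x, y != 0.
Proof.
move=> x0; have : nbhs x [set y : E | y != 0]; last by [].
by apply: open_nbhs_nbhs; split => //; exact: open_neq0.
Qed.

Definition Jac m (f : S -> 'rV[R]_m) (x : E) : 'M[R]_(n.+1, m) :=
  \matrix_(i, j) pderiv i (fun y => radial_ext f y 0 j) x.

Section Facts.
Variables (m : nat) (f : S -> 'rV[R]_m).
Hypothesis sf : smooth f.

Lemma smooth_coord_differentiable x j : x != 0 ->
  differentiable (fun y => radial_ext f y 0 j) x.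
Proof. by move=> x0; apply: Ck_on_diff ((smoothP f).1 sf j 0%N) x0. Qed.

Lemma smooth_differentiable x : x != 0 -> differentiable (radial_ext f) x.
Proof. by move=> x0; apply: differentiable_row => j; exact: smooth_coord_differentiable. Qed.

Lemma derive_Jac x v : x != 0 -> 'D_v (radial_ext f) x = v *m Jac f x.
Proof.
move=> x0; apply/rowP => j; rewrite derive_coord; last exact: smooth_differentiable.
rewrite derive_pderiv; last exact: smooth_coord_differentiable.
by rewrite mxE; apply: eq_bigr => i _; rewrite mxE.
Qed.

Lemma sdiffE p v : sdiff f p v = v *m Jac f (val p).
Proof. by rewrite /sdiff derive_Jac // (sphere_neq0 (valS p)). Qed.

Lemma Jac_radial x : x != 0 -> x *m Jac f x = 0.
Proof.
move=> x0; rewrite -derive_Jac //; apply: cvg_lim; first exact: norm_hausdorff.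
apply: (@cvg_trans _ ((fun=> 0 : 'rV[R]_m) @ (0 : R)^')); last exact: cvg_cst.
apply: near_eq_cvg; near=> h.
have hx : h *: x + x = (h + 1) *: x by rewrite scalerDl scale1r.
rewrite /= hx.
rewrite radial_extZ ?subrr ?scaler0 //.
have : `|h| < 1 by near: h; exact: dnbhs0_lt.
by rewrite ltr_norml => /andP[h1 _]; rewrite -ltrBlDr sub0r.
Unshelve. all: by end_near. Qed.

Lemma JacZ r x : 0 < r -> x != 0 -> Jac f (r *: x) = r^-1 *: Jac f x.
Proof.
move=> r0 x0; apply/matrixP => i j; rewrite !mxE.
have r1 : r^-1 *: (r *: x) = x by rewrite scalerA mulVf ?scale1r // gt_eqF.
have dZ y : differentiable (fun y : E => r^-1 *: y) y by apply: differentiableZ.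
have dF : differentiable (fun y => radial_ext f y 0 j) (r^-1 *: (r *: x)).
  by rewrite r1; exact: smooth_coord_differentiable.
have FE : (fun y => radial_ext f y 0 j) = (fun y => radial_ext f y 0 j) \o (fun y => r^-1 *: y).
  by apply/funext => y /=; rewrite radial_extZ // invr_gt0.
rewrite {1}FE /pderiv deriveE; last exact: differentiable_comp.
rewrite diff_comp //= r1 diffZ //= diff_val.
by rewrite -[X in 'd _ _ X]/(r^-1 *: delta_mx 0 i) linearZ /= deriveE //; exact: smooth_coord_differentiable.
Qed.

End Facts.

Lemma Jac_comp m (f : S -> 'rV[R]_m) (g : S -> S) p : smooth f -> smooth (post_incl g) ->
  Jac (f \o g) (val p) = Jac (post_incl g) (val p) *m Jac f (val (g p)).
Proof.
move=> sf sg; have p0 := sphere_neq0 (valS p); apply/matrixP => i j; rewrite !mxE.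
have gp : radial_ext (post_incl g) (val p) = val (g p) by rewrite radial_ext_val.
transitivity (pderiv i ((fun y => radial_ext f y 0 j) \o radial_ext (post_incl g)) (val p)).
  apply: near_eq_derive; near=> y; rewrite radial_ext_comp //.
  by near: y; exact: near_neq0.
rewrite /pderiv pderiv_comp; first last.
- by rewrite gp; apply: smooth_coord_differentiable => //; apply: sphere_neq0 (valS _).
- exact: smooth_differentiable.
- by apply: eq_bigr => k _; rewrite !mxE mulrC gp.
Unshelve. all: by end_near. Qed.

(** The determinant of the differential of the degree-one homogeneous extension. *)
Definition odet (g : S -> S) (p : S) : R :=
  \det (Jac (post_incl g) (val p) + (val p)^T *m val (g p)).

(** The derivative of the constant function [|g|^2 = 1], which holds for the radial extension on a
    neighbourhood of [x]. *)
Lemma post_incl_normal (g : S -> S) x : smooth (post_incl g) -> x != 0 ->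
  radial_ext (post_incl g) x *m (Jac (post_incl g) x)^T = 0.
Proof.
move=> sg x0; apply/rowP => i; rewrite !mxE.
pose c y := \sum_j radial_ext (post_incl g) y 0 j * radial_ext (post_incl g) y 0 j.
have dj j := smooth_coord_differentiable sg j x0.
have c1 : pderiv i c x = 0.
  transitivity (pderiv i (cst 1 : E -> R) x); last exact: derive_cst.
  apply: near_eq_derive; near=> y.
  have : K (radial_ext (post_incl g) y).
    by apply: radial_ext_post_incl; near: y; exact: near_neq0.
  by [].
have : pderiv i c x = 2 * \sum_j radial_ext (post_incl g) x 0 j * (Jac (post_incl g) x)^T j i.
  rewrite /pderiv /c mulr_sumr.
  rewrite -[X in 'D_ _ X x](_ : \sum_j (fun y => radial_ext (post_incl g) y 0 j * radial_ext (post_incl g) y 0 j) = _); last first.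
    by apply/funext => y; rewrite fct_sumE.
  rewrite derive_sum; last first.
    by move=> j; apply: derivableM; apply: diff_derivable.
  apply: eq_bigr => j _; rewrite deriveM; [|exact: diff_derivable..].
  by rewrite !mxE -[X in X + X = _]/(_ * pderiv i _ x) -mulr2n mulr_natl.
by rewrite c1 => /esym/eqP; rewrite mulf_eq0 pnatr_eq0 /= => /eqP.
Unshelve. all: by end_near. Qed.

(** The cross terms of the matrix product vanish: the differential of [h] takes values orthogonal to
    [h p], and that of [g] kills the radial direction [h p]. *)
Lemma odet_comp (g h : S -> S) p : smooth (post_incl g) -> smooth (post_incl h) ->
  odet (g \o h) p = odet h p * odet g (h p).
Proof.
move=> sg sh; rewrite /odet -det_mulmx; congr (\det _).
have -> : post_incl (g \o h) = post_incl g \o h by [].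
rewrite Jac_comp // mulmxDl !mulmxDr.
have h1 : Jac (post_incl h) (val p) *m (val (h p))^T = 0.
  have := @post_incl_normal h (val p) sh (sphere_neq0 (valS p)); rewrite radial_ext_val.
  by move=> /(congr1 trmx); rewrite trmx_mul trmxK trmx0.
have h2 : val (h p) *m Jac (post_incl g) (val (h p)) = 0.
  by apply: Jac_radial => //; apply: sphere_neq0 (valS _).
have h3 : val (h p) *m (val (h p))^T = 1%:M.
  by rewrite [LHS]mx11_scalar -dotE (valS (h p)).
rewrite [X in _ = _ + X + _]mulmxA h1 mul0mx addr0 -mulmxA h2 mulmx0 add0r.
by rewrite -mulmxA (mulmxA (val (h p))) h3 mul1mx.
Qed.

Hypothesis n0 : (0 < n)%N.

Lemma push_frameE m (f : S -> 'rV[R]_m) p (u : n.-tuple E) : smooth f ->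
  push_frame f p u = [tuple of map (mulmx^~ (Jac f (val p))) u].
Proof.
by move=> sf; apply: eq_from_tnth => i; rewrite !tnth_map sdiffE.
Qed.

Lemma push_frame_det (g : S -> S) p u : smooth (post_incl g) -> tangent_frame p u ->
  frame_det [tuple of rcons (push_frame (post_incl g) p u) (val (g p))] =
  frame_det [tuple of rcons u (val p)] * odet g p.
Proof.
move=> sg tu; rewrite push_frameE //.
exact: (frame_det_push _ (valS p) (Jac_radial sg (sphere_neq0 (valS p))) tu).
Qed.

Lemma push_frame_tangent (g : S -> S) p u : smooth (post_incl g) ->
  tangent_frame (g p) (push_frame (post_incl g) p u).
Proof.
move=> sg i; rewrite push_frameE // tnth_map /tangent dot_mulmx.
have := @post_incl_normal g (val p) sg (sphere_neq0 (valS p)); rewrite radial_ext_val => ->.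
exact: dot0r.
Qed.

Lemma positive_frame_exists p : exists u : n.-tuple E, positive_frame p u.
Proof.
have [u [/(orthonormal_rcons _ (valS p)) [_ tu] du]] := positive_frame_ex n0 (valS p).
by exists u; split.
Qed.

Lemma orientation_preservingP (g : S -> S) : smooth (post_incl g) ->
  orientation_preserving g <-> forall p, 0 < odet g p.
Proof.
move=> sg; split=> [H p|H p u [tu du]].
  have [u [tu du]] := positive_frame_exists p.
  have [_] := H p u (conj tu du).
  by rewrite push_frame_det // pmulr_rgt0.
by split; [exact: push_frame_tangent|rewrite push_frame_det // mulr_gt0].
Qed.

Lemma orientation_reversingP (g : S -> S) : smooth (post_incl g) ->
  orientation_reversing g <-> forall p, odet g p < 0.
Proof.
move=> sg; split=> [H p|H p u [tu du]].
  have [u [tu du]] := positive_frame_exists p.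
  have [_] := H p u (conj tu du).
  by rewrite push_frame_det // pmulr_rlt0.
by split; [exact: push_frame_tangent|rewrite push_frame_det // pmulr_rlt0].
Qed.

End Jacobian.

(** * Determinants, normalization and cross products in families *)

Section FamilyClosure.
Context {R : realType} {n : nat}.
Local Notation E := 'rV[R]_n.+1.
Local Notation S := (set_type (sphere R n)).
Local Notation U := ([set x : E | x != 0]).
Context {T : Type}.
Variables (F : set_system T) (A : set T) (t0 : T) (K : set E).
Hypotheses (FF : Filter F) (FA : F A) (At0 : A t0) (KU : K `<=` U).
Local Notation Ck_family := (Ck_family F A t0 K U).
Let oU := @open_neq0 R n.

Definition smooth_family m (G : T -> E -> 'rV[R]_m) := forall j k, Ck_family k (fun t x => G t x 0 j).

Lemma smooth_family_comp m (f : S -> 'rV[R]_m) (g : T -> S -> S) : smooth f ->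
  smooth_family (fun t => radial_ext (post_incl (g t))) ->
  smooth_family (fun t => radial_ext (f \o g t)).
Proof.
move=> sf Gg j k.
apply: (Ck_family_ext FF FA At0 oU KU (G := fun t x =>
  (fun y => radial_ext f y 0 j) (radial_ext (post_incl (g t)) x))).
  by move=> t x At Ux; rewrite radial_ext_comp.
apply: (Ck_family_comp FF FA At0 oU KU (V := U) (Phi := fun y => radial_ext f y 0 j)
  (G := fun t => radial_ext (post_incl (g t)))).
- exact: (smoothP f).1 sf j k.
- by move=> j'; apply: Gg.
- by move=> t x At Ux; apply: sphere_subU; apply: radial_ext_post_incl.
Qed.

Lemma Ck_family_det N (B : T -> E -> 'M[R]_N) : (forall i j k, Ck_family k (fun t x => B t x i j)) ->
  forall k, Ck_family k (fun t x => \det (B t x)).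
Proof.
move=> H k; rewrite /determinant; apply: Ck_family_sum => // s.
by apply: Ck_family_mul => //; [exact: Ck_family_cst|apply: Ck_family_prod].
Qed.

Lemma Ck_family_enorm m (G : T -> E -> 'rV[R]_m) : smooth_family G ->
  (forall t x, A t -> U x -> G t x != 0) -> forall k, Ck_family k (fun t x => enorm (G t x)).
Proof.
move=> H G0 k; apply: Ck_family_sqrt => //.
  by move=> t x At Ux; rewrite dot_gt0; apply: G0.
by apply: Ck_family_sum => // j; apply: Ck_family_mul.
Qed.

Lemma smooth_family_normalize m (G : T -> E -> 'rV[R]_m) : smooth_family G ->
  (forall t x, A t -> U x -> G t x != 0) -> smooth_family (fun t x => normalize (G t x)).
Proof.
move=> H G0 j k.
apply: (Ck_family_ext FF FA At0 oU KU (G := fun t x => (enorm (G t x))^-1 * G t x 0 j)).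
  by move=> t x _ _; rewrite mxE.
apply: Ck_family_mul => //; apply: Ck_family_inv => //; last exact: Ck_family_enorm.
by move=> t x At Ux; rewrite gt_eqF // enorm_gt0 G0.
Qed.

Lemma Ck_family_Jac m (f : T -> S -> 'rV[R]_m) : smooth_family (fun t => radial_ext (f t)) ->
  forall i j k, Ck_family k (fun t x => Jac (f t) x i j).
Proof.
move=> H i j k; apply: (Ck_family_ext FF FA At0 oU KU
  (G := fun t => pderiv i (fun y => radial_ext (f t) y 0 j))).
  by move=> t x _ _; rewrite mxE.
by have [_ _] := H j k.+1; apply.
Qed.

Lemma smooth_family_cross (f : T -> S -> E) : smooth_family (fun t => radial_ext (f t)) ->
  smooth_family (fun t x => cross x (Jac (f t) x)).
Proof.
move=> H c k.
apply: (Ck_family_ext FF FA At0 oU KU (G := fun t x => \det (Jac (f t) x + x^T *m delta_mx 0 c))).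
  by move=> t x _ _; rewrite mxE.
apply: Ck_family_det => i j k'.
apply: (Ck_family_ext FF FA At0 oU KU (G := fun t x =>
   Jac (f t) x i j + x 0 i * (delta_mx 0 c : E) 0 j)).
  by move=> t x _ _; rewrite [RHS]mxE [X in _ = _ + X]mxE big_ord1 [x^T _ _]mxE.
apply: Ck_family_add => //; first exact: Ck_family_Jac.
by apply: Ck_family_mul => //; [exact: Ck_family_coord|exact: Ck_family_cst].
Qed.

End FamilyClosure.

(** * Gauss maps *)

Section GaussMap.
Context {R : realType} {n : nat}.
Hypothesis n0 : (0 < n)%N.
Local Notation E := 'rV[R]_n.+1.
Local Notation S := (set_type (sphere R n)).
Local Notation K := (sphere R n).
Local Notation U := ([set x : E | x != 0]).
Implicit Types f : Cinfty R n n.+1.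

Lemma val_neq0 (p : S) : val p != 0.
Proof. exact: sphere_neq0 (valS p). Qed.

Lemma sphere_elt (x : E) : K x -> exists p : S, val p = x.
Proof. by move=> Kx; exists (SigSub (mem_set Kx)). Qed.

Lemma immersionP f : immersion f <->
  smooth f /\ forall p : S, nondeg (val p) (Jac f (val p)).
Proof.
split=> [[sf inj]|[sf nd]]; split => // p.
  split; [exact: valS|exact: Jac_radial (val_neq0 p)|].
  by move=> v vp vJ; apply: (inj p v) => //; rewrite sdiffE.
by move=> v vp; rewrite sdiffE //; have [_ _] := nd p; apply.
Qed.

Section Immersion.
Variable f : Cinfty R n n.+1.
Hypothesis imf : immersion f.
Let sf : smooth f := imf.1.
Local Notation J p := (Jac f (val p)).

Let nd (p : S) : nondeg (val p) (J p).
Proof. by have [_] := (immersionP f).1 imf; apply. Qed.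

Lemma gauss_normalP p N : gauss_normal f p N <-> is_normal (val p) (J p) (val N).
Proof.
rewrite -(gauss_frame_normal n0 (nd p) (valS N)).
split=> H u tu; have := H u tu; rewrite !push_frameE // => -[H1 H2].
- split=> [[pu ou]|/H2 [[_ pu] ou]] //.
  by apply: H1.
- by split=> [[[_ pu] ou]|/H2 [pu ou]] //; exact: H1.
Qed.

Lemma gauss_map_normal (p : S) : is_normal (val p) (J p) (val (gauss_map f p)).
Proof.
have [nu nuP] := is_normal_ex (nd p).
have [N vN] : exists N : S, val N = nu by apply: sphere_elt; have [] := nuP.
apply/gauss_normalP; apply: (@xgetI _ p [set N | gauss_normal f p N] N).
by apply/gauss_normalP; rewrite vN.
Qed.

Lemma gauss_map_unique (p N : S) : is_normal (val p) (J p) (val N) -> gauss_map f p = N.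
Proof.
move=> /(is_normalP _ (nd p)) h; apply: val_inj.
by rewrite h; apply/(is_normalP _ (nd p)); exact: gauss_map_normal.
Qed.

Lemma neq0_sphere_scale (x : E) : x != 0 -> exists p : S, x = enorm x *: val p /\
  forall m (h : S -> 'rV[R]_m), radial_ext h x = h p.
Proof.
move=> x0; have [p vp H] := radial_ext_ex x0; exists p; split => //.
by rewrite vp scalerA mulfV ?scale1r // gt_eqF // enorm_gt0.
Qed.

(** On the sphere this is [is_normalP]; both sides are unchanged under positive scaling of [x]. It
    turns a Gauss map defined by choice into an expression in first derivatives. *)
Lemma gauss_map_ext x : x != 0 ->
  radial_ext (post_incl (gauss_map f)) x = normalize (cross x (Jac f x)).
Proof.
move=> x0; have [p [xE ->]] := neq0_sphere_scale x0.
have e0 : 0 < enorm x by rewrite enorm_gt0.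
rewrite [in RHS]xE (JacZ sf e0 (val_neq0 p)) (crossZ (nd p) e0) normalizeZ.
  exact/(is_normalP _ (nd p))/gauss_map_normal.
by rewrite mulr_gt0 ?exprn_gt0 ?invr_gt0.
Qed.

Lemma cross_Jac_neq0 x : x != 0 -> cross x (Jac f x) != 0.
Proof.
move=> x0; have [p [xE _]] := neq0_sphere_scale x0.
have e0 : 0 < enorm x by rewrite enorm_gt0.
rewrite xE (JacZ sf e0 (val_neq0 p)) (crossZ (nd p) e0).
by rewrite scaler_eq0 (negbTE (cross_neq0 (nd p))) orbF gt_eqF // mulr_gt0 ?exprn_gt0 ?invr_gt0.
Qed.

Lemma Jac_gauss_orthogonal x : x != 0 ->
  Jac f x *m (radial_ext (post_incl (gauss_map f)) x)^T = 0.
Proof.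
move=> x0; have [p [xE ->]] := neq0_sphere_scale x0.
have e0 : 0 < enorm x by rewrite enorm_gt0.
rewrite xE (JacZ sf e0 (val_neq0 p)) -scalemxAl.
have [_ h _] := gauss_map_normal p.
have := congr1 trmx h; rewrite trmx_mul trmxK trmx0 /post_incl => ->.
by rewrite scaler0.
Qed.

End Immersion.

Section GaussFamily.
Context {T : Type}.
Variables (F : set_system T) (A : set T) (t0 : T) (K0 : set E).
Hypotheses (FF : Filter F) (FA : F A) (At0 : A t0) (KU : K0 `<=` U).

Lemma smooth_family_gauss (f : T -> Cinfty R n n.+1) : (forall t, A t -> immersion (f t)) ->
  smooth_family F A t0 K0 (fun t => radial_ext (f t)) ->
  smooth_family F A t0 K0 (fun t => radial_ext (post_incl (gauss_map (f t)))).
Proof.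
move=> imf H j k.
apply: (Ck_family_ext FF FA At0 (@open_neq0 R n) KU
  (G := fun t x => normalize (cross x (Jac (f t) x)) 0 j)).
  by move=> t x At Ux; rewrite gauss_map_ext //; exact: imf.
apply: smooth_family_normalize => //; first exact: smooth_family_cross.
by move=> t x At Ux; apply: cross_Jac_neq0 => //; exact: imf.
Qed.

End GaussFamily.

Lemma smooth_constant_family m (h : S -> 'rV[R]_m) : smooth h <->
  smooth_family (globally [set tt]) setT tt set0 (fun _ => radial_ext h).
Proof. exact: smoothP. Qed.

Lemma smooth_gauss f : immersion f -> smooth (post_incl (gauss_map f)).
Proof.
move=> imf; apply/smooth_constant_family; apply: (@smooth_family_gauss _ _ _ _ _ _ _ _ _ (fun=> f)) => //.
exact/smooth_constant_family/imf.1.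
Qed.

Lemma smooth_compose m (h : S -> 'rV[R]_m) (g : S -> S) : smooth h ->
  smooth (post_incl g) -> smooth (h \o g).
Proof.
move=> sh sg; apply/smooth_constant_family; apply: (@smooth_family_comp _ _ _ _ _ _ _ _ _ _ _ _ h (fun=> g)) => //.
exact/smooth_constant_family.
Qed.

Section CurvatureData.
Variable f : Cinfty R n n.+1.
Hypothesis imf : immersion f.
Let sf : smooth f := imf.1.
Local Notation J p := (Jac f (val p)).
Local Notation L p := (Jac (post_incl (gauss_map f)) (val p)).
Let sg := smooth_gauss imf.

(** Differentiating the orthogonality of the [i]-th partial of [f] to [nu] in direction [k] gives
    minus the pairing of [nu] with a second derivative of [f], symmetric in [i] and [k] by [young].
    Radial extensions make ambient coordinates available in place of charts. *)
Lemma shape_symmetric (p : S) : J p *m (L p)^T = (J p *m (L p)^T)^T.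
Proof.
set x := val p; have x0 : x != 0 by exact: val_neq0.
pose Fc j y := radial_ext f y 0 j.
pose Nc j y := radial_ext (post_incl (gauss_map f)) y 0 j.
have sFc j k : Ck_on U k (Fc j) by exact: (smoothP f).1 sf j k.
have dF j y : y != 0 -> differentiable (Fc j) y by move=> y0; exact: Ck_on_diff (sFc j 0%N) y0.
have dpF i j y : y != 0 -> differentiable (pderiv i (Fc j)) y.
  move=> y0; have [_ _ /(_ i) H] := sFc j 1%N.
  exact: (@Ck_on_diff _ _ U 0 _ y H y0).
have dN j y : y != 0 -> differentiable (Nc j) y.
  by move=> y0; exact: Ck_on_diff ((smoothP _).1 sg j 0%N) y0.
have key i k : \sum_j pderiv i (Fc j) x * pderiv k (Nc j) x =
    - \sum_j Nc j x * pderiv k (pderiv i (Fc j)) x.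
  apply/eqP; rewrite -addr_eq0 -big_split /=; apply/eqP.
  pose c y := \sum_j pderiv i (Fc j) y * Nc j y.
  transitivity (pderiv k c x).
    rewrite /pderiv /c.
    rewrite -[X in _ = 'D_ _ X x](_ : \sum_j (fun y => pderiv i (Fc j) y * Nc j y) = _); last first.
      by apply/funext => y; rewrite fct_sumE.
    rewrite derive_sum; last first.
      move=> j; apply: derivableM; apply: diff_derivable; [exact: dpF|exact: dN].
    apply: eq_bigr => j _; rewrite deriveM //; apply: diff_derivable; [exact: dpF|exact: dN].
  transitivity (pderiv k (cst 0 : E -> R) x); last exact: derive_cst.
  apply: near_eq_derive; near=> y.
  have y0 : y != 0 by near: y; exact: near_neq0.
  have := congr1 (fun B : 'M[R]_(n.+1, 1) => B i 0) (Jac_gauss_orthogonal imf y0).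
  rewrite !mxE => <-; apply: eq_bigr => j _.
  by rewrite !mxE.
apply/matrixP => i k; rewrite [RHS]mxE ![(_ *m _) _ _]mxE.
rewrite (eq_bigr (fun j => pderiv i (Fc j) x * pderiv k (Nc j) x)); last by move=> j _; rewrite !mxE.
rewrite [RHS](eq_bigr (fun j => pderiv k (Fc j) x * pderiv i (Nc j) x)); last by move=> j _; rewrite !mxE.
transitivity (- \sum_j Nc j x * pderiv k (pderiv i (Fc j)) x); first exact: key.
transitivity (- \sum_j Nc j x * pderiv i (pderiv k (Fc j)) x); last by rewrite (key k i).
have Y j : pderiv k (pderiv i (Fc j)) x = pderiv i (pderiv k (Fc j)) x.
  exact: (@young R n.+1 (Fc j) U x (@open_neq0 R n) x0 (dF j) i k (dpF i j x x0) (dpF k j x x0)).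
exact: (congr1 (fun z => - z) (eq_bigr _ (fun j _ => congr1 (fun z => Nc j x * z) (Y j)))).
Unshelve. all: by end_near. Qed.

Lemma immersion_curvature_data (p : S) :
  curvature_data (val p) (J p) (L p) (val (gauss_map f p)).
Proof.
have [_ nd] := (immersionP f).1 imf.
split; [exact: nd|exact: gauss_map_normal|exact: Jac_radial (val_neq0 p)| |].
  by have := post_incl_normal sg (val_neq0 p); rewrite radial_ext_val.
move=> v w; rewrite (dotC (w *m J p)) !dotE !trmx_mul.
have := shape_symmetric p; rewrite trmx_mul trmxK => sym.
by rewrite -!mulmxA (mulmxA (J p)) sym !mulmxA.
Qed.

(** The differential of the Gauss map takes values orthogonal to the normal, hence in the image of
    [df]; so the [xget] in the shape operator never returns its default, and [df] can be cleared
    from the eigenvalue equation. *)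
Lemma principal_curvatureP p k : principal_curvature f p k <-> eigen (val p) (J p) (L p) k.
Proof.
have [nd [n1 nJ _] pL nL _] := immersion_curvature_data p; have [_ _ inj] := nd.
have ex v : exists w, tangent p w /\ sdiff f p w = sdiff (post_incl (gauss_map f)) p v.
  have [|w wp wJ] := solve_tangent nd n1 nJ (y := v *m L p); first exact: dot_normal.
  by exists w; rewrite !sdiffE.
have shP v : let w := - shape_operator f p v in dot w (val p) = 0 /\ w *m J p = v *m L p.
  rewrite /shape_operator opprK; have [w wP] := ex v.
  have [h1 h2] := @xgetI _ 0 [set w | tangent p w /\ sdiff f p w = sdiff (post_incl (gauss_map f)) p v] w wP.
  by split => //; rewrite -!sdiffE.
split=> [[v [vp v0 sv]]|[v [vp v0 vL]]]; exists v; split => //.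
  by have [_] := shP v; rewrite sv -scaleNr -scalemxAl.
have [wp wJ] := shP v; apply/eqP; rewrite -subr_eq0; apply/eqP; apply: inj.
  by rewrite dotBl dotZl vp mulr0 subr0; move: wp; rewrite dotNl => /eqP; rewrite oppr_eq0 => /eqP.
rewrite mulmxBl -scalemxAl; move: wJ; rewrite mulNmx vL scaleNr => /oppr_inj ->.
by rewrite subrr.
Qed.

End CurvatureData.

End GaussMap.

(** * Self-maps of the sphere with invertible differential *)

Section InverseDiffeomorphism.
Context {R : realType} {n : nat}.
Hypothesis n2 : (2 <= n)%N.
Local Notation E := 'rV[R]_n.+1.
Local Notation S := (set_type (sphere R n)).
Local Notation K := (sphere R n).
Local Notation U := ([set x : E | x != 0]).
Variable g : S -> S.
Hypothesis sg : smooth (post_incl g).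
Hypothesis nd : forall p : S, nondeg (val p) (Jac (post_incl g) (val p)).

Let oU := @open_neq0 R n.

(** The extension of a self-map of the sphere that is homogeneous of degree one;
    it inherits bijectivity and, unlike the radial extension, it has an invertible
    differential. *)
Definition cone (h : S -> S) (x : E) : E := enorm x *: radial_ext (post_incl h) x.

Lemma Ck_on_const k (c : R) : Ck_on U k (fun=> c).
Proof. by apply: Ck_family_cst. Qed.

Lemma Ck_on_enorm k : Ck_on U k (@enorm R n.+1).
Proof.
apply: (@Ck_family_enorm _ _ _ _ _ _ _ _ _ _ _ _ (fun _ (x : E) => x)) => //.
by move=> j k'; apply: Ck_family_coord.
Qed.

Lemma Ck_on_cone h : smooth (post_incl h) -> forall j k, Ck_on U k (fun x => cone h x 0 j).
Proof.
move=> sh j k; apply: (Ck_on_ext oU (Phi := fun x => enorm x * radial_ext (post_incl h) x 0 j)).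
  by move=> x _; rewrite [RHS]mxE.
apply: Ck_family_mul => //; first exact: Ck_on_enorm.
exact: (smoothP _).1 sh j k.
Qed.

Lemma smooth_cone h : (forall j k, Ck_on U k (fun x => cone h x 0 j)) -> smooth (post_incl h).
Proof.
move=> sh; apply/smoothP => j k.
apply: (Ck_on_ext oU (Phi := fun x => (enorm x)^-1 * cone h x 0 j)).
  move=> x x0; rewrite [X in _ * X]mxE mulrA mulVf ?mul1r // gt_eqF // enorm_gt0 //.
apply: Ck_family_mul => //; last exact: sh.
apply: Ck_family_inv => //; last exact: Ck_on_enorm.
by move=> _ x _ x0; rewrite gt_eqF // enorm_gt0.
Qed.

Lemma cone_scale h (p : S) r : 0 < r -> cone h (r *: val p) = r *: val (h p).
Proof.
move=> r0; rewrite /cone radial_extZ // radial_ext_val enormZ gtr0_norm //.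
by rewrite (enorm_sphere (valS p)) mulr1.
Qed.

Lemma cone_sphere h (p : S) : cone h (val p) = val (h p).
Proof. by have := cone_scale h p ltr01; rewrite !scale1r. Qed.

Lemma cone_neq0 h x : x != 0 -> cone h x != 0.
Proof.
move=> x0; have [p [-> _]] := neq0_sphere_scale x0.
have e0 : 0 < enorm x by rewrite enorm_gt0.
by rewrite cone_scale // scaler_eq0 gt_eqF //= (sphere_neq0 (valS _)).
Qed.

Lemma cone_comp h1 h2 x : x != 0 -> cone h1 (cone h2 x) = cone (h1 \o h2) x.
Proof.
move=> x0; have [p [-> _]] := neq0_sphere_scale x0.
have e0 : 0 < enorm x by rewrite enorm_gt0.
by rewrite !cone_scale.
Qed.

Lemma pderiv_enorm (x : E) i : x != 0 -> pderiv i (@enorm R n.+1) x = (enorm x)^-1 * x 0 i.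
Proof.
move=> x0; have e0 : enorm x != 0 by rewrite gt_eqF // enorm_gt0.
have de : differentiable (@enorm R n.+1) x by exact: (Ck_on_diff (Ck_on_enorm 0%N) x0).
have dx j : differentiable (fun y : E => y 0 j) x by exact: differentiable_coord.
have : pderiv i (fun y : E => enorm y * enorm y) x = pderiv i (fun y : E => dot y y) x.
  by congr (pderiv i _ x); apply/funext => y; rewrite -expr2 enorm_sqr.
rewrite {1}/pderiv deriveM; [|exact: diff_derivable..].
rewrite /pderiv /dot.
rewrite -[X in _ = 'D_ _ X x](_ : \sum_j (fun y : E => y 0 j * y 0 j) = _); last first.
  by apply/funext => y; rewrite fct_sumE.
rewrite derive_sum; last by move=> j; apply: derivableM; apply: diff_derivable; exact: dx.
have dxE j : 'D_(delta_mx 0 i) (fun y : E => y 0 j) x = (i == j)%:R.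
  by rewrite -(derive_coord _ _ (F := id)) // derive_id mxE eqxx eq_sym.
rewrite (bigD1 i) //= big1 ?addr0 => [|j ji].
  rewrite deriveM; [|exact: diff_derivable..]; rewrite dxE eqxx.
  move: ('D_ _ (@enorm R n.+1) x) => D h.
  have {}h : enorm x * D + enorm x * D = x 0 i * 1 + x 0 i * 1 := h.
  by apply: (mulfI e0); rewrite mulVKf //; lra.
rewrite deriveM; [|exact: diff_derivable..].
by rewrite dxE eq_sym (negbTE ji) scaler0 addr0.
Qed.

Lemma pjac_cone x : x != 0 ->
  pjac (cone g) x = enorm x *: Jac (post_incl g) x +
    ((enorm x)^-1 *: x)^T *m radial_ext (post_incl g) x.
Proof.
move=> x0; apply/matrixP => i j; rewrite [LHS]mxE [RHS]mxE [in RHS]mxE.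
rewrite [X in _ = _ * X + _]mxE [X in _ = _ + X]mxE big_ord1 [X in _ = _ + X * _]mxE.
rewrite [X in _ = _ + X * _]mxE.
have de : differentiable (@enorm R n.+1) x by exact: (Ck_on_diff (Ck_on_enorm 0%N) x0).
transitivity (pderiv i (fun y => enorm y * radial_ext (post_incl g) y 0 j) x).
  by congr (pderiv i _ x); apply/funext => y; rewrite mxE.
rewrite {1}/pderiv deriveM; first last.
- by apply: diff_derivable; exact: smooth_coord_differentiable.
- exact: diff_derivable.
by congr (_ + _); rewrite -/(pderiv i _ x) pderiv_enorm // -[LHS]/(_ * _) mulrC.
Qed.

(** Along the ray through [p] the derivative is constantly [Jac + p^T *m g p], the matrix of
    [frame_unitmx] with [g p] as the unit normal. *)
Lemma pjac_cone_unit x : x != 0 -> pjac (cone g) x \in unitmx.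
Proof.
move=> x0; rewrite pjac_cone //.
have [p [xE gE]] := neq0_sphere_scale x0.
have e0 : 0 < enorm x by rewrite enorm_gt0.
rewrite gE; have -> : (enorm x)^-1 *: x = val p.
  by rewrite {2}xE scalerA mulVf ?scale1r // gt_eqF.
have -> : Jac (post_incl g) x = (enorm x)^-1 *: Jac (post_incl g) (val p).
  by rewrite {1}xE JacZ // (sphere_neq0 (valS p)).
rewrite scalerA mulfV ?gt_eqF // scale1r.
apply: frame_unitmx; [exact: nd|exact: valS|].
by have := post_incl_normal sg (sphere_neq0 (valS p)); rewrite radial_ext_val.
Qed.

Let dG x j : U x -> differentiable (fun y => cone g y 0 j) x.
Proof. by move=> x0; exact: (Ck_on_diff (Ck_on_cone sg j 0%N) x0). Qed.

Let cG x i j : U x -> {for x, continuous (pderiv i (fun y => cone g y 0 j))}.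
Proof.
move=> x0; apply: (@differentiable_continuous _ _ _ x (pderiv i (fun y => cone g y 0 j))).
by have [_ _ /(_ i) H] := Ck_on_cone sg j 1%N; exact: (@Ck_on_diff _ _ U 0 _ x H x0).
Qed.

Let coneK x : K x -> K (cone g x).
Proof. by move=> /sphere_elt [p <-]; rewrite cone_sphere; exact: valS. Qed.

Lemma cone_continuous x : x != 0 -> {for x, continuous (cone g)}.
Proof.
move=> x0; apply: (@cvg_row _ _ (nbhs x) _) => j.
by apply: (@differentiable_continuous _ _ _ _ (fun y => cone g y 0 j)); exact: dG.
Qed.

Lemma cone_locally_injective : exists2 e : R, 0 < e &
  forall x y, K x -> K y -> `|x - y| < e -> cone g x = cone g y -> x = y.
Proof.
have [|e e0 H] := @compact_uniform_eps R E K
  (fun e x => forall y, K y -> `|x - y| < e -> cone g x = cone g y -> x = y)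
  (@sphere_compact R n); last by exists e => // x y Kx; apply: H.
move=> x0 /sphere_neq0 x00.
have [r [c [r0 c0 Hinj _]]] := local_inverse oU dG cG x00 (pjac_cone_unit x00).
exists (ball x0 (r / 2), [set d | 0 < d /\ d < r / 2]) => /=.
  split; first by apply: nbhsx_ballx; rewrite divr_gt0.
  by apply: near_right_lt; rewrite divr_gt0.
move=> [x d] /= [xx [d0 dr]] _ y _ xy gxy.
have b1 : ball x0 r x.
  by apply: le_ball xx; rewrite ler_pdivrMr // ler_peMr ?ltW // ltr1n.
have b2 : ball x0 r y.
  rewrite -ball_normE /=; move: xx; rewrite -ball_normE /= => xx.
  by have h := ler_distD x x0 y; lra.
have := Hinj x y b1 b2; rewrite gxy subrr normr0 pmulr_rle0 // normr_le0 subr_eq0.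
by move=> /eqP.
Qed.

Lemma enorm_cone h x : x != 0 -> enorm (cone h x) = enorm x.
Proof.
move=> x0; have [p [_ hE]] := neq0_sphere_scale x0.
by rewrite /cone hE enormZ (enorm_sphere (valS _)) mulr1 ger0_norm // sqrtr_ge0.
Qed.

(** [local_inverse] finds a preimage in the ambient space; it lies on the sphere because the
    degree-one extension preserves the norm. *)
Lemma cone_locally_open (e : R) : 0 < e -> exists2 d : R, 0 < d &
  forall x w, K x -> K w -> `|w - cone g x| < d ->
    exists y, [/\ K y, `|y - x| < e & cone g y = w].
Proof.
move=> e0; have [|d d0 H] := @compact_uniform_eps R E K
  (fun d x => forall w, K w -> `|w - cone g x| < d ->
     exists y, [/\ K y, `|y - x| < e & cone g y = w])
  (@sphere_compact R n); last by exists d => // x w Kx; apply: H.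
move=> x0 /sphere_neq0 x00.
have [r [c [r0 c0 _ Hop]]] := local_inverse oU dG cG x00 (pjac_cone_unit x00).
have [m m0 mP] : exists2 m : R, 0 < m & forall y, `|y - x0| < m -> y != 0.
  by exists `|x0|; rewrite ?normr_gt0 // => y h; apply: contraTneq h => ->; rewrite sub0r normrN ltxx.
(* The preimage moves by at most [s] from a point within [s] of [x0]: [r / 4] keeps it where the
   inverse exists, [m / 4] away from the origin, and [e / 2] makes the final estimate strict. *)
pose s := Num.min (e / 2) (Num.min (r / 4) (m / 4)).
have s0 : 0 < s by rewrite !lt_min !divr_gt0.
have se : s < e by apply: (@le_lt_trans _ _ (e / 2)); [rewrite ge_min lexx|rewrite ltr_pdivrMr // ltr_pMr // ltr1n].
have sr : s <= r / 4 by rewrite !ge_min lexx orbT.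
have sm : s <= m / 4 by rewrite !ge_min lexx !orbT.
exists (ball x0 s, [set d | 0 < d /\ d < c * s]) => /=.
  by split; [exact: nbhsx_ballx|apply: near_right_lt; rewrite mulr_gt0].
move=> [x d] /= [xx [d0 dr]] Kx w Kw wx.
move: xx; rewrite -ball_normE /= => xx.
have [||z zx gz] := Hop x s w s0.
- move=> y; rewrite closed_ballE // /closed_ball_ /= -ball_normE /= => xy.
  by have h := ler_distD x x0 y; lra.
- exact: lt_trans wx dr.
have z0 : z != 0.
  apply: mP; have h := ler_distD x z x0; rewrite (distrC x x0) in h; lra.
exists z; split => //; last exact: le_lt_trans se.
rewrite /sphere /= -enorm_sqr -(enorm_cone g z0) gz enorm_sqr; exact: Kw.
Qed.

Lemma sphere_map_bijective : exists h : S -> S, cancel g h /\ cancel h g.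
Proof.
have inj := covering_injective n2 coneK (fun x Kx => cone_continuous (sphere_neq0 Kx))
  cone_locally_injective cone_locally_open.
have sur := covering_surjective n2 coneK cone_locally_open.
have /choice [h hP] : forall q : S, exists p : S, g p = q.
  move=> q; have [x /sphere_elt [p <-]] := sur _ (valS q).
  by rewrite cone_sphere => gp; exists p; apply: val_inj.
exists h; split => // p; apply: val_inj; apply: inj; try exact: valS.
by rewrite !cone_sphere hP.
Qed.

Section Inverse.
Variable h : S -> S.
Hypotheses (gh : cancel g h) (hg : cancel h g).

Lemma coneKV x : x != 0 -> cone g (cone h x) = x.
Proof.
move=> x0; rewrite cone_comp //; have [p [-> _]] := neq0_sphere_scale x0.
by rewrite cone_scale ?enorm_gt0 //= hg.
Qed.

Lemma coneVK x : x != 0 -> cone h (cone g x) = x.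
Proof.
move=> x0; rewrite cone_comp //; have [p [-> _]] := neq0_sphere_scale x0.
by rewrite cone_scale ?enorm_gt0 //= gh.
Qed.

(** Quantitative openness of [cone g] at [x] places a preimage of each nearby [w] within [s] of [x],
    and injectivity identifies it with [cone h w]. *)
Lemma cone_inverse_continuous y : y != 0 -> {for y, continuous (cone h)}.
Proof.
move=> y0; set x := cone h y; have x0 : x != 0 by exact: cone_neq0.
have gx : cone g x = y by exact: coneKV.
have [r [c [r0 c0 _ Hop]]] := local_inverse oU dG cG x0 (pjac_cone_unit x0).
apply/(@cvgrPdist_lt _ _ _ (nbhs y) _) => e e0.
have nx : 0 < `|x| by rewrite normr_gt0.
pose s := Num.min (e / 2) (Num.min (r / 2) (`|x| / 2)).
have s0 : 0 < s by rewrite !lt_min !divr_gt0.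
have se : s < e by apply: (@le_lt_trans _ _ (e / 2)); [rewrite ge_min lexx|rewrite ltr_pdivrMr // ltr_pMr // ltr1n].
have sr : s <= r / 2 by rewrite !ge_min lexx orbT.
have sm : s <= `|x| / 2 by rewrite !ge_min lexx !orbT.
near=> w.
have wy : `|w - cone g x| < c * s.
  rewrite gx distrC; near: w; apply: (@cvgr_dist_lt _ _ _ _ _ id y) => //; by rewrite mulr_gt0.
have [|z zx gz] := Hop x s w s0 _ wy.
  move=> z; rewrite closed_ballE // /closed_ball_ /= -ball_normE /= => xz.
  by move: r0; lra.
have z0 : z != 0.
  apply: contraTneq zx => ->; rewrite sub0r normrN -ltNge; lra.
rewrite -gz coneVK // distrC; exact: le_lt_trans se.
Unshelve. all: by end_near. Qed.

Lemma cone_inverse_differentiable y j : y != 0 ->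
  differentiable (fun w => cone h w 0 j) y /\
  forall i, pderiv i (fun w => cone h w 0 j) y = invmx (pjac (cone g) (cone h y)) i j.
Proof.
move=> y0; set x := cone h y; have x0 : x != 0 by exact: cone_neq0.
have gx : cone g x = y by exact: coneKV.
have uJ := pjac_cone_unit x0.
have [r [c [r0 c0 Hinj _]]] := local_inverse oU dG cG x0 uJ.
set B := invmx _.
have [k k0 kP] := mulmx_norm_le B.
have linB : linear (fun v : E => (v *m B) 0 j).
  by move=> a u v; rewrite mulmxDl -scalemxAl !mxE.
pose LB := GRing.isLinear.Build _ _ _ _ _ linB.
pose Lj : {linear E -> R} := HB.pack (fun v : E => (v *m B) 0 j) LB.
have [dH dE] : differentiable (fun w => cone h w 0 j) y /\ 'd (fun w => cone h w 0 j) y = Lj :> (E -> R).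
  apply: eps_differentiable; first exact: mulmx_coord_continuous.
  move=> e e0.
  (* [k] bounds the inverse matrix and [c] is the expansion constant of [cone g]: the error
     [k * (e * c / k) * |z - x|] is at most [e * |w - y|]. *)
  have [|r1 r10 [_ H]] := strict_differentiable_row oU dG cG x0 (e := e * c / k).
    by rewrite divr_gt0 // mulr_gt0.
  have m0 : 0 < Num.min r r1 by rewrite lt_min r0 r10.
  have cy : \forall w \near y, `|x - cone h w| < Num.min r r1.
    exact: ((@cvgrPdist_lt _ _ _ (nbhs y) _ _ _).1 (cone_inverse_continuous y0) _ m0).
  near=> w.
  have w0 : w != 0 by near: w; exact: near_neq0.
  have zx : `|x - cone h w| < Num.min r r1 by near: w; exact: cy.
  pose z := cone h w; have gz : cone g z = w by exact: coneKV.
  rewrite -/z in zx.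
  have b1 : ball x r z by rewrite -ball_normE /=; apply: lt_le_trans zx _; rewrite ge_min lexx.
  have b2 : ball x r1 z by rewrite -ball_normE /=; apply: lt_le_trans zx _; rewrite ge_min lexx orbT.
  have h1 := Hinj z x b1 (ballxx x r0).
  have h2 := H z x b2 (ballxx x r10).
  rewrite gz gx in h1 h2.
  have -> : cone h w 0 j - cone h y 0 j - Lj (w - y) =
      - ((w - y - (z - x) *m pjac (cone g) x) *m B) 0 j.
    rewrite mulmxBl mulmxK // -/z -/x /= !mxE; ring.
  rewrite normrN; apply: le_trans (coord_le_norm _ j) _.
  apply: le_trans (kP _) _.
  apply: le_trans (ler_wpM2l (ltW k0) h2) _.
  have -> : k * (e * c / k * `|z - x|) = e * (c * `|z - x|).
    by field; rewrite gt_eqF.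
  by apply: ler_wpM2l h1; exact: ltW.
split => // i; rewrite /pderiv deriveE // dE /=.
by rewrite -rowE mxE.
Unshelve. all: by end_near. Qed.

Lemma Ck_on_invmx_pjac i j k : Ck_on U k (fun x => invmx (pjac (cone g) x) i j).
Proof.
have sJ i' j' k' : Ck_on U k' (fun x => pjac (cone g) x i' j').
  apply: (Ck_on_ext oU (Phi := pderiv i' (fun y => cone g y 0 j'))).
    by move=> x _; rewrite mxE.
  by have [_ _] := Ck_on_cone sg j' k'.+1; apply.
apply: (Ck_on_ext oU (Phi := fun x => (\det (pjac (cone g) x))^-1 *
    ((-1) ^+ (j + i) * \det (row' j (col' i (pjac (cone g) x)))))).
  by move=> x x0; rewrite /invmx pjac_cone_unit // !mxE.
apply: Ck_family_mul => //.
  apply: Ck_family_inv => //; last by apply: Ck_family_det.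
  by move=> _ x _ x0; rewrite -unitfE -unitmxE pjac_cone_unit.
apply: Ck_family_mul => //; first exact: Ck_on_const.
apply: (@Ck_family_det _ _ _ _ _ _ _ _ _ _ _ _ (fun _ x => row' j (col' i (pjac (cone g) x)))) => // i' j' k'.
apply: (Ck_on_ext oU (Phi := fun x => pjac (cone g) x (lift j i') (lift i j'))) => //.
by move=> x _; rewrite !mxE.
Qed.

(** Bootstrapping: a partial derivative of the inverse is an entry of the inverse Jacobian matrix of
    [cone g] composed with the inverse itself, and the latter is only needed to the order already
    known. *)
Lemma Ck_on_cone_inverse k j : Ck_on U k (fun x => cone h x 0 j).
Proof.
elim: k j => [|k IH] j; split => //.
- by move=> _ x _ x0; have [] := cone_inverse_differentiable j x0.
- by move=> _ x _ x0; have [] := cone_inverse_differentiable j x0.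
move=> i; apply: (Ck_on_ext oU (Phi := fun y => (fun x => invmx (pjac (cone g) x) i j) (cone h y))).
  by move=> x x0; have [_ ->] := cone_inverse_differentiable j x0.
apply: (@Ck_family_comp _ _ _ _ _ _ _ _ _ _ _ _ _ _ U k (fun x => invmx (pjac (cone g) x) i j) (fun _ => cone h)) => //.
- exact: Ck_on_invmx_pjac.
- by move=> _ x _; exact: cone_neq0.
Qed.

End Inverse.

Theorem nondeg_diffeomorphism : diffeomorphism g.
Proof.
split => //; have [h [gh hg]] := sphere_map_bijective.
exists h; split => //; apply: smooth_cone => j k.
exact: Ck_on_cone_inverse gh hg k j.
Qed.

End InverseDiffeomorphism.

(** * The homotopy equivalences *)

Section Diffeomorphisms.
Context {R : realType} {n : nat}.
Local Notation E := 'rV[R]_n.+1.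
Local Notation S := (set_type (sphere R n)).
Local Notation U := ([set x : E | x != 0]).
Implicit Types g h : S -> S.

Lemma cone_id (x : E) : x != 0 -> cone (id : S -> S) x = x.
Proof.
move=> x0; have [p [xE _]] := neq0_sphere_scale x0.
by rewrite {1}xE cone_scale ?enorm_gt0 // -xE.
Qed.

Lemma smooth_id : smooth (post_incl (id : S -> S)).
Proof.
apply: smooth_cone => j k.
apply: (Ck_on_ext (@open_neq0 R n) (Phi := fun x => x 0 j)).
  by move=> x x0; rewrite cone_id.
by apply: Ck_family_coord => //; exact: open_neq0.
Qed.

(** The matrix in [odet] is the Jacobian of the degree-one extension, and that extension of the
    identity is the identity off the origin. *)
Lemma odet_id (p : S) : odet id p = 1.
Proof.
have p0 := val_neq0 p.
rewrite /odet -[RHS](det1 R n.+1); congr (\det _).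
have := pjac_cone smooth_id p0; rewrite (enorm_sphere (valS p)) invr1 !scale1r radial_ext_val.
move=> <-; apply/matrixP => i j; rewrite !mxE.
transitivity (pderiv i (fun x : E => x 0 j) (val p)).
  apply: near_eq_derive; near=> y; rewrite cone_id //.
  by near: y; exact: near_neq0.
rewrite /pderiv -(derive_coord _ _ (F := id)) // derive_id mxE eqxx /= eq_sym.
by [].
Unshelve. all: by end_near. Qed.

Lemma diffeomorphism_comp g h : diffeomorphism g -> diffeomorphism h ->
  diffeomorphism (g \o h).
Proof.
move=> [sg [g' [sg' gg' g'g]]] [sh [h' [sh' hh' h'h]]].
split; first exact: (smooth_compose (h := post_incl g)).
exists (h' \o g'); split; first exact: (smooth_compose (h := post_incl h')).
- by move=> p /=; rewrite gg' hh'.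
- by move=> p /=; rewrite h'h g'g.
Qed.

(** The values 1 and -1 of [s] give the two orientation classes; with the sign as a parameter, the
    homotopy argument is carried out once, and signs multiply under composition. *)
Definition Diff_sign (s : R) : set (Cinfty_self R n) :=
  [set g | diffeomorphism g /\ forall p, 0 < s * odet g p].

Lemma Diff_signM s1 s2 g h : Diff_sign s1 g -> Diff_sign s2 h ->
  Diff_sign (s1 * s2) (g \o h : S -> S).
Proof.
move=> [dg og] [dh oh]; split; first exact: diffeomorphism_comp.
move=> p; rewrite odet_comp; [|exact: dg.1|exact: dh.1].
have -> : s1 * s2 * (odet h p * odet g (h p)) = (s1 * odet g (h p)) * (s2 * odet h p) by ring.
by rewrite mulr_gt0.
Qed.

Lemma Diff_sign_inverse s g h : s ^+ 2 = 1 -> Diff_sign s g ->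
  smooth (post_incl h) -> cancel g h -> cancel h g -> Diff_sign s h.
Proof.
move=> s2 [[sg _] og] sh gh hg; split; first by split => //; exists g.
move=> p; have := odet_id p.
have -> : id = g \o h by apply/funext => q /=; rewrite hg.
rewrite odet_comp // => e.
have : 0 < (s * odet g (h p)) * (s * odet h p).
  by rewrite mulrACA -expr2 s2 mul1r mulrC e ltr01.
by rewrite pmulr_rgt0.
Qed.

Hypothesis n0 : (0 < n)%N.

Lemma Diff_plusE : Diff_plus R n = Diff_sign 1.
Proof.
apply/seteqP; split=> g [dg og]; split => //.
  by move=> p; rewrite mul1r; exact: (orientation_preservingP n0 dg.1).1.
by apply/(orientation_preservingP n0 dg.1) => p; rewrite -[odet _ _]mul1r.
Qed.

Lemma Diff_minusE : Diff_minus R n = Diff_sign (-1).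
Proof.
apply/seteqP; split=> g [dg og]; split => //.
  by move=> p; rewrite mulN1r oppr_gt0; exact: (orientation_reversingP n0 dg.1).1.
by apply/(orientation_reversingP n0 dg.1) => p; rewrite -oppr_gt0 -mulN1r.
Qed.

End Diffeomorphisms.

Section Topology.
Context {R : realType} {n : nat}.
Local Notation S := (set_type (sphere R n)).
Local Notation K := (sphere R n).
Context {T : Type}.
Variables (F : set_system T) (A : set T) (t0 : T).
Hypotheses (FF : Filter F) (FA : F A) (At0 : A t0).

Lemma cvg_Cinfty_smooth_family m (f : T -> Cinfty R n m) : (forall t, A t -> smooth (f t)) ->
  f @ F --> f t0 <-> smooth_family F A t0 K (fun t => radial_ext (f t)).
Proof. exact: cvg_CinftyP. Qed.

Lemma cvg_Cinfty_self_smooth_family (g : T -> Cinfty_self R n) :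
  (forall t, A t -> smooth (post_incl (g t))) ->
  g @ F --> g t0 <-> smooth_family F A t0 K (fun t => radial_ext (post_incl (g t))).
Proof.
move=> sg; have H := cvg_Cinfty_smooth_family (f := fun t => post_incl (g t)) sg.
have -> : (g @ F --> g t0) <-> ((fun t => post_incl (g t)) @ F --> post_incl (g t0)).
  exact: cvg_initial.
exact: H.
Qed.

End Topology.

(** * The two equivalences for a fixed curvature interval *)

Section Main.
Context {R : realType} {n : nat}.
Hypothesis n2 : (2 <= n)%N.
Let n0 : (0 < n)%N. Proof. exact: ltnW. Qed.
Local Notation E := 'rV[R]_n.+1.
Local Notation S := (set_type (sphere R n)).
Local Notation K := (sphere R n).
Local Notation U := ([set x : E | x != 0]).
Variable I : set R.
Hypotheses (hI : is_interval I) (hI0 : ~ I 0).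
Local Notation FI := (curvature_space n I).
Implicit Types f : Cinfty R n n.+1.

Lemma curvature_spaceP f : FI f -> immersion f /\
  forall (p : S) k, eigen (val p) (Jac f (val p)) (Jac (post_incl (gauss_map f)) (val p)) k -> I k.
Proof.
move=> [imf H]; split => // p k /(principal_curvatureP n0 imf); exact: H.
Qed.

Lemma gauss_map_diffeomorphism f : FI f -> diffeomorphism (gauss_map f).
Proof.
move=> /curvature_spaceP [imf H]; apply: nondeg_diffeomorphism => //.
  exact: smooth_gauss.
by move=> p; exact: (curvature_nondeg (immersion_curvature_data n0 imf p) (H p) hI0).
Qed.

(** Here [e] is the sign of the pairing of [df v] with [dnu v], opposite to that of the curvatures.
    It depends on [I] only, so all Gauss maps lie in one orientation class. *)
Lemma gauss_map_sign : exists e : R, [/\ e = 1 \/ e = -1,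
  (forall f, FI f -> (e = -1 <-> forall k, I k -> 0 < k)) &
  forall f, FI f -> Diff_sign (e ^+ n) (gauss_map f)].
Proof.
have main e : (e = 1 \/ e = -1) -> (forall f, FI f -> forall p : S, forall v,
    dot v (val p) = 0 -> v != 0 -> 0 < e * dot (v *m Jac f (val p))
      (v *m Jac (post_incl (gauss_map f)) (val p))) ->
    forall f, FI f -> Diff_sign (e ^+ n) (gauss_map f).
  move=> e1 H f Ff; split; first exact: gauss_map_diffeomorphism.
  move=> p; have [imf Hf] := curvature_spaceP Ff.
  apply: (gauss_orientation (immersion_curvature_data n0 imf p) (Hf p) hI0).
    by case: e1 => ->; rewrite ?expr1n // sqrrN expr1n.
  exact: H.
have p0 : exists p : S, True.
  have := @generic_vector R n [:: const_mx 1] => -[|m _].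
    move=> w; rewrite inE => /eqP ->; apply/eqP => /rowP /(_ 0); rewrite !mxE => /eqP.
    by rewrite oner_eq0.
  have w0 : (const_mx 1 : E) != 0.
    by apply/eqP => /rowP /(_ 0); rewrite !mxE => /eqP; rewrite oner_eq0.
  by have [p _ _] := radial_ext_ex w0; exists p.
(* If the curvatures are negative, an element of [I] is needed to refute that [I] is positive, which
   would hold vacuously for an empty [I]. *)
have nonempty f : FI f -> exists k, I k.
  have [p _] := p0; move=> /curvature_spaceP [imf H].
  have [k1 [_ [Ik1 _ _]]] := curvature_bounds n0 (immersion_curvature_data n0 imf p) (H p) hI0.
  by exists k1.
case: (interval_sign hI hI0) => sg.
  exists (-1); split; [by right|by []|].
  apply: main; first by right.
  move=> f /curvature_spaceP [imf H] p v vp v0; rewrite mulN1r oppr_gt0.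
  exact: (curvature_pos n0 (immersion_curvature_data n0 imf p) (H p) hI0).
exists 1; split; [by left| |].
  move=> f /nonempty [k Ik]; split=> [/eqP|/(_ k Ik)]; last by rewrite lt_gtF // sg.
  by rewrite -addr_eq0 -mulr2n pnatr_eq0.
apply: main; first by left.
move=> f /curvature_spaceP [imf H] p v vp v0; rewrite mul1r.
exact: (curvature_neg n0 (immersion_curvature_data n0 imf p) (H p) hI0).
Qed.

Section Reparametrization.
Variables (f : Cinfty R n n.+1) (g : Cinfty_self R n).
Hypotheses (imf : immersion f) (dg : Diff_sign 1 g).
Let fg : Cinfty R n n.+1 := f \o g.
Let sg : smooth (post_incl g) := dg.1.1.

Let JE (p : S) : Jac fg (val p) = Jac (post_incl g) (val p) *m Jac f (val (g p)).
Proof. by rewrite Jac_comp //; exact: imf.1. Qed.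

Let gT (p : S) : (val (g p)) *m (Jac (post_incl g) (val p))^T = 0.
Proof. by have := post_incl_normal sg (val_neq0 p); rewrite radial_ext_val. Qed.

Lemma Diff_nondeg (p : S) : nondeg (val p) (Jac (post_incl g) (val p)).
Proof.
split; [exact: valS|exact: Jac_radial (val_neq0 p)|move=> v vp vJ].
have uM : Jac (post_incl g) (val p) + (val p)^T *m val (g p) \in unitmx.
  by rewrite unitmxE unitfE gt_eqF //; have := dg.2 p; rewrite mul1r.
by rewrite -(mulmxK uM v) mulmxD_outer vp scale0r addr0 vJ mul0mx.
Qed.

Lemma reparametrization_immersion : immersion fg.
Proof.
apply/immersionP; split; first exact: smooth_compose imf.1 sg.
move=> p; have [pp pJ inj] := Diff_nondeg p.
have [_ _ injf] := ((immersionP f).1 imf).2 (g p).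
split => //; first by rewrite JE mulmxA pJ mul0mx.
move=> v vp; rewrite JE mulmxA => h; apply: inj => //; apply: injf => //.
by rewrite dot_mulmx gT dot0r.
Qed.

(** The image hyperplane at [p] is that of [f] at [g p], so only the orientation is at stake: the
    framed determinant of [f o g] is the product of [odet g p], which is positive, and that of [f]
    at [g p]. *)
Lemma reparametrization_gauss : gauss_map fg = gauss_map f \o g.
Proof.
apply/funext => p; apply: (gauss_map_unique n0 reparametrization_immersion).
have [n1 nJ d0] := gauss_map_normal n0 imf (g p).
split => //; first by rewrite JE trmx_mul mulmxA nJ mul0mx.
have -> : Jac fg (val p) + (val p)^T *m val (gauss_map f (g p)) =
   (Jac (post_incl g) (val p) + (val p)^T *m val (g p)) *m
   (Jac f (val (g p)) + (val (g p))^T *m val (gauss_map f (g p))).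
  have h1 : Jac (post_incl g) (val p) *m (val (g p))^T = 0.
    by have := congr1 trmx (gT p); rewrite trmx_mul trmxK trmx0.
  have h2 : val (g p) *m Jac f (val (g p)) = 0.
    by apply: Jac_radial (val_neq0 _); exact: imf.1.
  have h3 : val (g p) *m (val (g p))^T = 1%:M.
    by rewrite [LHS]mx11_scalar -dotE (valS (g p)).
  rewrite mulmxDl !mulmxDr -JE [X in _ = _ + X + _]mulmxA h1 mul0mx addr0.
  by rewrite -mulmxA h2 mulmx0 add0r -mulmxA (mulmxA (val (g p))) h3 mul1mx.
by rewrite det_mulmx mulr_gt0 //; have := dg.2 p; rewrite mul1r.
Qed.

(** The differential of [g] takes a principal direction of [f o g] to one of [f] with the same
    curvature. *)
Lemma reparametrization_curvature : FI f -> FI fg.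
Proof.
move=> /curvature_spaceP [_ H]; split; first exact: reparametrization_immersion.
move=> p k /(principal_curvatureP n0 reparametrization_immersion) [v [vp v0]].
rewrite reparametrization_gauss JE.
rewrite -[post_incl _]/(post_incl (gauss_map f) \o g) Jac_comp //; last exact: smooth_gauss.
rewrite !mulmxA => vL; apply: (H (g p)); exists (v *m Jac (post_incl g) (val p)).
split => //; first by rewrite dot_mulmx gT dot0r.
have [_ _ inj] := Diff_nondeg p.
by apply: contra_neq v0; exact: inj.
Qed.

End Reparametrization.

Definition blend (f1 f : Cinfty R n n.+1) (t : R) : Cinfty R n n.+1 :=
  fun p => (1 - t) *: f1 p + t *: f p.

Lemma radial_ext_blend f1 f t x : x != 0 ->
  radial_ext (blend f1 f t) x = (1 - t) *: radial_ext f1 x + t *: radial_ext f x.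
Proof. by move=> x0; have [p _ H] := radial_ext_ex x0; rewrite !H. Qed.

Lemma smooth_family_blend (T : Type) (F : set_system T) (A : set T) (t0 : T) (K0 : set E)
    (FF : Filter F) (FA : F A) (At0 : A t0) (KU : K0 `<=` U)
    (f1 f : T -> Cinfty R n n.+1) (a : T -> R) : a @ F --> a t0 ->
  smooth_family F A t0 K0 (fun t => radial_ext (f1 t)) ->
  smooth_family F A t0 K0 (fun t => radial_ext (f t)) ->
  smooth_family F A t0 K0 (fun t => radial_ext (blend (f1 t) (f t) (a t))).
Proof.
move=> ca H1 H j k.
apply: (Ck_family_ext FF FA At0 (@open_neq0 R n) KU (G := fun t x =>
  (1 - a t) * radial_ext (f1 t) x 0 j + a t * radial_ext (f t) x 0 j)).
  by move=> t x At Ux; rewrite radial_ext_blend // !mxE.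
have oU := @open_neq0 R n.
apply: Ck_family_add => //; apply: Ck_family_mul => //; apply: Ck_family_param => //.
exact: (cvgB (cvg_cst _) ca).
Qed.

Lemma smooth_blend f1 f t : smooth f1 -> smooth f -> smooth (blend f1 f t).
Proof.
move=> s1 s; apply/smooth_constant_family.
apply: (@smooth_family_blend _ _ _ _ _ _ _ _ _ (fun=> f1) (fun=> f) (fun=> t)) => //.
- exact: cvg_cst.
- exact/smooth_constant_family.
- exact/smooth_constant_family.
Qed.

Lemma Jac_blend f1 f t x : smooth f1 -> smooth f -> x != 0 ->
  Jac (blend f1 f t) x = (1 - t) *: Jac f1 x + t *: Jac f x.
Proof.
move=> s1 s x0; apply/matrixP => i j; rewrite !mxE.
transitivity (pderiv i (fun y => (1 - t) * radial_ext f1 y 0 j + t * radial_ext f y 0 j) x).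
  apply: near_eq_derive; near=> y; rewrite radial_ext_blend ?mxE //.
  by near: y; exact: near_neq0.
pose F1 y := radial_ext f1 y 0 j; pose F2 y := radial_ext f y 0 j.
have d1 : derivable F1 x (delta_mx 0 i).
  by apply: diff_derivable; exact: smooth_coord_differentiable.
have d2 : derivable F2 x (delta_mx 0 i).
  by apply: diff_derivable; exact: smooth_coord_differentiable.
rewrite -[LHS]/('D_(delta_mx 0 i) ((1 - t) *: F1 + t *: F2) x).
rewrite deriveD; [|exact: derivableZ|exact: derivableZ].
by rewrite !deriveZ.
Unshelve. all: by end_near. Qed.

(** [curvature_convex] is applied with the common differential of the Gauss maps. It first shows
    that the blend is an immersion with the same Gauss map; only then are its eigenvalues principal
    curvatures. *)
Lemma blend_curvature f1 f t : FI f1 -> FI f -> gauss_map f1 = gauss_map f ->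
  0 <= t <= 1 -> FI (blend f1 f t).
Proof.
move=> /curvature_spaceP [im1 H1] /curvature_spaceP [imf H] ge t01.
have sb : smooth (blend f1 f t) by apply: smooth_blend; [exact: im1.1|exact: imf.1].
have JbE (p : S) := @Jac_blend f1 f t _ im1.1 imf.1 (val_neq0 p).
have conv (p : S) : curvature_data (val p) (Jac (blend f1 f t) (val p))
      (Jac (post_incl (gauss_map f)) (val p)) (val (gauss_map f p)) /\
    (forall k, eigen (val p) (Jac (blend f1 f t) (val p))
      (Jac (post_incl (gauss_map f)) (val p)) k -> I k).
  have c1 := immersion_curvature_data n0 im1 p; have h1 := H1 p; rewrite ge in c1 h1.
  have c2 := immersion_curvature_data n0 imf p.
  by rewrite JbE; exact: (curvature_convex n0 hI hI0 c1 h1 c2 (H p) t01).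
have imb : immersion (blend f1 f t).
  apply/immersionP; split; first exact: sb.
  by move=> p; have [[nd _ _ _ _] _] := conv p; exact: nd.
have gb : gauss_map (blend f1 f t) = gauss_map f.
  apply/funext => p; apply: (gauss_map_unique n0 imb).
  by have [[_ nu _ _ _] _] := conv p; exact: nu.
split; first exact: imb.
move=> p k /(principal_curvatureP n0 imb); rewrite gb.
by have [_ H'] := conv p; exact: H'.
Qed.

Variable f0 : Cinfty R n n.+1.
Hypothesis hf0 : FI f0.
Variables (a : S -> S) (s : R).
Hypotheses (s2 : s * s = 1) (sa : smooth (post_incl a)).
Hypotheses (ga : cancel (gauss_map f0) a) (ag : cancel a (gauss_map f0)).
Hypothesis gauss_s : forall f, FI f -> Diff_sign s (gauss_map f).

Lemma inverse_Diff_sign : Diff_sign s a.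
Proof. exact: (Diff_sign_inverse _ (gauss_s hf0)). Qed.

(** As [a] is inverse to [gauss_map f0], this reparametrization of [f0] has Gauss map [g]: a section
    of the Gauss map over [Diff_sign s]. *)
Definition normal_form (g : Cinfty_self R n) : Cinfty R n n.+1 := f0 \o (a \o g).

Lemma Diff_sign_normalized g : Diff_sign s g -> Diff_sign 1 (a \o g : Cinfty_self R n).
Proof. by move=> dg; rewrite -s2; exact: (Diff_signM inverse_Diff_sign dg). Qed.

Lemma normal_form_space g : Diff_sign s g -> FI (normal_form g).
Proof.
by move=> /Diff_sign_normalized dg; apply: reparametrization_curvature => //; exact: hf0.1.
Qed.

Lemma normal_form_gauss g : Diff_sign s g -> gauss_map (normal_form g) = g.
Proof.
move=> /Diff_sign_normalized dg.
have := reparametrization_gauss hf0.1 dg; rewrite -/(normal_form g) => ->.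
by apply/funext => p /=; rewrite ag.
Qed.

Let smooth_f0a : smooth (f0 \o a).
Proof. exact: smooth_compose hf0.1.1 sa. Qed.

Let KU := @sphere_subU R n.

Lemma curvature_space_smooth f : FI f -> smooth f. Proof. by move=> [[]]. Qed.

Lemma compose_continuous m (h : S -> 'rV[R]_m) (A : set (Cinfty_self R n)) :
  smooth h -> (forall g, A g -> smooth (post_incl g)) ->
  {within A, continuous (fun g : Cinfty_self R n => (h \o g : Cinfty R n m))}.
Proof.
move=> sh sA; apply/subspace_continuousP => g Ag.
have FF : Filter (within A (nbhs g)) by exact: within_filter.
have FA : within A (nbhs g) A by exact: withinT.
apply/(@cvg_Cinfty_smooth_family R n _ _ A g FF FA Ag _ (fun g => h \o g)).
  by move=> g' Ag'; apply: smooth_compose => //; exact: sA.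
apply: (@smooth_family_comp R n _ _ A g K FF FA Ag KU _ h id sh).
apply/(@cvg_Cinfty_self_smooth_family R n _ _ A g FF FA Ag id sA).
exact: cvg_within.
Qed.

Lemma gauss_map_continuous : {within FI, continuous (@gauss_map R n)}.
Proof.
apply/subspace_continuousP => f Ff.
have FF : Filter (within FI (nbhs f)) by exact: within_filter.
have FA : within FI (nbhs f) FI by exact: withinT.
apply/(@cvg_Cinfty_self_smooth_family R n _ _ FI f FF FA Ff (@gauss_map R n)).
  by move=> f' [imf' _]; exact: smooth_gauss.
apply: (@smooth_family_gauss R n n0 _ _ FI f K FF FA Ff KU id); first by move=> f' [].
apply/(@cvg_Cinfty_smooth_family R n _ _ FI f FF FA Ff _ id); first by move=> f'; exact: curvature_space_smooth.
exact: cvg_within.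
Qed.

Lemma homotopic_refl (X : topologicalType) (A : set X) (h : X -> X) :
  (forall x, A x -> h x = x) -> @homotopic_in R X X A A h id.
Proof.
move=> hE; exists fst; split => //.
- by apply: continuous_subspaceT => x; exact: cvg_fst.
- by move=> x Ax /=; rewrite hE.
Qed.

(** The map [f0 o a o gauss_map f] is one composite of each equivalence, since [a] may be grouped
    with either neighbour; this homotopy therefore serves both. *)
Lemma normal_form_homotopy : @homotopic_in R _ _ FI FI (fun f => normal_form (gauss_map f)) id.
Proof.
exists (fun z => blend (normal_form (gauss_map z.1)) z.1 z.2); split.
(* For joint continuity the pair [(f, t)] is itself the parameter of the family, filtered by its
   neighbourhoods within the product of [FI] and the unit interval. *)
- apply/subspace_continuousP => -[f t] [/= Ff t01].
  set A := FI `*` _; set F := within A (nbhs (f, t)).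
  have FF : Filter F by exact: within_filter.
  have FA : F A by exact: withinT.
  have cfst : fst @ F --> f by apply: cvg_trans (@cvg_fst _ _ (nbhs f) (nbhs t) _); apply: cvg_app; exact: cvg_within.
  have csnd : snd @ F --> t by apply: cvg_trans (@cvg_snd _ _ (nbhs f) (nbhs t) _); apply: cvg_app; exact: cvg_within.
  have Aft : A (f, t) by split.
  have sA z : A z -> FI z.1 by case.
  have Gfst : smooth_family F A (f, t) K (fun z => radial_ext z.1).
    apply/(@cvg_Cinfty_smooth_family R n _ F A (f, t) FF FA Aft _ fst); last exact: cfst.
    by move=> z /sA; exact: curvature_space_smooth.
  apply/(@cvg_Cinfty_smooth_family R n _ F A (f, t) FF FA Aft _
    (fun z => blend (normal_form (gauss_map z.1)) z.1 z.2)).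
    move=> z /sA Fz; apply: smooth_blend; last exact: curvature_space_smooth.
    by apply: curvature_space_smooth; apply: normal_form_space; exact: gauss_s.
  apply: (@smooth_family_blend _ F A (f, t) K FF FA Aft KU
    (fun z => normal_form (gauss_map z.1)) fst snd csnd _ Gfst).
  apply: (@smooth_family_comp R n _ F A (f, t) K FF FA Aft KU _ (f0 \o a) (fun z => gauss_map z.1) smooth_f0a).
  by apply: (@smooth_family_gauss R n n0 _ F A (f, t) K FF FA Aft KU fst) => // z /sA [].
- move=> f t Ff t01.
  have Fg := normal_form_space (gauss_s Ff); have gg := normal_form_gauss (gauss_s Ff).
  exact: (blend_curvature Fg Ff gg t01).
- by move=> f Ff; apply/funext => p; rewrite /blend /= subr0 scale1r scale0r addr0.
- by move=> f Ff; apply/funext => p; rewrite /blend /= subrr scale0r scale1r add0r.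
Qed.

Lemma gauss_map_equivalence : homotopy_equivalence R FI (Diff_sign s) (@gauss_map R n).
Proof.
split; [by move=> f /gauss_s|exact: gauss_map_continuous|exists normal_form; split].
- by move=> g; exact: normal_form_space.
- by apply: (compose_continuous smooth_f0a) => g [[]].
- exact: normal_form_homotopy.
- by apply: homotopic_refl => g /normal_form_gauss.
Qed.

Lemma reparametrization_equivalence : homotopy_equivalence R (Diff_sign 1) FI
  (fun g : Cinfty_self R n => (f0 \o g : Cinfty R n n.+1)).
Proof.
split.
- by move=> g dg; exact: (reparametrization_curvature hf0.1 dg hf0).
- by apply: (compose_continuous hf0.1.1) => g [[]].
exists (fun f => a \o gauss_map f); split.
- by move=> f /gauss_s; exact: Diff_sign_normalized.
- apply/subspace_continuousP => f Ff.
  have FF : Filter (within FI (nbhs f)) by exact: within_filter.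
  have FA : within FI (nbhs f) FI by exact: withinT.
  have sA f' : FI f' -> smooth (post_incl (gauss_map f')) by move=> [imf' _]; exact: smooth_gauss.
  apply/(@cvg_Cinfty_self_smooth_family R n _ _ FI f FF FA Ff (fun f => a \o gauss_map f)).
    by move=> f' /sA; exact: (smooth_compose sa).
  apply: (@smooth_family_comp R n _ _ FI f K FF FA Ff KU _ (post_incl a) (@gauss_map R n) sa).
  apply/(@cvg_Cinfty_self_smooth_family R n _ _ FI f FF FA Ff (@gauss_map R n) sA).
  by have /subspace_continuousP := gauss_map_continuous; apply.
- apply: homotopic_refl => g dg /=.
  by rewrite (reparametrization_gauss hf0.1 dg); apply/funext => p /=; rewrite ga.
- exact: normal_form_homotopy.
Qed.

End Main.

Theorem proposition4p3 (R : realType) (n : nat) (hn : (2 <= n)%N)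
    (I : set R) (hI : is_interval I) (hI0 : ~ I 0)
    (f0 : Cinfty R n n.+1) (hf0 : curvature_space n I f0) :
  homotopy_equivalence R (Diff_plus R n) (curvature_space n I)
    (fun g : Cinfty_self R n => (f0 \o g : Cinfty R n n.+1)) /\
  (((forall k, I k -> 0 < k) /\ odd n) ->
    homotopy_equivalence R (curvature_space n I) (Diff_minus R n) gauss_map) /\
  (~ ((forall k, I k -> 0 < k) /\ odd n) ->
    homotopy_equivalence R (curvature_space n I) (Diff_plus R n) gauss_map).
Proof.
have n0 : (0 < n)%N by exact: ltnW.
have [e [e1 eI Hs]] := gauss_map_sign hn hI hI0.
have [_ [a [sa ga ag]]] := gauss_map_diffeomorphism hn hI0 hf0.
have s2 : e ^+ n * e ^+ n = 1.
  by rewrite -exprMn; case: e1 => ->; rewrite ?mulrNN mulr1 expr1n.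
have G := gauss_map_equivalence hn hI hI0 hf0 s2 sa ga ag Hs.
rewrite (Diff_plusE n0) (Diff_minusE n0).
split; first exact: (reparametrization_equivalence hn hI hI0 hf0 s2 sa ga ag Hs).
split=> [[Ip on]|H].
  have eN : e = -1 by apply/(eI _ hf0).
  by move: G; rewrite eN -signr_odd on expr1.
suff en : e ^+ n = 1 by move: G; rewrite en.
case: e1 => eE; first by rewrite eE expr1n.
rewrite eE -signr_odd; case: (boolP (odd n)) => [on|_]; last by rewrite expr0.
by case: H; split => //; apply/(eI _ hf0).
Qed.
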